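(* Let $n\in\{1,2,3,\dots\}$ and $\nu_n=2n+\tfrac32$. As $\nu\uparrow\nu_n$, each zero of $K_\nu$ converges to a non-real zero of $K_{\nu_n}$. That is, for each $\nu\in(\nu_n-2,\nu_n)$ the $2n$ zeros of $K_\nu$ can be enumerated as $z_1^{(\nu)},\dots,z_{2n}^{(\nu)}$ in such a way that, for every $j\in\{1,\dots,2n\}$, the limit $\lim_{\nu\uparrow\nu_n}z_j^{(\nu)}$ exists and is a non-real zero of $K_{\nu_n}$.
   Context: For real $\nu$, $K_\nu$ denotes the modified Bessel function of the second kind (Macdonald function). $K_\nu(z)$ is considered, by analytic continuation from $(0,\infty)$, as a holomorphic function of $z\in\mathbf{C}\setminus(-\infty,0]$ (principal branch). For $n=0,1,2,\dots$ put $\nu_n=2n+\frac32$. Zeros: for $\nu>\frac32$ not of the form $\nu_m$, the zeros of $K_\nu$ are its zeros in $\mathbf{C}\setminus(-\infty,0]$. It is known that when $\nu_{n-1}=\nu_n-2<\nu<\nu_n$ there are exactly $2n$ of them. For $\nu=\nu_n$ one has $$K_{\nu_n}(z)=\sqrt{\frac{\pi}{2z}}\,e^{-z}\sum_{k=0}^{2n+1}\frac{(\nu_n,k)}{(2z)^k},\qquad (\nu,0)=1,\quad (\nu,k)=\frac{(4\nu^2-1^2)(4\nu^2-3^2)\cdots(4\nu^2-(2k-1)^2)}{k!\,2^{2k}},$$ so the zeros of $K_{\nu_n}$ are by convention the $2n+1$ roots of the polynomial $\sum_{k=0}^{2n+1}\frac{(\nu_n,2n+1-k)}{2^{2n+1-k}}z^k$.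 It is known that exactly one of these is real; it is negative and is also regarded as a zero of $K_{\nu_n}$. The other $2n$ roots are the non-real zeros of $K_{\nu_n}$. *)

(* Defs.v *)
(* Stdlib real numbers, with Coquelicot for integrals, limits and C. *)
From Stdlib Require Import Reals Factorial List ClassicalEpsilon.
From Coquelicot Require Import Coquelicot.

Open Scope R_scope.

Definition slit_plane (z : C) : Prop := 0 < Re z \/ Im z <> 0.

Definition holomorphic_on (D : C -> Prop) (f : C -> C) : Prop :=
  forall z : C, D z -> ex_derive (K := C_AbsRing) (V := C_NormedModule) f z.

(* The Macdonald function on the half-line [x > 0]:
   K_nu(x) = int_0^oo exp(- x cosh t) cosh(nu t) dt. *)
Definition besselK_pos (nu x : R) : R :=
  RInt_gen (fun t : R => exp (- x * cosh t) * cosh (nu * t))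
    (at_point 0) (Rbar_locally p_infty).

Definition is_besselK (nu : R) (f : C -> C) : Prop :=
  holomorphic_on slit_plane f /\
  (forall x : R, 0 < x -> f (RtoC x) = RtoC (besselK_pos nu x)).

(* By the identity theorem [is_besselK nu] determines its argument on the slit
   plane; the values of [besselK nu] on the cut are irrelevant. *)
Definition besselK (nu : R) : C -> C :=
  epsilon (inhabits (fun _ : C => RtoC 0)) (is_besselK nu).

Definition besselK_zero (nu : R) (z : C) : Prop :=
  slit_plane z /\ besselK nu z = RtoC 0.

Definition nu_ (n : nat) : R := 2 * INR n + 3 / 2.

(* Hankel's symbol (nu, k). *)
Definition hankel (nu : R) (k : nat) : R :=
  fold_right Rmult 1
    (map (fun j : nat => 4 * nu ^ 2 - (2 * INR j - 1) ^ 2) (seq 1 k))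
  / (INR (fact k) * 2 ^ (2 * k)).

(* z^(2n+1) times the sum over k of (nu_n, k) / (2z)^k. *)
Definition besselK_nu_poly (n : nat) (z : C) : C :=
  sum_n (G := C_AbelianMonoid)
    (fun k : nat =>
       (RtoC (hankel (nu_ n) (2 * n + 1 - k) / 2 ^ (2 * n + 1 - k))
        * Cpow z k)%C)
    (2 * n + 1).

(* At nu = nu_n the zeros are by convention all roots of this polynomial, so
   that the negative real root, which lies on the cut, is counted as well. *)
Definition besselK_nu_zero (n : nat) (z : C) : Prop :=
  besselK_nu_poly n z = RtoC 0.

(* [u 0, ..., u (m - 1)] lists every element of [P] exactly once. *)
Definition enumerates (m : nat) (u : nat -> C) (P : C -> Prop) : Prop :=
  (forall j : nat, (j < m)%nat -> P (u j)) /\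
  (forall i j : nat, (i < m)%nat -> (j < m)%nat -> u i = u j -> i = j) /\
  (forall w : C, P w -> exists j : nat, (j < m)%nat /\ u j = w).

(* Main.v *)
(** Up to a nonzero constant, K_nu (z) = e^(-z) z^(-nu) H_m (2 z) on the slit plane, where
    m = nu - 1/2 and H_m (w) = int_0^oo e^(-s) s^m (s + w)^m ds.  So the zeros of K_nu are
    half the zeros of H_m, and the interval nu_n - 2 < nu < nu_n becomes 2n - 1 < m < 2n + 1.

    The zeros of H_m are simple, because H_m solves a second-order linear equation.  For m in
    the open interval no zero can reach the cut: on the boundary value at w = - p + i0 the
    integrand, turned by e^(- i pi (m - 2n) / 2), has positive real part.  No zero escapes to
    infinity either, since w^(-m) H_m (w) tends to a nonzero constant.  Hence the number of
    zeros is locally constant in m, and at m = 2n, where H_m is a polynomial with 2n simple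
    non-real roots, it is 2n.

    At m = 2n + 1, H_m is a polynomial of degree 2n + 1 with simple roots, at most one of them
    real.  As m increases to 2n + 1, each of the 2n non-real roots attracts exactly one zero of
    H_m, by a contraction argument, and this accounts for all 2n zeros. *)

From Stdlib Require Import Reals Lra Lia Psatz Factorial List FinFun.
From Stdlib Require Import Classical ClassicalEpsilon ClassicalChoice.
From Stdlib Require Import FunctionalExtensionality PropExtensionality.
From Coquelicot Require Import Coquelicot.
From mathcomp Require all_boot all_algebra separable complex Rstruct.
Require Import Defs.

Open Scope R_scope.
Set Bullet Behavior "Strict Subproofs".

(** * Complex derivatives *)

(** No contour integral counts the zeros. Simplicity makes each zero the centre of a contraction, so
    it moves continuously with m, and compactness leaves finitely many discs to inspect. Two
    obstacles shape the rest. [besselK] is known only through its values on the half-line, so H_m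
    has to be tied to the Macdonald integral: both give exponentially decaying solutions of the
    modified Bessel equation, their Wronskian vanishes, and an identity theorem on the slit plane
    carries the proportionality to complex arguments. The other obstacle is m = 2n + 1 itself. On
    the cut the boundary integrand takes only the directions 1 and e^(i pi (m - 2n)); they span an
    angle less than pi when |m - 2n| < 1, and turning back by half that angle puts both into the
    right half-plane. At m = 2n + 1 they are opposite and a root may lie on the cut. Hence the count
    2n is carried over from inside the interval, and 2n distinct zeros continued from the non-real
    roots must be all of them. *)

Lemma Im_le_Cmod (z : C) : Rabs (Im z) <= Cmod z.
Proof. exact (Rle_trans _ _ _ (Rmax_r _ _) (Rmax_Cmod z)). Qed.

Lemma Cmod_le_abs (z : C) : Cmod z <= Rabs (Re z) + Rabs (Im z).
Proof.
  destruct z as [x y]. unfold Cmod, Re, Im; simpl fst; simpl snd.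
  apply Rsqr_incr_0_var.
  - rewrite Rsqr_sqrt by nra. unfold Rsqr.
    pose proof (Rabs_pos x); pose proof (Rabs_pos y).
    assert (Rabs x * Rabs x = x * x) by (rewrite <- Rabs_mult; apply Rabs_pos_eq; nra).
    assert (Rabs y * Rabs y = y * y) by (rewrite <- Rabs_mult; apply Rabs_pos_eq; nra).
    nra.
  - pose proof (Rabs_pos x); pose proof (Rabs_pos y); lra.
Qed.

(** The remainder form with a non-strict bound admits h = 0, and the mean value and Taylor estimates
    consume it directly. [Cder_is_derive] and [Cder_is_derive_ring] connect it with the library
    derivative. *)
Definition Cder (f : C -> C) (z l : C) : Prop :=
  forall eps, 0 < eps -> exists d, 0 < d /\ forall h : C, Cmod h < d ->
    Cmod (f (z + h) - f z - h * l)%C <= eps * Cmod h.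

Lemma Cadd_sub (z y : C) : (z + (y - z))%C = y.
Proof. ring. Qed.

Lemma Cder_is_derive (f : C -> C) (z l : C) :
  Cder f z l <-> is_derive (K := C_AbsRing) (V := C_NormedModule) f z l.
Proof.
  split.
  - intros H. split.
    + apply is_linear_scal_l.
    + intros x Hx eps.
      apply (is_filter_lim_locally_unique (K := C_AbsRing) (V := AbsRing_NormedModule C_AbsRing)) in Hx.
      rewrite <- Hx; clear x Hx.
      destruct (H eps (cond_pos eps)) as (d & Hd & Hh).
      exists (mkposreal d Hd). intros y Hy.
      change (Cmod (y - z)%C < d) in Hy.
      specialize (Hh _ Hy).
      change (Cmod (f y - f z - (y - z) * l)%C <= eps * Cmod (y - z)%C).
      rewrite Cadd_sub in Hh. exact Hh.
  - intros [_ H] eps He.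
    specialize (H z (fun P Q => Q) (mkposreal eps He)).
    destruct H as [d Hd]. exists d; split; [apply cond_pos|].
    intros h Hh. specialize (Hd (z + h)%C).
    change (Cmod ((z + h) - z)%C < d -> Cmod (f (z+h)%C - f z - ((z + h) - z) * l)%C <= eps * Cmod ((z + h) - z)%C) in Hd.
    replace (z + h - z)%C with h in Hd by ring. apply Hd. exact Hh.
Qed.

(** C as a module over itself and [C_NormedModule] are distinct structures: products and the inner
    function of a composition use the former, sums and the outer function the latter. *)
Lemma Cder_is_derive_ring (f : C -> C) (z l : C) :
  Cder f z l <-> is_derive (K := C_AbsRing) (V := AbsRing_NormedModule C_AbsRing) f z l.
Proof.
  split.
  - intros H. split.
    + apply is_linear_scal_l.
    + intros x Hx eps.
      apply (is_filter_lim_locally_unique (K := C_AbsRing) (V := AbsRing_NormedModule C_AbsRing)) in Hx.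
      rewrite <- Hx; clear x Hx.
      destruct (H eps (cond_pos eps)) as (d & Hd & Hh).
      exists (mkposreal d Hd). intros y Hy.
      change (Cmod (y - z)%C < d) in Hy.
      specialize (Hh _ Hy).
      change (Cmod (f y - f z - (y - z) * l)%C <= eps * Cmod (y - z)%C).
      rewrite Cadd_sub in Hh. exact Hh.
  - intros [_ H] eps He.
    specialize (H z (fun P Q => Q) (mkposreal eps He)).
    destruct H as [d Hd]. exists d; split; [apply cond_pos|].
    intros h Hh. specialize (Hd (z + h)%C).
    change (Cmod ((z + h) - z)%C < d -> Cmod (f (z+h)%C - f z - ((z + h) - z) * l)%C <= eps * Cmod ((z + h) - z)%C) in Hd.
    replace (z + h - z)%C with h in Hd by ring. apply Hd. exact Hh.
Qed.

Lemma Cder_eq (f : C -> C) (z l l' : C) : Cder f z l -> l = l' -> Cder f z l'.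
Proof. intros H <-; exact H. Qed.

Lemma Cder_const (c z : C) : Cder (fun _ => c) z 0.
Proof.
  intros eps He; exists 1; split; [lra|]. intros h _.
  replace (c - c - h * 0)%C with (RtoC 0) by ring. rewrite Cmod_0.
  pose proof (Cmod_ge_0 h); nra.
Qed.

Lemma Cder_id (z : C) : Cder (fun x => x) z 1.
Proof.
  intros eps He; exists 1; split; [lra|]. intros h _.
  replace (z + h - z - h * 1)%C with (RtoC 0) by ring. rewrite Cmod_0.
  pose proof (Cmod_ge_0 h); nra.
Qed.

Lemma Cder_plus (f g : C -> C) (z l m : C) :
  Cder f z l -> Cder g z m -> Cder (fun x => f x + g x)%C z (l + m).
Proof.
  rewrite !Cder_is_derive. exact (is_derive_plus f g z l m).
Qed.

Lemma Cder_mult (f g : C -> C) (z l m : C) :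
  Cder f z l -> Cder g z m -> Cder (fun x => f x * g x)%C z (l * g z + f z * m).
Proof.
  rewrite !Cder_is_derive_ring. intros Hf Hg.
  exact (is_derive_mult (K := C_AbsRing) f g z l m Hf Hg Cmult_comm).
Qed.

Lemma Cder_comp (f g : C -> C) (z l m : C) :
  Cder f (g z) l -> Cder g z m -> Cder (fun x => f (g x)) z (m * l).
Proof.
  rewrite (Cder_is_derive_ring g), (Cder_is_derive f), (Cder_is_derive (fun x => f (g x))).
  exact (is_derive_comp (K := C_AbsRing) (V := C_NormedModule) f g z l m).
Qed.

Lemma Cder_scal (c : C) (f : C -> C) (z l : C) :
  Cder f z l -> Cder (fun x => c * f x)%C z (c * l).
Proof.
  intros H. eapply Cder_eq.
  - apply Cder_mult; [apply Cder_const | exact H].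
  - cbv beta. ring.
Qed.

Lemma Cder_opp (f : C -> C) (z l : C) : Cder f z l -> Cder (fun x => - f x)%C z (- l).
Proof.
  intros H eps He. destruct (H eps He) as (d & Hd & Hh). exists d; split; auto.
  intros h Hm. specialize (Hh h Hm). rewrite <- Cmod_opp.
  replace (- (- f (z + h) - - f z - h * - l))%C with (f (z + h) - f z - h * l)%C by ring.
  exact Hh.
Qed.

Lemma Cder_minus (f g : C -> C) (z l m : C) :
  Cder f z l -> Cder g z m -> Cder (fun x => f x - g x)%C z (l - m).
Proof. intros Hf Hg. apply Cder_plus; [exact Hf|apply Cder_opp, Hg]. Qed.

Lemma Cder_ext_loc (f g : C -> C) (z l : C) (r : R) :
  0 < r -> (forall h, Cmod h < r -> f (z + h)%C = g (z + h)%C) -> Cder f z l -> Cder g z l.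
Proof.
  intros Hr E H eps He. destruct (H eps He) as (d & Hd & Hh).
  exists (Rmin d r). split; [apply Rmin_pos; lra|].
  intros h Hm. rewrite <- (E h).
  - replace (g z) with (f z).
    + apply Hh. pose proof (Rmin_l d r); lra.
    + specialize (E 0). rewrite Cmod_0 in E. rewrite Cplus_0_r in E. auto.
  - pose proof (Rmin_r d r); lra.
Qed.

Definition Ccont (f : C -> C) (z : C) : Prop :=
  forall eps, 0 < eps -> exists d, 0 < d /\ forall h : C, Cmod h < d ->
    Cmod (f (z + h) - f z)%C < eps.

Lemma Cder_cont (f : C -> C) (z l : C) : Cder f z l -> Ccont f z.
Proof.
  intros H eps He. destruct (H 1 Rlt_0_1) as (d & Hd & Hh).
  pose proof (Cmod_ge_0 l) as Hl.
  exists (Rmin d (eps / (2 + Cmod l))). split.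
  { apply Rmin_pos; [lra|]. apply Rdiv_lt_0_compat; lra. }
  intros h Hm.
  destruct (Rmin_Rgt_l _ _ _ Hm) as [h1 h2].
  specialize (Hh h h1).
  replace (f (z + h) - f z)%C with ((f (z + h) - f z - h * l) + h * l)%C by ring.
  eapply Rle_lt_trans; [apply Cmod_triangle|]. rewrite Cmod_mult.
  assert (Cmod h * (2 + Cmod l) < eps).
  { apply Rlt_div_r in h2; [|lra]. lra. }
  pose proof (Cmod_ge_0 h). nra.
Qed.

Lemma Cder_line (f : C -> C) (w h l : C) (t : R) :
  Cder f (w + t * h)%C l ->
  is_derive (fun t : R => Re (f (w + t * h)%C)) t (Re (h * l)%C) /\
  is_derive (fun t : R => Im (f (w + t * h)%C)) t (Im (h * l)%C).
Proof.
  intros H.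
  assert (E : forall eps, 0 < eps -> exists d, 0 < d /\ forall s : R, Rabs s < d ->
     Cmod (f (w + (t + s)%R * h) - f (w + t * h) - s * (h * l))%C <= eps * Rabs s).
  { intros eps He. pose proof (Cmod_ge_0 h) as Hh.
    destruct (H (eps / (1 + Cmod h))) as (d & Hd & Hb).
    { apply Rdiv_lt_0_compat; lra. }
    exists (d / (1 + Cmod h)). split; [apply Rdiv_lt_0_compat; lra|].
    intros s Hs. specialize (Hb (s * h)%C).
    rewrite Cmod_mult, Cmod_R in Hb.
    replace (w + (t + s)%R * h)%C with (w + t * h + s * h)%C
      by (rewrite RtoC_plus; ring).
    replace (s * (h * l))%C with (s * h * l)%C by ring.
    pose proof (Rabs_pos s).
    eapply Rle_trans; [apply Hb|].
    - apply Rlt_div_r in Hs; [|lra]. nra.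
    - replace (eps * Rabs s) with (eps / (1 + Cmod h) * ((1 + Cmod h) * Rabs s)) by (field; lra).
      apply Rmult_le_compat_l; [|nra]. apply Rlt_le, Rdiv_lt_0_compat; lra. }
  (* Real and imaginary part are treated at once, as a real-linear functional p dominated by the
     modulus. *)
  assert (K : forall p : C -> R, (forall u v, p (u - v)%C = p u - p v) ->
    (forall (s : R) u, p (s * u)%C = s * p u) -> (forall u, Rabs (p u) <= Cmod u) ->
    is_derive (fun t : R => p (f (w + t * h)%C)) t (p (h * l)%C)).
  { intros p Hm Hs Hb. apply is_derive_Reals. intros eps He.
    destruct (E (eps / 2)) as (d & Hd & B); [lra|].
    exists (mkposreal d Hd). intros s Hs0 Hs1. pose proof (Rabs_pos_lt s Hs0) as Hp.
    specialize (B s Hs1). pose proof (Hb (f (w + (t + s)%R * h) - f (w + t * h) - s * (h * l))%C) as Q.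
    rewrite !Hm, Hs in Q.
    replace ((p (f (w + (t + s)%R * h)%C) - p (f (w + t * h)%C)) / s - p (h * l)%C)
      with ((p (f (w + (t + s)%R * h)%C) - p (f (w + t * h)%C) - s * p (h * l)%C) / s) by (field; auto).
    unfold Rdiv at 1. rewrite Rabs_mult, Rabs_inv. apply Rlt_div_l; [exact Hp|]. nra. }
  split; apply K; try (intros; unfold Re, Im; simpl; ring); [apply re_le_Cmod|apply Im_le_Cmod].
Qed.

Lemma MVT_abs (g dg : R -> R) (M : R) :
  (forall t, 0 <= t <= 1 -> is_derive g t (dg t)) ->
  (forall t, 0 <= t <= 1 -> Rabs (dg t) <= M) ->
  Rabs (g 1 - g 0) <= M.
Proof.
  intros Hd HM.
  destruct (MVT_gen g 0 1 dg) as (c & Hc & E).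
  - intros x Hx. rewrite Rmin_left, Rmax_right in Hx by lra. apply Hd; lra.
  - intros x Hx. rewrite Rmin_left, Rmax_right in Hx by lra.
    apply derivable_continuous_pt. exists (dg x). apply is_derive_Reals, Hd; lra.
  - rewrite Rmin_left, Rmax_right in Hc by lra.
    rewrite E. replace (dg c * (1 - 0)) with (dg c) by ring. apply HM; lra.
Qed.

(** The real mean value theorem is applied to the real and the imaginary part along the segment;
    adding the two bounds costs the factor 2. *)
Lemma Cmean_value (f df : C -> C) (w h : C) (M : R) :
  (forall t : R, 0 <= t <= 1 -> Cder f (w + t * h)%C (df (w + t * h)%C)) ->
  (forall t : R, 0 <= t <= 1 -> Cmod (df (w + t * h)%C) <= M) ->
  Cmod (f (w + h) - f w)%C <= 2 * M * Cmod h.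
Proof.
  intros Hd HM.
  assert (B : forall t : R, 0 <= t <= 1 -> Cmod (h * df (w + t * h))%C <= M * Cmod h).
  { intros t Ht. rewrite Cmod_mult. pose proof (Cmod_ge_0 h). specialize (HM t Ht). nra. }
  pose proof (MVT_abs (fun t : R => Re (f (w + t * h)%C))
    (fun t : R => Re (h * df (w + t * h))%C) (M * Cmod h)) as H1.
  pose proof (MVT_abs (fun t : R => Im (f (w + t * h)%C))
    (fun t : R => Im (h * df (w + t * h))%C) (M * Cmod h)) as H2.
  cbv beta in H1, H2.
  replace (w + 1%R * h)%C with (w + h)%C in H1, H2 by ring.
  replace (w + 0%R * h)%C with w in H1, H2 by ring.
  eapply Rle_trans; [apply Cmod_le_abs|].
  replace (Re (f (w + h) - f w)%C) with (Re (f (w + h)%C) - Re (f w)) by (unfold Re; simpl; ring).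
  replace (Im (f (w + h) - f w)%C) with (Im (f (w + h)%C) - Im (f w)) by (unfold Im; simpl; ring).
  assert (Rabs (Re (f (w + h)%C) - Re (f w)) <= M * Cmod h).
  { apply H1; intros t Ht; [apply Cder_line, Hd, Ht|].
    eapply Rle_trans; [apply re_le_Cmod|apply B, Ht]. }
  assert (Rabs (Im (f (w + h)%C) - Im (f w)) <= M * Cmod h).
  { apply H2; intros t Ht; [apply Cder_line, Hd, Ht|].
    eapply Rle_trans; [apply Im_le_Cmod|apply B, Ht]. }
  lra.
Qed.

(** [Cmean_value] is used twice: for df, and for x -> f x - x * df w, whose derivative df x - df w
    the other use bounds. *)
Lemma Ctaylor (f df ddf : C -> C) (w h : C) (M : R) :
  (forall t : R, 0 <= t <= 1 -> Cder f (w + t * h)%C (df (w + t * h)%C)) ->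
  (forall t : R, 0 <= t <= 1 -> Cder df (w + t * h)%C (ddf (w + t * h)%C)) ->
  (forall t : R, 0 <= t <= 1 -> Cmod (ddf (w + t * h)%C) <= M) ->
  Cmod (f (w + h) - f w - h * df w)%C <= 4 * M * (Cmod h * Cmod h).
Proof.
  intros H1 H2 HM.
  pose proof (Cmean_value (fun x => f x - x * df w)%C (fun x => df x - df w)%C w h (2 * M * Cmod h)) as K.
  replace (f (w + h) - f w - h * df w)%C
    with ((f (w + h) - (w + h) * df w) - (f w - w * df w))%C by ring.
  replace (4 * M * (Cmod h * Cmod h)) with (2 * (2 * M * Cmod h) * Cmod h) by ring.
  apply K.
  - intros t Ht. eapply Cder_eq.
    + apply Cder_minus; [apply H1, Ht|].
      apply Cder_mult; [apply Cder_id|apply Cder_const].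
    + cbv beta. ring.
  - intros t Ht.
    pose proof (Cmean_value df ddf w (t * h)%C M) as K2.
    rewrite Cmod_mult, Cmod_R, (Rabs_pos_eq t) in K2 by lra.
    assert (M0 : 0 <= M) by (eapply Rle_trans; [apply Cmod_ge_0|apply (HM t Ht)]).
    pose proof (Cmod_ge_0 h).
    eapply Rle_trans; [apply K2|].
    + intros s Hs. replace (w + s * (t * h))%C with (w + (s * t)%R * h)%C by (rewrite RtoC_mult; ring).
      apply H2. split; nra.
    + intros s Hs. replace (w + s * (t * h))%C with (w + (s * t)%R * h)%C by (rewrite RtoC_mult; ring).
      apply HM. split; nra.
    + assert (t * Cmod h <= Cmod h) by nra. nra.
Qed.

Lemma C_ext (z w : C) : Re z = Re w -> Im z = Im w -> z = w.
Proof. destruct z, w; unfold Re, Im; simpl; intros -> ->; reflexivity. Qed.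

(** * Exponential, logarithm and powers *)

Definition Cexp (z : C) : C := (exp (Re z) * cos (Im z), exp (Re z) * sin (Im z)).

Lemma Cexp_plus (z w : C) : Cexp (z + w) = (Cexp z * Cexp w)%C.
Proof.
  unfold Cexp; apply C_ext; unfold Re, Im; simpl; rewrite exp_plus, ?cos_plus, ?sin_plus; ring.
Qed.

Lemma Cexp_R (x : R) : Cexp x = RtoC (exp x).
Proof. unfold Cexp, RtoC, Re, Im; simpl. rewrite cos_0, sin_0. f_equal; ring. Qed.

Lemma Cmod_Cexp (z : C) : Cmod (Cexp z) = exp (Re z).
Proof.
  unfold Cmod, Cexp; simpl fst; simpl snd.
  replace ((exp (Re z) * cos (Im z)) ^ 2 + (exp (Re z) * sin (Im z)) ^ 2) with (exp (Re z) ^ 2).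
  - apply sqrt_pow2. apply Rlt_le, exp_pos.
  - pose proof (sin2_cos2 (Im z)) as H. unfold Rsqr in H.
    transitivity (exp (Re z) ^ 2 * 1); [ring|]. rewrite <- H. ring.
Qed.

Lemma Cexp_neq_0 (z : C) : Cexp z <> 0.
Proof. apply Cmod_gt_0. rewrite Cmod_Cexp. apply exp_pos. Qed.

Lemma Rtaylor2 (g dg ddg : R -> R) (M : R) :
  (forall t, 0 <= t <= 1 -> is_derive g t (dg t)) ->
  (forall t, 0 <= t <= 1 -> is_derive dg t (ddg t)) ->
  (forall t, 0 <= t <= 1 -> Rabs (ddg t) <= M) ->
  Rabs (g 1 - g 0 - dg 0) <= M.
Proof.
  intros H1 H2 HM.
  replace (g 1 - g 0 - dg 0) with ((g 1 - 1 * dg 0) - (g 0 - 0 * dg 0)) by ring.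
  apply (MVT_abs (fun t => g t - t * dg 0) (fun t => dg t - dg 0)).
  - intros t Ht. replace (dg t - dg 0) with (minus (dg t) (1 * dg 0)) by (unfold minus, plus, opp; simpl; ring).
    apply (is_derive_minus g (fun t => t * dg 0)); [apply H1, Ht|].
    apply (is_derive_ext (fun t => scal t (dg 0))); [reflexivity|].
    apply (is_derive_scal_l (fun t : R => t) t (1 : R) (dg 0)). apply (is_derive_id (K := R_AbsRing)).
  - intros t Ht.
    assert (M0 : 0 <= M) by (eapply Rle_trans; [apply Rabs_pos|apply (HM t Ht)]).
    destruct (MVT_gen dg 0 t ddg) as (c & Hc & E).
    + intros x Hx. rewrite Rmin_left, Rmax_right in Hx by lra. apply H2; lra.
    + intros x Hx. rewrite Rmin_left, Rmax_right in Hx by lra.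
      apply derivable_continuous_pt. exists (ddg x). apply is_derive_Reals, H2; lra.
    + rewrite Rmin_left, Rmax_right in Hc by lra.
      rewrite E, Rabs_mult, (Rabs_pos_eq (t - 0)) by lra.
      assert (Rabs (ddg c) <= M) by (apply HM; lra). pose proof (Rabs_pos (ddg c)). nra.
Qed.

(** The second derivative of t -> exp (t h) has modulus |h|^2 exp (t Re h), which is at most 3 |h|^2
    when |h| <= 1. The real and the imaginary part contribute 3 each. *)
Lemma Cexp_quad (h : C) : Cmod h <= 1 ->
  Cmod (Cexp h - 1 - h)%C <= 6 * (Cmod h * Cmod h).
Proof.
  intros Hh. destruct h as [a b].
  assert (Ha : Rabs a <= Cmod (a, b)) by apply (re_le_Cmod (a, b)).
  pose proof (Cmod_ge_0 (a, b)) as H0.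
  set (m := Cmod (a, b)) in *.
  assert (S : forall t : R, Cmod ((a, b) * (a, b) * Cexp ((t * a)%R, (t * b)%R))%C = m * m * exp (t * a)).
  { intros t. rewrite !Cmod_mult, Cmod_Cexp. reflexivity. }
  assert (B : forall t, 0 <= t <= 1 -> m * m * exp (t * a) <= 3 * (m * m)).
  { intros t Ht. assert (exp (t * a) <= 3).
    { apply Rle_trans with (exp 1); [|apply exp_le_3].
      destruct (Rle_lt_or_eq_dec (t * a) 1) as [|E].
      - apply Rabs_le_between in Ha. nra.
      - apply Rlt_le, exp_increasing; lra.
      - rewrite E; lra. }
    nra. }
  eapply Rle_trans; [apply Cmod_le_abs|].
  assert (HR : Rabs (Re (Cexp (a, b) - 1 - (a, b))%C) <= 3 * (m * m)).
  { replace (Re (Cexp (a, b) - 1 - (a, b))%C) with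
      (exp (1 * a) * cos (1 * b) - exp (0 * a) * cos (0 * b) - (exp (0 * a) * (a * cos (0 * b) - b * sin (0 * b)))).
    2:{ unfold Re; simpl. rewrite !Rmult_0_l, !Rmult_1_l, exp_0, cos_0, sin_0. ring. }
    apply (Rtaylor2 (fun t => exp (t * a) * cos (t * b))
      (fun t => exp (t * a) * (a * cos (t * b) - b * sin (t * b)))
      (fun t => exp (t * a) * ((a * a - b * b) * cos (t * b) - 2 * a * b * sin (t * b)))).
    - intros t _. auto_derive; auto. ring.
    - intros t _. auto_derive; auto. ring.
    - intros t Ht. eapply Rle_trans; [|apply (B t Ht)]. rewrite <- S.
      eapply Rle_trans; [|apply re_le_Cmod]. right. f_equal.
      unfold Re, Cexp, Im; simpl; ring. }
  assert (HI : Rabs (Im (Cexp (a, b) - 1 - (a, b))%C) <= 3 * (m * m)).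
  { replace (Im (Cexp (a, b) - 1 - (a, b))%C) with
      (exp (1 * a) * sin (1 * b) - exp (0 * a) * sin (0 * b) - (exp (0 * a) * (a * sin (0 * b) + b * cos (0 * b)))).
    2:{ unfold Im; simpl. rewrite !Rmult_0_l, !Rmult_1_l, exp_0, cos_0, sin_0. ring. }
    apply (Rtaylor2 (fun t => exp (t * a) * sin (t * b))
      (fun t => exp (t * a) * (a * sin (t * b) + b * cos (t * b)))
      (fun t => exp (t * a) * ((a * a - b * b) * sin (t * b) + 2 * a * b * cos (t * b)))).
    - intros t _. auto_derive; auto. ring.
    - intros t _. auto_derive; auto. ring.
    - intros t Ht. eapply Rle_trans; [|apply (B t Ht)]. rewrite <- S.
      eapply Rle_trans; [|apply Im_le_Cmod]. right. f_equal.
      unfold Re, Cexp, Im; simpl; ring. }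
  lra.
Qed.

Lemma Cder_Cexp (z : C) : Cder Cexp z (Cexp z).
Proof.
  intros eps He.
  pose proof (exp_pos (Re z)) as Hp. set (c := exp (Re z)) in *.
  exists (Rmin 1 (eps / (6 * c))). split; [apply Rmin_pos; [lra|apply Rdiv_lt_0_compat; lra]|].
  intros h Hh.
  destruct (Rmin_Rgt_l _ _ _ Hh) as [h1 h2].
  rewrite Cexp_plus.
  replace (Cexp z * Cexp h - Cexp z - h * Cexp z)%C with (Cexp z * (Cexp h - 1 - h))%C by ring.
  rewrite Cmod_mult, Cmod_Cexp. fold c.
  pose proof (Cexp_quad h (Rlt_le _ _ h1)). pose proof (Cmod_ge_0 h).
  apply Rlt_div_r in h2; [|lra].
  apply Rle_trans with (c * (6 * (Cmod h * Cmod h))); [nra|nra].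
Qed.

(* The principal argument; this half-angle formula is smooth on the whole slit plane. *)
Definition carg (z : C) : R := 2 * atan (Im z / (Re z + Cmod z)).
Definition Clog (z : C) : C := (ln (Cmod z), carg z).

Lemma Cmod_sq (z : C) : Cmod z * Cmod z = Re z * Re z + Im z * Im z.
Proof. pose proof (Cmod2_alt z). nra. Qed.

Lemma slit_pos (z : C) : slit_plane z -> 0 < Cmod z /\ 0 < Re z + Cmod z.
Proof.
  intros H. pose proof (Cmod_ge_0 z). pose proof (Cmod_sq z) as E.
  pose proof (re_le_Cmod z) as L. apply Rabs_le_between in L.
  destruct H as [H|H].
  - split; lra.
  - assert (0 < Im z * Im z) by nra.
    split; [nra|]. assert (Re z + Cmod z <> 0) by (intro; nra). lra.
Qed.

Lemma slit_neq_0 (z : C) : slit_plane z -> z <> 0.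
Proof. intros H. apply Cmod_gt_0, slit_pos, H. Qed.

Lemma carg_bound (z : C) : - PI < carg z < PI.
Proof. unfold carg. pose proof (atan_bound (Im z / (Re z + Cmod z))). lra. Qed.

Lemma Cexp_Clog (z : C) : slit_plane z -> Cexp (Clog z) = z.
Proof.
  intros H. destruct (slit_pos z H) as [H1 H2].
  pose proof (Cmod_sq z) as E.
  unfold Cexp, Clog. change (Re (ln (Cmod z), carg z)) with (ln (Cmod z)).
  change (Im (ln (Cmod z), carg z)) with (carg z).
  rewrite exp_ln by auto. unfold carg.
  set (u := Im z / (Re z + Cmod z)).
  set (r := Cmod z) in *. set (x := Re z) in *. set (y := Im z) in *.
  assert (U : 1 + u ^ 2 = 2 * r / (x + r)).
  { unfold u. field_simplify_eq; [|lra]. nra. }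
  assert (P : 0 < 1 + Rsqr u) by (unfold Rsqr; nra).
  rewrite cos_2a, sin_2a, cos_atan, sin_atan.
  assert (Q : sqrt (1 + Rsqr u) * sqrt (1 + Rsqr u) = 2 * r / (x + r)).
  { rewrite sqrt_sqrt by lra. rewrite <- U. unfold Rsqr; ring. }
  assert (Q0 : sqrt (1 + Rsqr u) <> 0) by (apply Rgt_not_eq, sqrt_lt_R0, P).
  apply C_ext; simpl Re; simpl Im; fold x; fold y.
  - replace (r * (1 / sqrt (1 + Rsqr u) * (1 / sqrt (1 + Rsqr u)) - u / sqrt (1 + Rsqr u) * (u / sqrt (1 + Rsqr u))))
      with (r * (1 - u * u) / (sqrt (1 + Rsqr u) * sqrt (1 + Rsqr u))) by (field; auto).
    rewrite Q. unfold u. field_simplify_eq; [nra|split; lra].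
  - replace (r * (2 * (u / sqrt (1 + Rsqr u)) * (1 / sqrt (1 + Rsqr u))))
      with (r * (2 * u) / (sqrt (1 + Rsqr u) * sqrt (1 + Rsqr u))) by (field; auto).
    rewrite Q. unfold u. field. split; lra.
Qed.

Lemma Clog_R (x : R) : 0 < x -> Clog x = RtoC (ln x).
Proof.
  intros H. unfold Clog, carg. rewrite Cmod_R, Rabs_pos_eq by lra.
  unfold Re, Im; simpl. unfold Rdiv. rewrite Rmult_0_l, atan_0, Rmult_0_r. reflexivity.
Qed.

(** * Continuity of elementary functions on a general space of parameters *)

Lemma cU_comp {U : UniformSpace} (g : R -> R) (f : U -> R) (p : U) :
  continuous f p -> continuous g (f p) -> continuous (fun q => g (f q)) p.
Proof. intros Hf Hg. exact (continuous_comp f g p Hf Hg). Qed.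

Lemma cU_plus {U : UniformSpace} (f g : U -> R) (p : U) :
  continuous f p -> continuous g p -> continuous (fun q => f q + g q) p.
Proof. intros Hf Hg. exact (continuous_plus (K := R_AbsRing) (V := R_NormedModule) f g p Hf Hg). Qed.

Lemma cU_minus {U : UniformSpace} (f g : U -> R) (p : U) :
  continuous f p -> continuous g p -> continuous (fun q => f q - g q) p.
Proof. intros Hf Hg. exact (continuous_minus (K := R_AbsRing) (V := R_NormedModule) f g p Hf Hg). Qed.

Lemma cU_opp {U : UniformSpace} (f : U -> R) (p : U) :
  continuous f p -> continuous (fun q => - f q) p.
Proof. intros Hf. exact (continuous_opp (K := R_AbsRing) (V := R_NormedModule) f p Hf). Qed.

Lemma cU_mult {U : UniformSpace} (f g : U -> R) (p : U) :
  continuous f p -> continuous g p -> continuous (fun q => f q * g q) p.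
Proof. intros Hf Hg. exact (continuous_mult (K := R_AbsRing) f g p Hf Hg). Qed.

Lemma cU_const {U : UniformSpace} (c : R) (p : U) : continuous (fun _ : U => c) p.
Proof. apply continuous_const. Qed.

Lemma c_der (g : R -> R) (x : R) : ex_derive g x -> continuous g x.
Proof. exact (ex_derive_continuous (K := R_AbsRing) (V := R_NormedModule) g x). Qed.

Lemma cU_exp {U : UniformSpace} (f : U -> R) (p : U) :
  continuous f p -> continuous (fun q => exp (f q)) p.
Proof. intros H. apply (cU_comp exp); auto. apply c_der. auto_derive; auto. Qed.

Lemma cU_cos {U : UniformSpace} (f : U -> R) (p : U) :
  continuous f p -> continuous (fun q => cos (f q)) p.
Proof. intros H. apply (cU_comp cos); auto. apply c_der. auto_derive; auto. Qed.

Lemma cU_sin {U : UniformSpace} (f : U -> R) (p : U) :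
  continuous f p -> continuous (fun q => sin (f q)) p.
Proof. intros H. apply (cU_comp sin); auto. apply c_der. auto_derive; auto. Qed.

Lemma cU_atan {U : UniformSpace} (f : U -> R) (p : U) :
  continuous f p -> continuous (fun q => atan (f q)) p.
Proof. intros H. apply (cU_comp atan); auto. apply c_der. auto_derive; auto. Qed.

Lemma cU_ln {U : UniformSpace} (f : U -> R) (p : U) :
  continuous f p -> 0 < f p -> continuous (fun q => ln (f q)) p.
Proof. intros H Hp. apply (cU_comp ln); auto. apply continuous_ln, Hp. Qed.

Lemma cU_inv {U : UniformSpace} (f : U -> R) (p : U) :
  continuous f p -> f p <> 0 -> continuous (fun q => / f q) p.
Proof. intros H Hp. apply (cU_comp Rinv); auto. apply c_der. auto_derive; auto. Qed.

Lemma cU_Cmod {U : UniformSpace} (f g : U -> R) (p : U) :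
  continuous f p -> continuous g p -> continuous (fun q => Cmod (f q, g q)) p.
Proof.
  intros Hf Hg. unfold Cmod; simpl.
  apply (cU_comp sqrt).
  - apply cU_plus; repeat (apply cU_mult; auto); apply cU_const.
  - apply continuity_pt_filterlim, continuity_pt_sqrt. nra.
Qed.

Lemma cU_carg {U : UniformSpace} (f g : U -> R) (p : U) :
  continuous f p -> continuous g p -> slit_plane (f p, g p) ->
  continuous (fun q => carg (f q, g q)) p.
Proof.
  intros Hf Hg H. unfold carg. apply cU_mult; [apply cU_const|].
  apply cU_atan. apply (cU_mult (fun q => g q)); auto.
  apply (cU_inv (fun q => f q + Cmod (f q, g q))).
  - apply cU_plus; auto. apply cU_Cmod; auto.
  - apply slit_pos in H. unfold Re in H; simpl in H. lra.
Qed.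

Lemma Ccont_pair (f : C -> C) (z : C) :
  continuous (T := C_UniformSpace) (U := R_UniformSpace) (fun w => Re (f w)) z ->
  continuous (T := C_UniformSpace) (U := R_UniformSpace) (fun w => Im (f w)) z -> Ccont f z.
Proof.
  intros H1 H2 eps He.
  assert (He2 : 0 < eps / 2) by lra.
  destruct (proj1 (filterlim_locally _ _) H1 (mkposreal _ He2)) as [d1 B1].
  destruct (proj1 (filterlim_locally _ _) H2 (mkposreal _ He2)) as [d2 B2].
  pose proof (cond_pos d1). pose proof (cond_pos d2).
  exists (Rmin d1 d2). split; [apply Rmin_pos; lra|]. intros h Hh.
  destruct (Rmin_Rgt_l _ _ _ Hh) as [h1 h2].
  pose proof (re_le_Cmod h) as Lr. pose proof (Im_le_Cmod h) as Li.
  specialize (B1 (z + h)%C). specialize (B2 (z + h)%C).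
  assert (S : forall d, Cmod h < d -> ball (M := C_UniformSpace) z d (z + h)%C).
  { intros d Hd. split.
    - change (Rabs (Re z + Re h - Re z) < d).
      replace (Re z + Re h - Re z) with (Re h) by ring. lra.
    - change (Rabs (Im z + Im h - Im z) < d).
      replace (Im z + Im h - Im z) with (Im h) by ring. lra. }
  specialize (B1 (S _ h1)). specialize (B2 (S _ h2)).
  change (Rabs (Re (f (z + h)%C) - Re (f z)) < eps / 2) in B1.
  change (Rabs (Im (f (z + h)%C) - Im (f z)) < eps / 2) in B2.
  eapply Rle_lt_trans; [apply Cmod_le_abs|].
  change (Rabs (Re (f (z + h)%C) - Re (f z)) + Rabs (Im (f (z + h)%C) - Im (f z)) < eps). lra.
Qed.

Lemma cRe (z : C) : continuous (T := C_UniformSpace) (U := R_UniformSpace) Re z.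
Proof. destruct z; apply (continuous_fst (U := R_UniformSpace) (V := R_UniformSpace)). Qed.
Lemma cIm (z : C) : continuous (T := C_UniformSpace) (U := R_UniformSpace) Im z.
Proof. destruct z; apply (continuous_snd (U := R_UniformSpace) (V := R_UniformSpace)). Qed.

Lemma pairC (z : C) : (Re z, Im z) = z.
Proof. destruct z; reflexivity. Qed.

Lemma Ccont_Clog (z : C) : slit_plane z -> Ccont Clog z.
Proof.
  intros H. apply Ccont_pair.
  - apply (continuous_ext (fun w : C_UniformSpace => ln (Cmod (Re w, Im w)))).
    { intros w; rewrite pairC; reflexivity. }
    apply cU_ln; [|rewrite pairC; apply slit_pos, H].
    apply cU_Cmod; [apply cRe|apply cIm].
  - apply (continuous_ext (fun w : C_UniformSpace => carg (Re w, Im w))).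
    { intros w; rewrite pairC; reflexivity. }
    apply cU_carg; [apply cRe|apply cIm|rewrite pairC; exact H].
Qed.

Lemma Cmod_minus_ge (z w : C) : Cmod z - Cmod w <= Cmod (z - w)%C.
Proof.
  pose proof (Cmod_triangle (z - w)%C w) as H.
  replace (z - w + w)%C with z in H by ring. lra.
Qed.

Lemma slit_open (z : C) : slit_plane z -> exists r, 0 < r /\ forall h, Cmod h < r -> slit_plane (z + h)%C.
Proof.
  intros [H|H].
  - exists (Re z). split; auto. intros h Hh. left.
    pose proof (re_le_Cmod h) as L. apply Rabs_le_between in L.
    change (0 < Re z + Re h). lra.
  - exists (Rabs (Im z)). split; [apply Rabs_pos_lt, H|]. intros h Hh. right.
    pose proof (Im_le_Cmod h) as L. change (Im z + Im h <> 0). intro E.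
    replace (Im h) with (- Im z) in L by lra. rewrite Rabs_Ropp in L. lra.
Qed.

(** The logarithm inherits its derivative from the exponential: with k = Clog (z + h) - Clog z one
    has h / z = e^k - 1, so k - h / z is quadratic in k, and k is small by continuity. *)
Lemma Cder_Clog (z : C) : slit_plane z -> Cder Clog z (/ z).
Proof.
  intros H eps He.
  pose proof (slit_neq_0 z H) as Hz0. pose proof (proj1 (slit_pos z H)) as Hm.
  destruct (slit_open z H) as (r & Hr & Hs).
  set (m := Cmod z) in *.
  (* |k| < 1/12 makes 6 |k|^2 <= |k| / 2, hence |k| <= 2 |h| / m; then |k| < eps m / 24 bounds 6
     |k|^2 by eps |h| / 2. *)
  set (e0 := Rmin (1/12) (eps * m / 24)).
  assert (He0 : 0 < e0) by (apply Rmin_pos; [lra|]; apply Rdiv_lt_0_compat; [nra|lra]).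
  destruct (Ccont_Clog z H e0 He0) as (d & Hd & Hc).
  exists (Rmin d r). split; [apply Rmin_pos; lra|]. intros h Hh.
  destruct (Rmin_Rgt_l _ _ _ Hh) as [h1 h2].
  specialize (Hc h h1). specialize (Hs h h2).
  set (k := (Clog (z + h) - Clog z)%C) in *.
  destruct (Rmin_Rgt_l _ _ _ Hc) as [K1 K2].
  pose proof (Cexp_quad k) as Q.
  assert (E : (h / z)%C = (Cexp k - 1)%C).
  { assert (E1 : (z * Cexp k)%C = (z + h)%C).
    { rewrite <- (Cexp_Clog z H) at 1. rewrite <- Cexp_plus. unfold k.
      replace (Clog z + (Clog (z + h) - Clog z))%C with (Clog (z + h)) by ring.
      apply Cexp_Clog, Hs. }
    replace (Cexp k) with (z * Cexp k / z)%C by (field; auto). rewrite E1. field; auto. }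
  replace (k - h * / z)%C with (- (Cexp k - 1 - k))%C.
  2:{ change (h * / z)%C with (h / z)%C. rewrite E. ring. }
  rewrite Cmod_opp.
  assert (Q' : Cmod (Cexp k - 1 - k)%C <= 6 * (Cmod k * Cmod k)) by (apply Q; lra). clear Q.
  assert (L : Cmod k <= 2 * (Cmod h / m)).
  { assert (Cmod k - Cmod (h / z)%C <= Cmod (Cexp k - 1 - k)%C).
    { rewrite E. eapply Rle_trans; [apply Cmod_minus_ge|]. rewrite <- Cmod_opp. right. f_equal. ring. }
    rewrite Cmod_div in H0 by auto. fold m in H0.
    pose proof (Cmod_ge_0 k). nra. }
  pose proof (Cmod_ge_0 k) as Kp. pose proof (Cmod_ge_0 h) as Hp.
  apply Rle_trans with (6 * (Cmod k * Cmod k)); auto.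
  apply Rle_trans with (6 * (Cmod k * (2 * (Cmod h / m)))).
  { nra. }
  apply Rle_trans with (6 * ((eps * m / 24) * (2 * (Cmod h / m)))).
  { assert (0 <= 2 * (Cmod h / m)).
    { assert (0 <= Cmod h / m); [|lra]. apply Rmult_le_pos; [lra|]. apply Rlt_le, Rinv_0_lt_compat; lra. }
    nra. }
  replace (6 * (eps * m / 24 * (2 * (Cmod h / m)))) with (eps * Cmod h / 2) by (field; lra).
  nra.
Qed.

(** Branch identities for logarithms are checked after exponentiation; a bound on the arguments then
    rules out a nonzero multiple of 2 pi. *)
Lemma Cexp_inj (z w : C) : Cexp z = Cexp w -> - (2 * PI) < Im z - Im w < 2 * PI -> z = w.
Proof.
  intros E B.
  assert (R1 : Re z = Re w).
  { apply exp_inv. rewrite <- !Cmod_Cexp, E. reflexivity. }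
  unfold Cexp in E. injection E as E1 E2. rewrite R1 in E1, E2.
  pose proof (exp_pos (Re w)) as Hp.
  apply Rmult_eq_reg_l in E1; [|lra]. apply Rmult_eq_reg_l in E2; [|lra].
  apply C_ext; auto.
  assert (S : sin ((Im z - Im w) / 2) = 0).
  { assert (cos (Im z - Im w) = 1).
    { rewrite cos_minus, E1, E2. pose proof (sin2_cos2 (Im w)). unfold Rsqr in *. lra. }
    replace (Im z - Im w) with (2 * ((Im z - Im w) / 2)) in H by field.
    rewrite cos_2a_sin in H. nra. }
  destruct (Rtotal_order (Im z) (Im w)) as [L|[L|L]]; auto.
  - assert (0 < sin (- ((Im z - Im w) / 2))) by (apply sin_gt_0; lra).
    rewrite sin_neg in H. lra.
  - assert (0 < sin ((Im z - Im w) / 2)) by (apply sin_gt_0; lra). lra.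
Qed.

Definition Cpw (a : R) (z : C) : C := Cexp (a * Clog z).

Lemma Cpw_plus (a b : R) (z : C) : Cpw (a + b) z = (Cpw a z * Cpw b z)%C.
Proof. unfold Cpw. rewrite <- Cexp_plus, RtoC_plus. f_equal. ring. Qed.

Lemma Cpw_0 (z : C) : Cpw 0 z = 1.
Proof. unfold Cpw. replace (0%R * Clog z)%C with (RtoC 0) by ring. rewrite Cexp_R, exp_0; reflexivity. Qed.

Lemma Cpw_1 (z : C) : slit_plane z -> Cpw 1 z = z.
Proof.
  intros H. unfold Cpw. replace (1%R * Clog z)%C with (Clog z) by ring. apply Cexp_Clog, H.
Qed.

Lemma Cpw_S (a : R) (z : C) : slit_plane z -> Cpw (a + 1) z = (z * Cpw a z)%C.
Proof. intros H. rewrite Cpw_plus, (Cpw_1 z H). ring. Qed.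

Lemma Cpw_neq_0 (a : R) (z : C) : Cpw a z <> 0.
Proof. apply Cexp_neq_0. Qed.

Lemma Cmod_Cpw (a : R) (z : C) : Cmod (Cpw a z) = exp (a * ln (Cmod z)).
Proof. unfold Cpw. rewrite Cmod_Cexp. f_equal. unfold Re, Clog; simpl. ring. Qed.

Lemma Cpw_R (a x : R) : 0 < x -> Cpw a x = RtoC (exp (a * ln x)).
Proof. intros H. unfold Cpw. rewrite Clog_R, <- RtoC_mult, Cexp_R by auto. reflexivity. Qed.

Lemma Cpw_nat (n : nat) (z : C) : slit_plane z -> Cpw (INR n) z = (z ^ n)%C.
Proof.
  intros H. induction n as [|n IH].
  - simpl. apply Cpw_0.
  - rewrite S_INR, Cpw_S, IH by auto. reflexivity.
Qed.

Lemma Cder_Cpw (a : R) (z : C) : slit_plane z -> Cder (Cpw a) z (a * Cpw (a - 1) z).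
Proof.
  intros H. eapply Cder_eq.
  - apply (Cder_comp Cexp); [apply Cder_Cexp|]. apply Cder_scal, Cder_Clog, H.
  - change (a * / z * Cpw a z = a * Cpw (a - 1) z)%C.
    replace (Cpw a z) with (Cpw (a - 1 + 1) z) by (f_equal; ring).
    rewrite Cpw_S by auto. field. apply slit_neq_0, H.
Qed.

(** * Improper integrals *)

Definition RInt0oo (f : R -> R) : R := RInt_gen f (at_point 0) (Rbar_locally p_infty).

(** Domination by an exponential of fixed rate. The rate 1/2 leaves room for polynomial growth
    against exp (- s), and the single constant M makes tail estimates uniform in parameters. *)
Definition okR (M : R) (f : R -> R) : Prop :=
  forall s, 0 <= s -> continuous f s /\ Rabs (f s) <= M * exp (- s / 2).

Lemma okR_ex (M : R) (f : R -> R) (a b : R) : okR M f -> 0 <= a -> a <= b -> ex_RInt f a b.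
Proof.
  intros H Ha Hab. apply (ex_RInt_continuous (V := R_CompleteNormedModule)).
  intros s Hs. rewrite Rmin_left, Rmax_right in Hs by lra. apply H; lra.
Qed.

Lemma exp_le (x y : R) : x <= y -> exp x <= exp y.
Proof. intros [H| ->]; [left; apply exp_increasing, H|right; reflexivity]. Qed.

Lemma okR_ge0 (M : R) (f : R -> R) : okR M f -> 0 <= M.
Proof.
  intros H. destruct (H 0 (Rle_refl 0)) as [_ B]. replace (- 0 / 2) with 0 in B by field.
  rewrite exp_0 in B. pose proof (Rabs_pos (f 0)). lra.
Qed.

Lemma exp_tail (M eps : R) : 0 <= M -> 0 < eps ->
  exists T, 1 <= T /\ forall t, T <= t -> M * exp (- t / 2) < eps.
Proof.
  intros HM He. exists (2 * M / eps + 1).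
  assert (0 <= 2 * M / eps) by (apply Rdiv_le_0_compat; lra).
  split; [lra|]. intros t Ht.
  assert (E : exp (- t / 2) * exp (t / 2) = 1).
  { rewrite <- exp_plus. replace (- t / 2 + t / 2) with 0 by field. apply exp_0. }
  pose proof (exp_ineq1_le (t / 2)). pose proof (exp_pos (- t / 2)).
  assert (B : 2 * M < t * eps) by (apply Rlt_div_l; lra).
  apply Rmult_lt_reg_r with (exp (t / 2)); [apply exp_pos|].
  rewrite Rmult_assoc, E. nra.
Qed.

Lemma okR_tail (M : R) (f : R -> R) (a b : R) : okR M f -> 0 <= a -> a <= b ->
  Rabs (RInt f a b) <= 2 * M * exp (- a / 2).
Proof.
  intros H Ha Hab. pose proof (okR_ge0 M f H) as M0.
  assert (I : is_RInt (fun s => M * exp (- s / 2)) a b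
    (minus (- (2 * M * exp (- b / 2))) (- (2 * M * exp (- a / 2))))).
  { apply (is_RInt_derive (V := R_CompleteNormedModule) (fun s => - (2 * M * exp (- s / 2)))).
    - intros x _. auto_derive; auto. unfold Rdiv; field.
    - intros x _. apply c_der. auto_derive; auto. }
  eapply Rle_trans.
  - apply (norm_RInt_le f (fun s => M * exp (- s / 2)) a b); [exact Hab| | |exact I].
    + intros x Hx. apply H; lra.
    + apply (RInt_correct (V := R_CompleteNormedModule)), (okR_ex M); auto.
  - unfold minus, plus, opp; simpl. pose proof (exp_pos (- b / 2)). nra.
Qed.

Lemma okR_diff (M : R) (f : R -> R) (a b : R) : okR M f -> 0 <= a -> 0 <= b ->
  Rabs (RInt f 0 b - RInt f 0 a) <= 2 * M * exp (- Rmin a b / 2).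
Proof.
  intros H.
  assert (D : forall a b, 0 <= a -> a <= b -> Rabs (RInt f 0 b - RInt f 0 a) <= 2 * M * exp (- a / 2)).
  { clear a b. intros a b Ha Hab.
    replace (RInt f 0 b - RInt f 0 a) with (RInt f a b); [apply okR_tail; auto|].
    pose proof (RInt_Chasles f 0 a b (okR_ex M f 0 a H (Rle_refl 0) Ha) (okR_ex M f a b H Ha Hab)) as E.
    unfold plus in E; simpl in E. lra. }
  intros Ha Hb. destruct (Rle_or_lt a b).
  - rewrite Rmin_left by auto. apply D; auto.
  - rewrite Rmin_right, Rabs_minus_sym by lra. apply D; lra.
Qed.

Lemma okR_lim (M : R) (f : R -> R) : okR M f ->
  exists l, is_RInt_gen f (at_point 0) (Rbar_locally p_infty) l /\
    forall T, 0 <= T -> Rabs (RInt f 0 T - l) <= 2 * M * exp (- T / 2).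
Proof.
  intros H. pose proof (okR_ge0 M f H) as M0.
  assert (Hc : exists l, filterlim (fun T => RInt f 0 T) (Rbar_locally p_infty) (locally l)).
  { apply (proj1 (filterlim_locally_cauchy (F := Rbar_locally p_infty) (fun T => RInt f 0 T))).
    intros eps. destruct (exp_tail (2 * M) eps ltac:(lra) (cond_pos eps)) as (T & HT & B).
    exists (fun t => T < t). split; [exists T; auto|].
    intros u v Hu Hv. change (Rabs (RInt f 0 v - RInt f 0 u) < eps).
    eapply Rle_lt_trans; [apply (okR_diff M); auto; lra|]. apply B, Rmin_glb; lra. }
  destruct Hc as [l Hl]. exists l. split.
  - intros P HP. specialize (Hl P HP). destruct Hl as [T HT].
    exists (fun a => a = 0) (fun b => Rmax 0 T < b).
    + reflexivity.
    + exists (Rmax 0 T); auto.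
    + intros a b -> Hb. pose proof (Rmax_l 0 T). pose proof (Rmax_r 0 T).
      exists (RInt f 0 b). split.
      * apply (RInt_correct (V := R_CompleteNormedModule)), (okR_ex M); auto; simpl; lra.
      * apply HT. lra.
  - intros T HT. apply Rnot_lt_le. intro Hn.
    (* The tail bound survives the passage to the limit: if it failed by e, a later partial integral
       closer to l than e would contradict [okR_diff]. *)
    set (e := Rabs (RInt f 0 T - l) - 2 * M * exp (- T / 2)) in *.
    assert (He : 0 < e) by (unfold e; lra).
    destruct (proj1 (filterlim_locally _ _) Hl (mkposreal e He)) as [T2 HT2].
    set (b := Rmax T T2 + 1).
    assert (b1 : T <= b) by (unfold b; pose proof (Rmax_l T T2); lra).
    assert (b2 : T2 < b) by (unfold b; pose proof (Rmax_r T T2); lra).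
    specialize (HT2 b b2). change (Rabs (RInt f 0 b - l) < e) in HT2.
    pose proof (okR_diff M f T b H HT ltac:(lra)) as D. rewrite Rmin_left in D by lra.
    pose proof (Rabs_triang (RInt f 0 b - l) (- (RInt f 0 b - RInt f 0 T))) as Q.
    rewrite Rabs_Ropp in Q.
    replace (RInt f 0 b - l + - (RInt f 0 b - RInt f 0 T)) with (RInt f 0 T - l) in Q by ring.
    unfold e in *. lra.
Qed.

Lemma RInt0oo_unique (f : R -> R) (l : R) :
  is_RInt_gen f (at_point 0) (Rbar_locally p_infty) l -> RInt0oo f = l.
Proof. apply (is_RInt_gen_unique (V := R_CompleteNormedModule)). Qed.

Lemma RInt0oo_correct (M : R) (f : R -> R) : okR M f ->
  is_RInt_gen f (at_point 0) (Rbar_locally p_infty) (RInt0oo f) /\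
  forall T, 0 <= T -> Rabs (RInt f 0 T - RInt0oo f) <= 2 * M * exp (- T / 2).
Proof.
  intros H. destruct (okR_lim M f H) as (l & H1 & H2).
  rewrite (RInt0oo_unique f l H1). auto.
Qed.

Lemma RInt0oo_bound (M : R) (f : R -> R) : okR M f -> Rabs (RInt0oo f) <= 2 * M.
Proof.
  intros H. destruct (RInt0oo_correct M f H) as [_ B]. specialize (B 0 (Rle_refl 0)).
  rewrite RInt_point in B. change zero with 0 in B.
  replace (- 0 / 2) with 0 in B by field. rewrite exp_0 in B.
  rewrite <- Rabs_Ropp. replace (- RInt0oo f) with (0 - RInt0oo f) by ring. lra.
Qed.

Lemma RInt0oo_plus (M N : R) (f g : R -> R) : okR M f -> okR N g ->
  RInt0oo (fun s => f s + g s) = RInt0oo f + RInt0oo g.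
Proof.
  intros Hf Hg. apply RInt0oo_unique.
  apply (is_RInt_gen_plus (V := R_NormedModule) f g); [apply (RInt0oo_correct M), Hf|apply (RInt0oo_correct N), Hg].
Qed.

Lemma RInt0oo_scal (M k : R) (f : R -> R) : okR M f -> RInt0oo (fun s => k * f s) = k * RInt0oo f.
Proof.
  intros Hf. apply RInt0oo_unique.
  apply (is_RInt_gen_scal (V := R_NormedModule) f k); apply (RInt0oo_correct M), Hf.
Qed.

(** The value of [RInt_gen] is chosen from the predicate [is_RInt_gen]; the two predicates coincide,
    so the chosen values do as well, whether or not the integrals converge. *)
Lemma RInt0oo_ext (f g : R -> R) : (forall s, 0 < s -> f s = g s) -> RInt0oo f = RInt0oo g.
Proof.
  intros E. unfold RInt0oo, RInt_gen.
  assert (forall l, is_RInt_gen f (at_point 0) (Rbar_locally p_infty) l <->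
                    is_RInt_gen g (at_point 0) (Rbar_locally p_infty) l) as K.
  { assert (K0 : forall u v : R -> R, (forall s, 0 < s -> u s = v s) -> forall l,
      is_RInt_gen u (at_point 0) (Rbar_locally p_infty) l ->
      is_RInt_gen v (at_point 0) (Rbar_locally p_infty) l).
    { intros u v Euv l. apply is_RInt_gen_ext.
      exists (fun a => a = 0) (fun b => 0 < b); [reflexivity|exists 0; auto|].
      intros a b -> Hb x Hx; simpl in *. rewrite Rmin_left in Hx by lra. apply Euv; lra. }
    intros l; split; apply K0; auto. intros; symmetry; auto. }
  f_equal. apply functional_extensionality. intros l. apply propositional_extensionality, K.
Qed.

Lemma RInt0oo_approx (M : R) (f : R -> R) : okR M f -> forall eps, 0 < eps ->
  exists T, 1 <= T /\ forall t, T <= t -> Rabs (RInt f 0 t - RInt0oo f) < eps.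
Proof.
  intros H eps He. pose proof (okR_ge0 M f H) as M0. destruct (RInt0oo_correct M f H) as [_ B].
  destruct (exp_tail (2 * M) eps ltac:(lra) He) as (T & HT & E). exists T. split; auto.
  intros t Ht. eapply Rle_lt_trans; [apply B; lra|]. apply E, Ht.
Qed.

Lemma RInt0oo_ge_RInt (M : R) (f : R -> R) (a b : R) : okR M f -> (forall s, 0 <= s -> 0 <= f s) ->
  0 <= a -> a <= b -> RInt f a b <= RInt0oo f.
Proof.
  intros H P Ha Hab. apply Rnot_lt_le. intro L.
  destruct (RInt0oo_approx M f H (RInt f a b - RInt0oo f) ltac:(lra)) as (T0 & _ & B).
  set (T := Rmax b T0). specialize (B T (Rmax_r _ _)). assert (HT : b <= T) by apply Rmax_l.
  assert (X : forall u v, 0 <= u -> u <= v -> ex_RInt f u v /\ 0 <= RInt f u v).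
  { intros u v Hu Hv. assert (ex_RInt f u v) by (apply (okR_ex M); auto).
    split; auto. apply RInt_ge_0; auto. intros; apply P; lra. }
  destruct (X 0 a), (X a b), (X b T), (X a T); try lra.
  pose proof (RInt_Chasles f 0 a T) as E. pose proof (RInt_Chasles f a b T) as E'.
  unfold plus in E, E'; simpl in E, E'. rewrite <- E, <- E' in B by auto.
  apply Rabs_lt_between in B. lra.
Qed.

Lemma RInt0oo_pos (M : R) (f : R -> R) (a b : R) : okR M f -> (forall s, 0 <= s -> 0 <= f s) ->
  0 <= a -> a < b -> (forall s, a < s < b -> 0 < f s) -> 0 < RInt0oo f.
Proof.
  intros H P Ha Hab Q.
  apply Rlt_le_trans with (RInt f a b); [|apply (RInt0oo_ge_RInt M); auto; lra].
  apply RInt_gt_0; auto.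
  intros x Hx. apply H; lra.
Qed.

(** Differentiability is asked only on the open half-line, where a power of s is exp (a ln s); at 0
    only continuity of the antiderivative is at hand. *)
Lemma RInt0oo_ftc (M : R) (f F : R -> R) : okR M f ->
  (forall s, 0 < s -> is_derive F s (f s)) -> continuous F 0 ->
  is_lim F p_infty 0 -> RInt0oo f = - F 0.
Proof.
  intros H HD HC HL. pose proof (okR_ge0 M f H) as M0.
  assert (E : forall T, 0 < T -> RInt f 0 T = F T - F 0).
  { intros T HT. apply cond_eq. intros eps He.
    destruct (proj1 (filterlim_locally _ _) HC (mkposreal (eps / 2) ltac:(lra))) as [d Hd].
    pose proof (cond_pos d) as Pd.
    (* The fundamental theorem is applied on [c, T] with c = a / 2 so small that both the integral
       over [0, c] and F c - F 0 stay below eps / 2. *)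
    set (a := Rmin (Rmin (d / 2) T) (eps / (4 * (M + 1)))).
    assert (a0 : 0 < a) by (repeat apply Rmin_pos; try lra; apply Rdiv_lt_0_compat; lra).
    destruct (proj1 (Rmin_Rgt (Rmin (d / 2) T) (eps / (4 * (M + 1))) (a / 2))) as [a12 a3]; [fold a; lra|].
    destruct (proj1 (Rmin_Rgt (d / 2) T (a / 2)) a12) as [a1 a2].
    clear a12. set (c := a / 2) in *. assert (c0 : 0 < c) by (unfold c; lra).
    apply Rlt_div_r in a3; [|lra].
    assert (I : is_RInt f c T (minus (F T) (F c))).
    { apply (is_RInt_derive (V := R_CompleteNormedModule) F f); intros x Hx; rewrite Rmin_left in Hx by lra;
        [apply HD|apply H]; lra. }
    apply (is_RInt_unique (V := R_CompleteNormedModule)) in I.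
    assert (X1 : ex_RInt f 0 c) by (apply (okR_ex M); auto; lra).
    assert (X2 : ex_RInt f c T) by (apply (okR_ex M); auto; lra).
    pose proof (RInt_Chasles f 0 c T X1 X2) as Ch. rewrite I in Ch.
    change (RInt f 0 c + (F T + - F c) = RInt f 0 T) in Ch.
    assert (S : Rabs (RInt f 0 c) <= (c - 0) * M).
    { apply (abs_RInt_le_const f 0 c); [lra|exact X1|].
      intros s Hs. eapply Rle_trans; [apply H; lra|].
      rewrite <- (Rmult_1_r M) at 2. rewrite <- exp_0. apply Rmult_le_compat_l; auto. apply exp_le; lra. }
    assert (C : Rabs (F c - F 0) < eps / 2).
    { apply (Hd c). change (Rabs (c - 0) < d). rewrite Rabs_pos_eq; lra. }
    rewrite <- Ch.
    replace (RInt f 0 c + (F T + - F c) - (F T - F 0)) with (RInt f 0 c - (F c - F 0)) by ring.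
    eapply Rle_lt_trans; [apply Rabs_triang|]. rewrite Rabs_Ropp. nra. }
  apply cond_eq. intros eps He.
  apply is_lim_spec in HL. destruct (HL (mkposreal (eps / 2) ltac:(lra))) as [T0 HT0].
  destruct (RInt0oo_approx M f H (eps / 2) ltac:(lra)) as (T1 & HT1 & B).
  set (T := Rmax T1 (T0 + 1)). assert (L1 : T1 <= T) by apply Rmax_l. assert (L2 : T0 + 1 <= T) by apply Rmax_r.
  specialize (HT0 T ltac:(lra)). simpl in HT0. rewrite Rminus_0_r in HT0.
  specialize (B T L1). rewrite (E T) in B by lra.
  replace (RInt0oo f - - F 0) with (F T - (F T - F 0 - RInt0oo f)) by ring.
  eapply Rle_lt_trans; [apply Rabs_triang|]. rewrite Rabs_Ropp. lra.
Qed.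

Lemma filter_list {T A : Type} (F : (T -> Prop) -> Prop) {FF : Filter F} (P : A -> T -> Prop) (l : list A) :
  (forall a, In a l -> F (P a)) -> F (fun t => forall a, In a l -> P a t).
Proof.
  induction l as [|a l IH]; intros H.
  - apply filter_forall. intros t a [].
  - assert (H1 : F (P a)) by (apply H; left; auto).
    assert (H2 : F (fun t => forall b, In b l -> P b t)) by (apply IH; intros; apply H; right; auto).
    generalize (filter_and _ _ H1 H2). apply filter_imp. intros t [K1 K2] b [<-|Hb]; auto.
Qed.

(** Uniform tails reduce the claim to a compact interval, where joint continuity is uniform. The set
    D restricts the directions of approach: it will be the closed upper half-plane at the cut, and
    the slit plane with 0 added for the behaviour at infinity. *)
Lemma RInt0oo_param {U : UniformSpace} (D : U -> Prop) (f : U -> R -> R) (p0 : U) (M : R) :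
  D p0 -> locally p0 (fun p => D p -> okR M (f p)) ->
  (forall s, 0 <= s -> continuous (fun q : U * R => f (fst q) (snd q)) (p0, s)) ->
  forall eps, 0 < eps -> locally p0 (fun p => D p -> Rabs (RInt0oo (f p) - RInt0oo (f p0)) < eps).
Proof.
  intros D0 Hok Hc eps He.
  assert (Hok0 : okR M (f p0)) by (apply (locally_singleton _ _ Hok D0)).
  pose proof (okR_ge0 _ _ Hok0) as M0.
  destruct (exp_tail (2 * M) (eps / 4) ltac:(lra) ltac:(lra)) as (T & T1 & E4).
  specialize (E4 T (Rle_refl T)).
  (* A pointwise error 2 e over [0, T] integrates to eps / 4; two tails below eps / 4 are added to
     it. *)
  set (e := eps / (8 * T)). assert (He' : 0 < e) by (apply Rdiv_lt_0_compat; lra).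
  assert (Dl : forall t : R, exists d : posreal, 0 <= t -> locally p0 (fun p => forall s, Rabs (s - t) < d -> Rabs (f p s - f p0 t) < e)).
  { intros t. destruct (Rle_dec 0 t) as [Ht|Ht]; [|exists (mkposreal 1 Rlt_0_1); intros; contradiction].
    destruct (proj1 (filterlim_locally _ _) (Hc t Ht) (mkposreal e He')) as [d Hd].
    exists d. intros _. exists d. intros p Hp s Hs. apply (Hd (p, s)). split; [exact Hp|exact Hs]. }
  destruct (choice _ Dl) as [dl Hdl].
  (* The finite subcover is available only under a double negation. *)
  apply NNPP. intro NN.
  apply (compactness_list 1 (0, tt) (T, tt) (fun t => dl (fst t))). intros [l Hl]. apply NN. clear NN.
  assert (F : locally p0 (fun p => forall t, In t l -> bounded_n 1 (0, tt) (T, tt) t ->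
     forall s, Rabs (s - fst t) < dl (fst t) -> Rabs (f p s - f p0 (fst t)) < e)).
  { apply (filter_list (locally p0) (fun (t : Compactness.Tn 1 R) p => bounded_n 1 (0, tt) (T, tt) t ->
      forall s, Rabs (s - fst t) < dl (fst t) -> Rabs (f p s - f p0 (fst t)) < e)).
    intros [t []] Hin.
    destruct (Rle_dec 0 t) as [Ht|Ht].
    - generalize (Hdl t Ht). apply filter_imp. intros p Hp _. exact Hp.
    - apply filter_forall. intros p [Hb _]. lra. }
  pose proof (locally_singleton _ _ F) as F0.
  generalize (filter_and _ _ F Hok). apply filter_imp. intros p [Fp Okp] Dp.
  specialize (Okp Dp).
  assert (Unif : forall s, 0 <= s <= T -> Rabs (f p s - f p0 s) < 2 * e).
  { intros s Hs. destruct (Hl (s, tt)) as ([t []] & Hin & Hb & Hcl).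
    - simpl. auto.
    - destruct Hcl as [Hcl _]. simpl in Hcl.
      pose proof (Fp (t, tt) Hin Hb s Hcl) as A1. pose proof (F0 (t, tt) Hin Hb s Hcl) as A2. simpl in A1, A2.
      replace (f p s - f p0 s) with ((f p s - f p0 t) - (f p0 s - f p0 t)) by ring.
      eapply Rle_lt_trans; [apply Rabs_triang|]. rewrite Rabs_Ropp. lra. }
  destruct (RInt0oo_correct M _ Hok0) as [_ B0]. destruct (RInt0oo_correct M _ Okp) as [_ B1].
  specialize (B0 T ltac:(lra)). specialize (B1 T ltac:(lra)).
  assert (I : Rabs (RInt (f p) 0 T - RInt (f p0) 0 T) <= (T - 0) * (2 * e)).
  { assert (X1 := okR_ex M _ 0 T Okp ltac:(lra) ltac:(lra)).
    assert (X2 := okR_ex M _ 0 T Hok0 ltac:(lra) ltac:(lra)).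
    pose proof (RInt_minus (V := R_CompleteNormedModule) (f p) (f p0) 0 T X1 X2) as E.
    unfold minus, plus, opp in E; simpl in E. unfold Rminus at 1. rewrite <- E.
    apply abs_RInt_le_const; [lra| |].
    - apply (ex_RInt_minus (V := R_CompleteNormedModule) (f p) (f p0)); auto.
    - intros s Hs. left. apply Unif, Hs. }
  assert (I2 : (T - 0) * (2 * e) = eps / 4) by (unfold e; field; lra).
  replace (RInt0oo (f p) - RInt0oo (f p0)) with
    (- (RInt (f p) 0 T - RInt0oo (f p)) + (RInt (f p) 0 T - RInt (f p0) 0 T) + (RInt (f p0) 0 T - RInt0oo (f p0))) by ring.
  eapply Rle_lt_trans; [apply Rabs_triang|].
  eapply Rle_lt_trans; [apply Rplus_le_compat_r, Rabs_triang|]. rewrite Rabs_Ropp. lra.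
Qed.

Definition CInt0oo (f : R -> C) : C := (RInt0oo (fun s => Re (f s)), RInt0oo (fun s => Im (f s))).

Definition Ccts (f : R -> C) (s : R) : Prop :=
  continuous (fun s => Re (f s)) s /\ continuous (fun s => Im (f s)) s.

Definition okC (M : R) (f : R -> C) : Prop :=
  forall s, 0 <= s -> Ccts f s /\ Cmod (f s) <= M * exp (- s / 2).

Lemma okC_Re (M : R) (f : R -> C) : okC M f -> okR M (fun s => Re (f s)).
Proof.
  intros H s Hs. destruct (H s Hs) as [[H1 H2] B]. split; auto.
  eapply Rle_trans; [apply re_le_Cmod|exact B].
Qed.
Lemma okC_Im (M : R) (f : R -> C) : okC M f -> okR M (fun s => Im (f s)).
Proof.
  intros H s Hs. destruct (H s Hs) as [[H1 H2] B]. split; auto.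
  eapply Rle_trans; [apply Im_le_Cmod|exact B].
Qed.

Lemma CInt0oo_bound (M : R) (f : R -> C) : okC M f -> Cmod (CInt0oo f) <= 4 * M.
Proof.
  intros H. eapply Rle_trans; [apply Cmod_le_abs|].
  pose proof (RInt0oo_bound M _ (okC_Re M f H)). pose proof (RInt0oo_bound M _ (okC_Im M f H)).
  unfold CInt0oo; simpl Re; simpl Im. lra.
Qed.

Lemma Ccts_plus (f g : R -> C) (s : R) : Ccts f s -> Ccts g s -> Ccts (fun s => f s + g s)%C s.
Proof.
  intros [A B] [A' B']. split.
  - exact (cU_plus (fun s => Re (f s)) (fun s => Re (g s)) s A A').
  - exact (cU_plus (fun s => Im (f s)) (fun s => Im (g s)) s B B').
Qed.

Lemma Ccts_mult (f g : R -> C) (s : R) : Ccts f s -> Ccts g s -> Ccts (fun s => f s * g s)%C s.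
Proof.
  intros [A B] [A' B']. split.
  - apply (cU_minus (fun s => Re (f s) * Re (g s)) (fun s => Im (f s) * Im (g s))); apply cU_mult; auto.
  - apply (cU_plus (fun s => Re (f s) * Im (g s)) (fun s => Im (f s) * Re (g s))); apply cU_mult; auto.
Qed.

Lemma Ccts_const (c : C) (s : R) : Ccts (fun _ => c) s.
Proof. split; apply cU_const. Qed.

Lemma okC_plus (M N : R) (f g : R -> C) : okC M f -> okC N g -> okC (M + N) (fun s => f s + g s)%C.
Proof.
  intros Hf Hg s Hs. destruct (Hf s Hs) as [A B]. destruct (Hg s Hs) as [A' B']. split.
  - apply Ccts_plus; auto.
  - eapply Rle_trans; [apply Cmod_triangle|]. lra.
Qed.

Lemma okC_scal (M : R) (c : C) (f : R -> C) : okC M f -> okC (Cmod c * M) (fun s => c * f s)%C.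
Proof.
  intros Hf s Hs. destruct (Hf s Hs) as [A B]. split.
  - apply Ccts_mult; auto. apply Ccts_const.
  - rewrite Cmod_mult. pose proof (Cmod_ge_0 c). nra.
Qed.

Lemma CInt0oo_plus (M N : R) (f g : R -> C) : okC M f -> okC N g ->
  CInt0oo (fun s => f s + g s)%C = (CInt0oo f + CInt0oo g)%C.
Proof.
  intros Hf Hg. apply C_ext; unfold CInt0oo; simpl Re; simpl Im.
  - apply (RInt0oo_plus M N (fun s => Re (f s)) (fun s => Re (g s))); apply okC_Re; auto.
  - apply (RInt0oo_plus M N (fun s => Im (f s)) (fun s => Im (g s))); apply okC_Im; auto.
Qed.

Lemma okR_scal (M c : R) (f : R -> R) : okR M f -> okR (Rabs c * M) (fun s => c * f s).
Proof.
  intros Hf s Hs. destruct (Hf s Hs) as [A B]. split.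
  - apply cU_mult; auto. apply cU_const.
  - rewrite Rabs_mult. pose proof (Rabs_pos c). nra.
Qed.

Lemma CInt0oo_scal (M : R) (c : C) (f : R -> C) : okC M f -> CInt0oo (fun s => c * f s)%C = (c * CInt0oo f)%C.
Proof.
  intros Hf. pose proof (okC_Re M f Hf) as H1. pose proof (okC_Im M f Hf) as H2.
  apply C_ext; unfold CInt0oo; simpl Re; simpl Im.
  - transitivity (RInt0oo (fun s => Re c * Re (f s) + (- Im c) * Im (f s))).
    { apply RInt0oo_ext. intros s _. unfold Re, Im; simpl; ring. }
    rewrite (RInt0oo_plus (Rabs (Re c) * M) (Rabs (- Im c) * M)) by (apply okR_scal; auto).
    rewrite (RInt0oo_scal M) by auto. rewrite (RInt0oo_scal M) by auto. unfold Re, Im; simpl; ring.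
  - transitivity (RInt0oo (fun s => Re c * Im (f s) + (Im c) * Re (f s))).
    { apply RInt0oo_ext. intros s _. unfold Re, Im; simpl; ring. }
    rewrite (RInt0oo_plus (Rabs (Re c) * M) (Rabs (Im c) * M)) by (apply okR_scal; auto).
    rewrite (RInt0oo_scal M) by auto. rewrite (RInt0oo_scal M) by auto. unfold Re, Im; simpl; ring.
Qed.

Lemma CInt0oo_ext (f g : R -> C) : (forall s, 0 < s -> f s = g s) -> CInt0oo f = CInt0oo g.
Proof. intros E. unfold CInt0oo. f_equal; apply RInt0oo_ext; intros s Hs; rewrite E; auto. Qed.

(** No limit is interchanged with the integral: a dominated second derivative bounds the Taylor
    remainder of the integrand by 4 M |h|^2 exp (- s / 2), whose integral is at most 16 M |h|^2. *)
Lemma CInt0oo_der (f df ddf : C -> R -> C) (w0 : C) (r M : R) : 0 < r ->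
  (forall w, Cmod (w - w0)%C < r -> okC M (f w)) ->
  (forall w, Cmod (w - w0)%C < r -> okC M (df w)) ->
  (forall w s, Cmod (w - w0)%C < r -> 0 <= s ->
     Cder (fun w => f w s) w (df w s) /\ Cder (fun w => df w s) w (ddf w s) /\ Cmod (ddf w s) <= M * exp (- s / 2)) ->
  Cder (fun w => CInt0oo (f w)) w0 (CInt0oo (df w0)).
Proof.
  intros Hr H1 H2 H3 eps He.
  assert (Z0 : Cmod (w0 - w0)%C < r) by (replace (w0 - w0)%C with (RtoC 0) by ring; rewrite Cmod_0; auto).
  assert (M0 : 0 <= M).
  { destruct (H1 w0 Z0 0 (Rle_refl 0)) as [_ B]. replace (- 0 / 2) with 0 in B by field. rewrite exp_0 in B.
    pose proof (Cmod_ge_0 (f w0 0)); lra. }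
  exists (Rmin r (eps / (16 * (M + 1)))). split; [apply Rmin_pos; [lra|apply Rdiv_lt_0_compat; lra]|].
  intros h Hh.
  destruct (Rmin_Rgt_l _ _ _ Hh) as [h1 h2].
  pose proof (Cmod_ge_0 h) as Hp.
  assert (B : forall t : R, 0 <= t <= 1 -> Cmod (w0 + t * h - w0)%C < r).
  { intros t Ht. replace (w0 + t * h - w0)%C with (t * h)%C by ring.
    rewrite Cmod_mult, Cmod_R, Rabs_pos_eq by lra. nra. }
  assert (Bh : Cmod (w0 + h - w0)%C < r) by (replace (w0 + h - w0)%C with h by ring; auto).
  assert (O : okC (4 * M * (Cmod h * Cmod h)) (fun s => (f (w0 + h)%C s + (-1) * f w0 s) + (- h) * df w0 s)%C).
  { intros s Hs. split.
    - apply (Ccts_plus (fun s => f (w0 + h)%C s + (-1) * f w0 s)%C (fun s => - h * df w0 s)%C).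
      + apply (Ccts_plus (f (w0 + h)%C) (fun s => (-1) * f w0 s)%C); [apply H1; auto|].
        apply Ccts_mult; [apply Ccts_const|apply H1; auto].
      + apply Ccts_mult; [apply Ccts_const|apply H2; auto].
    - pose proof (Ctaylor (fun w => f w s) (fun w => df w s) (fun w => ddf w s) w0 h (M * exp (- s / 2))) as T.
      replace (f (w0 + h) s + -1 * f w0 s + - h * df w0 s)%C with (f (w0 + h) s - f w0 s - h * df w0 s)%C by ring.
      eapply Rle_trans; [apply T|].
      + intros t Ht. apply H3; auto.
      + intros t Ht. apply H3; auto.
      + intros t Ht. apply H3; auto.
      + right; ring. }
  assert (E : CInt0oo (fun s => (f (w0 + h)%C s + (-1) * f w0 s) + (- h) * df w0 s)%C =
     (CInt0oo (f (w0 + h)%C) - CInt0oo (f w0) - h * CInt0oo (df w0))%C).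
  { pose proof (H1 _ Bh) as O1. pose proof (H1 _ Z0) as O2. pose proof (H2 _ Z0) as O3.
    rewrite (CInt0oo_plus (M + Cmod (RtoC (-1)) * M) (Cmod (- h)%C * M)).
    - rewrite (CInt0oo_plus M (Cmod (RtoC (-1)) * M)); auto; [|apply okC_scal; auto].
      rewrite (CInt0oo_scal M), (CInt0oo_scal M) by auto. ring.
    - apply okC_plus; auto. apply okC_scal; auto.
    - apply okC_scal; auto. }
  rewrite <- E. eapply Rle_trans; [apply (CInt0oo_bound _ _ O)|].
  apply Rlt_div_r in h2; [|lra].
  nra.
Qed.

Lemma CInt0oo_param {U : UniformSpace} (D : U -> Prop) (f : U -> R -> C) (p0 : U) (M : R) :
  D p0 -> locally p0 (fun p => D p -> okC M (f p)) ->
  (forall s, 0 <= s -> continuous (fun q : U * R => Re (f (fst q) (snd q))) (p0, s) /\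
                       continuous (fun q : U * R => Im (f (fst q) (snd q))) (p0, s)) ->
  forall eps, 0 < eps -> locally p0 (fun p => D p -> Cmod (CInt0oo (f p) - CInt0oo (f p0))%C < eps).
Proof.
  intros D0 Hok Hc eps He.
  assert (A1 := RInt0oo_param D (fun p s => Re (f p s)) p0 M D0).
  assert (A2 := RInt0oo_param D (fun p s => Im (f p s)) p0 M D0).
  specialize (A1 (filter_imp _ _ (fun p H Dp => okC_Re M _ (H Dp)) Hok)).
  specialize (A2 (filter_imp _ _ (fun p H Dp => okC_Im M _ (H Dp)) Hok)).
  specialize (A1 (fun s Hs => proj1 (Hc s Hs)) (eps / 2) ltac:(lra)).
  specialize (A2 (fun s Hs => proj2 (Hc s Hs)) (eps / 2) ltac:(lra)).
  generalize (filter_and _ _ A1 A2). apply filter_imp. intros p [B1 B2] Dp.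
  specialize (B1 Dp). specialize (B2 Dp).
  eapply Rle_lt_trans; [apply Cmod_le_abs|].
  change (Rabs (RInt0oo (fun s => Re (f p s)) - RInt0oo (fun s => Re (f p0 s))) +
          Rabs (RInt0oo (fun s => Im (f p s)) - RInt0oo (fun s => Im (f p0 s))) < eps). lra.
Qed.

(** * The integral of [exp (- s) s^a (s + w)^b] *)

(** The value 0 for s <= 0 is imposed because [ln] is 0 there by convention, so that exp (a * ln s)
    would be 1. With it the power is jointly continuous in (a, s) wherever a > 0. *)
Definition spow (a s : R) : R := if Rle_dec s 0 then 0 else exp (a * ln s).

Lemma spow_pos (a s : R) : 0 < s -> spow a s = exp (a * ln s).
Proof. intros H. unfold spow. destruct (Rle_dec s 0); [lra|reflexivity]. Qed.

Lemma spow_np (a s : R) : s <= 0 -> spow a s = 0.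
Proof. intros H. unfold spow. destruct (Rle_dec s 0); [reflexivity|lra]. Qed.

Lemma spow_ge0 (a s : R) : 0 <= spow a s.
Proof. unfold spow. destruct (Rle_dec s 0); [lra|left; apply exp_pos]. Qed.

Lemma ln_le' (x y : R) : 0 < x -> x <= y -> ln x <= ln y.
Proof. intros H [L| ->]; [left; apply ln_increasing; auto|right; reflexivity]. Qed.

Lemma squeeze0 {U : UniformSpace} (f : U -> R) (p : U) : f p = 0 ->
  (forall eps, 0 < eps -> locally p (fun q => Rabs (f q) < eps)) -> continuous f p.
Proof.
  intros E H. apply filterlim_locally. intros eps. generalize (H eps (cond_pos eps)).
  apply filter_imp. intros q Hq. rewrite E. change (Rabs (f q - 0) < eps). rewrite Rminus_0_r; auto.
Qed.

Lemma cont_loc {U : UniformSpace} (f : U -> R) (p : U) : continuous f p ->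
  forall eps, 0 < eps -> locally p (fun q => Rabs (f q - f p) < eps).
Proof.
  intros H eps He. exact (proj1 (filterlim_locally _ _) H (mkposreal eps He)).
Qed.

Lemma cU_ext_loc {U : UniformSpace} (f g : U -> R) (p : U) :
  locally p (fun q => f q = g q) -> continuous f p -> continuous g p.
Proof.
  intros E Hf P HP. rewrite <- (locally_singleton _ _ E) in HP. specialize (Hf P HP).
  generalize (filter_and _ _ E Hf). unfold filtermap. apply filter_imp. intros q [-> Hq]. exact Hq.
Qed.

Lemma cU_spow {U : UniformSpace} (A S : U -> R) (p : U) :
  continuous A p -> continuous S p -> 0 < A p -> continuous (fun q => spow (A q) (S q)) p.
Proof.
  intros HA HS H.
  destruct (Rtotal_order (S p) 0) as [L|[L|L]].
  - apply (cU_ext_loc (fun _ => 0)); [|apply cU_const].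
    generalize (cont_loc S p HS (- S p) ltac:(lra)). apply filter_imp. intros q Hq.
    apply Rabs_lt_between in Hq. rewrite spow_np; lra.
  - apply squeeze0; [apply spow_np; lra|]. intros eps He.
    (* Near p the exponent exceeds A p / 2. For 0 < S q < 1 the power is then at most S q to the A p
       / 2, which is below eps once S q < eps^(2 / A p). *)
    set (c := Rmin (1/2) (exp (2 * ln eps / A p))).
    assert (Hc : 0 < c) by (apply Rmin_pos; [lra|apply exp_pos]).
    assert (HA2 : 0 < A p / 2) by lra.
    generalize (filter_and _ _ (cont_loc A p HA _ HA2) (cont_loc S p HS c Hc)).
    apply filter_imp. intros q [H1 H2].
    rewrite Rabs_pos_eq by apply spow_ge0.
    destruct (Rle_lt_dec (S q) 0) as [N|P]; [rewrite spow_np; lra|].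
    rewrite spow_pos by auto. rewrite L, Rminus_0_r, Rabs_pos_eq in H2 by lra.
    apply Rabs_lt_between in H1.
    assert (L1 : ln (S q) < 2 * ln eps / A p).
    { rewrite <- (ln_exp (2 * ln eps / A p)). apply ln_increasing; auto.
      eapply Rlt_le_trans; [apply H2|apply Rmin_r]. }
    assert (L2 : ln (S q) < 0).
    { rewrite <- ln_1. apply ln_increasing; auto. apply Rlt_trans with (1/2); [|lra].
      eapply Rlt_le_trans; [apply H2|apply Rmin_l]. }
    rewrite <- (exp_ln eps) by auto. apply exp_increasing.
    apply Rlt_div_r in L1; [|lra]. nra.
  - apply (cU_ext_loc (fun q => exp (A q * ln (S q)))).
    + generalize (cont_loc S p HS (S p) L). apply filter_imp. intros q Hq.
      apply Rabs_lt_between in Hq. rewrite spow_pos; lra.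
    + apply cU_exp, cU_mult; auto. apply cU_ln; auto.
Qed.

(** Obtained from ln y <= y at y = (1 + s) e with e = 1 / (8 (A + 1)). At rate 1/8 the two powers in
    an integrand cost 1/4 together, and exp (- s) still leaves the required exp (- s / 2). *)
Lemma exp_ln_growth (A : R) : 0 <= A -> exists K, 0 < K /\
  forall a s, 0 <= s -> 0 <= a <= A -> exp (a * ln (1 + s)) <= K * exp (s / 8).
Proof.
  intros HA. set (e := / (8 * (A + 1))).
  assert (He : 0 < e) by (apply Rinv_0_lt_compat; lra).
  exists (exp (1/8 + A * (- ln e + 0))). split; [apply exp_pos|]. intros a s Hs Ha.
  rewrite <- exp_plus. apply exp_le.
  assert (L0 : 0 <= ln (1 + s)) by (rewrite <- ln_1; apply ln_le'; lra).
  apply Rle_trans with (A * ln (1 + s)); [nra|].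
  assert (L : ln ((1 + s) * e) <= (1 + s) * e).
  { assert (P : 0 < (1 + s) * e) by nra.
    pose proof (exp_ineq1_le (ln ((1 + s) * e))) as Q. rewrite exp_ln in Q by auto. lra. }
  rewrite ln_mult in L by lra.
  assert (A * e <= / 8).
  { unfold e. rewrite Rinv_mult. apply Rmult_le_reg_r with (A + 1); [lra|].
    replace (A * (/ 8 * / (A + 1)) * (A + 1)) with (A / 8) by (field; lra). lra. }
  assert (A * ln (1 + s) <= A * ((1 + s) * e - ln e)) by nra.
  assert (A * ((1 + s) * e) <= (1 + s) / 8) by nra.
  lra.
Qed.

Lemma spow_growth (A : R) : 0 <= A -> exists K, 0 < K /\
  forall a s x, 0 <= s -> 0 <= a <= A -> x <= 1 + s -> spow a x <= K * exp (s / 8).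
Proof.
  intros HA. destruct (exp_ln_growth A HA) as (K & HK & B). exists K. split; auto.
  intros a s x Hs Ha Hx. destruct (Rle_lt_dec x 0) as [N|P].
  - rewrite spow_np by auto. pose proof (exp_pos (s / 8)). nra.
  - rewrite spow_pos by auto. eapply Rle_trans; [|apply (B a s Hs Ha)].
    apply exp_le. apply Rmult_le_compat_l; [lra|]. apply ln_le'; lra.
Qed.

Definition Hw (a s : R) : R := exp (- s) * spow a s.

Lemma Hw_ge0 (a s : R) : 0 <= Hw a s.
Proof. unfold Hw. pose proof (exp_pos (- s)). pose proof (spow_ge0 a s). nra. Qed.

Lemma Hw_pos (a s : R) : 0 < s -> 0 < Hw a s.
Proof.
  intros H. unfold Hw. rewrite spow_pos by auto. apply Rmult_lt_0_compat; apply exp_pos.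
Qed.

Lemma cU_Hw {U : UniformSpace} (A S : U -> R) (p : U) :
  continuous A p -> continuous S p -> 0 < A p -> continuous (fun q => Hw (A q) (S q)) p.
Proof.
  intros HA HS H. unfold Hw. apply cU_mult; [apply cU_exp, cU_opp, HS|apply cU_spow; auto].
Qed.

Lemma Hw_dom (A : R) : 0 <= A -> exists M, 0 < M /\ forall (K a s : R) (z : C),
   0 <= s -> 0 <= a <= A -> Cmod z <= K * exp (s / 8) -> 
   Cmod (Hw a s * z)%C <= (M * K) * exp (- s / 2).
Proof.
  intros HA. destruct (spow_growth A HA) as (M & HM & B). exists M; split; auto.
  intros K a s z Hs Ha Hz.
  rewrite Cmod_mult, Cmod_R, Rabs_pos_eq by apply Hw_ge0.
  specialize (B a s s Hs Ha ltac:(lra)).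
  unfold Hw. pose proof (exp_pos (- s)). pose proof (spow_ge0 a s). pose proof (Cmod_ge_0 z).
  pose proof (exp_pos (s / 8)).
  assert (0 <= K) by nra.
  apply Rle_trans with (exp (- s) * (M * exp (s / 8)) * (K * exp (s / 8))).
  { apply Rmult_le_compat; auto; [nra|]. apply Rmult_le_compat_l; lra. }
  replace (exp (- s) * (M * exp (s / 8)) * (K * exp (s / 8)))
    with ((M * K) * (exp (- s) * exp (s / 8) * exp (s / 8))) by ring.
  apply Rmult_le_compat_l; [nra|]. rewrite <- !exp_plus. apply exp_le. lra.
Qed.

Lemma slit_shift (w : C) (s : R) : slit_plane w -> 0 <= s -> slit_plane (s + w)%C.
Proof.
  intros [H|H] Hs; [left|right].
  - change (0 < s + Re w). lra.
  - change (0 + Im w <> 0). lra.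
Qed.

(** A horizontal ray going right from a point of the slit plane keeps a positive distance from 0.
    This controls s + w also under negative exponents, which appear after differentiation. *)
Lemma slit_away (w0 : C) : slit_plane w0 -> exists c, 0 < c < 1 /\
  forall w s, Cmod (w - w0)%C < c -> 0 <= s -> slit_plane w /\ c <= Cmod (s + w)%C.
Proof.
  intros [H|H].
  - exists (Rmin (1/2) (Re w0 / 2)). assert (P : 0 < Rmin (1/2) (Re w0 / 2)) by (apply Rmin_pos; lra).
    split; [pose proof (Rmin_l (1/2) (Re w0 / 2)); lra|].
    intros w s Hw Hs. pose proof (Rmin_r (1/2) (Re w0 / 2)).
    pose proof (re_le_Cmod (w - w0)%C) as L. change (Re (w - w0)%C) with (Re w - Re w0) in L.
    apply Rabs_le_between in L. split; [left; lra|].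
    pose proof (re_le_Cmod (s + w)%C) as L2. change (Re (s + w)%C) with (s + Re w) in L2.
    apply Rabs_le_between in L2. lra.
  - pose proof (Rabs_pos_lt _ H) as P0.
    exists (Rmin (1/2) (Rabs (Im w0) / 2)). assert (P : 0 < Rmin (1/2) (Rabs (Im w0) / 2)) by (apply Rmin_pos; lra).
    split; [pose proof (Rmin_l (1/2) (Rabs (Im w0) / 2)); lra|].
    intros w s Hw Hs. pose proof (Rmin_r (1/2) (Rabs (Im w0) / 2)).
    pose proof (Im_le_Cmod (w - w0)%C) as L. change (Im (w - w0)%C) with (Im w - Im w0) in L.
    assert (T : Rabs (Im w0) <= Rabs (Im w) + Rabs (Im w - Im w0)).
    { replace (Im w0) with (Im w - (Im w - Im w0)) at 1 by ring.
      eapply Rle_trans; [apply Rabs_triang|]. rewrite Rabs_Ropp. lra. }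
    split; [right; intro E; assert (E0 : Rabs (Im w) = 0) by (rewrite E; apply Rabs_R0); lra|].
    pose proof (Im_le_Cmod (s + w)%C) as L2. change (Im (s + w)%C) with (0 + Im w) in L2.
    rewrite Rplus_0_l in L2. lra.
Qed.

(** The two exponents are independent because differentiation in w lowers only the second one; the
    function H_m is the case a = b = m. *)
Definition Hf (a b : R) (w : C) (s : R) : C := (Hw a s * Cpw b (s + w))%C.
Definition H (a b : R) (w : C) : C := CInt0oo (Hf a b w).

Lemma Re_Hf (a b : R) (w : C) (s : R) : Re (Hf a b w s) =
  Hw a s * (exp (b * ln (Cmod (s + Re w, Im w))) * cos (b * carg (s + Re w, Im w))).
Proof.
  unfold Hf. rewrite re_scal_l. f_equal. unfold Cpw, Cexp, Clog.
  replace (s + w)%C with (s + Re w, Im w) by (apply C_ext; unfold Re, Im; simpl; ring).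
  unfold Re, Im; simpl. f_equal; f_equal; ring.
Qed.

Lemma Im_Hf (a b : R) (w : C) (s : R) : Im (Hf a b w s) =
  Hw a s * (exp (b * ln (Cmod (s + Re w, Im w))) * sin (b * carg (s + Re w, Im w))).
Proof.
  unfold Hf.
  replace (Im (Hw a s * Cpw b (s + w))%C) with (Hw a s * Im (Cpw b (s + w)%C)) by (unfold Im; simpl; ring).
  f_equal. unfold Cpw, Cexp, Clog.
  replace (s + w)%C with (s + Re w, Im w) by (apply C_ext; unfold Re, Im; simpl; ring).
  unfold Re, Im; simpl. f_equal; f_equal; ring.
Qed.

Lemma cU_Hf {U : UniformSpace} (A B X Y S : U -> R) (p : U) :
  continuous A p -> continuous B p -> continuous X p -> continuous Y p -> continuous S p ->
  0 < A p -> slit_plane (S p + X p, Y p) ->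
  continuous (fun q => Re (Hf (A q) (B q) (X q, Y q) (S q))) p /\
  continuous (fun q => Im (Hf (A q) (B q) (X q, Y q) (S q))) p.
Proof.
  intros HA HB HX HY HS PA Hsl.
  assert (C1 : continuous (fun q => Cmod (S q + X q, Y q)) p) by (apply cU_Cmod; auto; apply cU_plus; auto).
  assert (C2 : continuous (fun q => carg (S q + X q, Y q)) p) by (apply cU_carg; auto; apply cU_plus; auto).
  assert (C3 : continuous (fun q => ln (Cmod (S q + X q, Y q))) p) by (apply cU_ln; auto; apply slit_pos, Hsl).
  split.
  - apply (continuous_ext (fun q => Hw (A q) (S q) * (exp (B q * ln (Cmod (S q + X q, Y q))) * cos (B q * carg (S q + X q, Y q))))).
    { intros q. rewrite Re_Hf. reflexivity. }
    apply cU_mult; [apply cU_Hw; auto|]. apply cU_mult; [apply cU_exp|apply cU_cos]; apply cU_mult; auto.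
  - apply (continuous_ext (fun q => Hw (A q) (S q) * (exp (B q * ln (Cmod (S q + X q, Y q))) * sin (B q * carg (S q + X q, Y q))))).
    { intros q. rewrite Im_Hf. reflexivity. }
    apply cU_mult; [apply cU_Hw; auto|]. apply cU_mult; [apply cU_exp|apply cU_sin]; apply cU_mult; auto.
Qed.

Lemma Cpw_growth (w0 : C) (B : R) : slit_plane w0 -> 0 <= B -> exists r K, 0 < r /\ 0 < K /\
  forall w b s, Cmod (w - w0)%C < r -> Rabs b <= B -> 0 <= s ->
    slit_plane w /\ Cmod (Cpw b (s + w)) <= K * exp (s / 8).
Proof.
  intros Hsl HB. destruct (slit_away w0 Hsl) as (c & Hc & Hw).
  destruct (exp_ln_growth B HB) as (K & HK & HG).
  set (R0 := Cmod w0 + 2). pose proof (Cmod_ge_0 w0) as W0.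
  exists c, (K * exp (B * (ln R0 - ln c))).
  split; [lra|]. split; [apply Rmult_lt_0_compat; [auto|apply exp_pos]|].
  intros w b s Hr Hb Hs. destruct (Hw w s Hr Hs) as [S1 S2]. split; auto.
  rewrite Cmod_Cpw.
  assert (U : Cmod (s + w)%C <= R0 * (1 + s)).
  { eapply Rle_trans; [apply Cmod_triangle|]. rewrite Cmod_R, Rabs_pos_eq by lra.
    assert (Cmod w <= Cmod w0 + 1).
    { replace w with (w0 + (w - w0))%C by ring. eapply Rle_trans; [apply Cmod_triangle|]. lra. }
    unfold R0. nra. }
  assert (L1 : ln (Cmod (s + w)%C) <= ln R0 + ln (1 + s)).
  { rewrite <- ln_mult by (unfold R0; lra). apply ln_le'; lra. }
  assert (L2 : ln c <= ln (Cmod (s + w)%C)) by (apply ln_le'; lra).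
  assert (L3 : ln c < 0) by (rewrite <- ln_1; apply ln_increasing; lra).
  assert (L4 : 0 <= ln R0) by (rewrite <- ln_1; apply ln_le'; unfold R0; lra).
  assert (L5 : 0 <= ln (1 + s)) by (rewrite <- ln_1; apply ln_le'; lra).
  apply Rle_trans with (exp (B * (ln R0 - ln c)) * exp (B * ln (1 + s))).
  - rewrite <- exp_plus. apply exp_le. apply Rabs_le_between in Hb.
    set (X := ln R0 - ln c) in *.
    assert (- (X + ln (1 + s)) <= ln (Cmod (s + w)%C) <= X + ln (1 + s)) by (unfold X; lra).
    assert (0 <= X) by (unfold X; lra). nra.
  - specialize (HG B s Hs ltac:(lra)). pose proof (exp_pos (B * (ln R0 - ln c))). nra.
Qed.

(** Uniformity in w serves differentiation in w; uniformity in the exponents serves continuity in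
    m. *)
Lemma Hf_ok (w0 : C) (A B : R) : slit_plane w0 -> 0 <= A -> 0 <= B -> exists r M, 0 < r /\ 0 < M /\
  forall w a b, Cmod (w - w0)%C < r -> 0 < a <= A -> Rabs b <= B -> slit_plane w /\ okC M (Hf a b w).
Proof.
  intros Hsl HA HB. destruct (Cpw_growth w0 B Hsl HB) as (r & K & Hr & HK & HG).
  destruct (Hw_dom A HA) as (M & HM & HD).
  exists r, (M * K). split; [auto|]. split; [nra|].
  intros w a b Hw Ha Hb. split; [apply (HG w b 0 Hw Hb (Rle_refl 0))|].
  intros s Hs. destruct (HG w b s Hw Hb Hs) as [S1 S2]. split.
  - rewrite <- (pairC w). apply (cU_Hf (fun _ => a) (fun _ => b) (fun _ => Re w) (fun _ => Im w) (fun s => s)); try apply cU_const.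
    + apply continuous_id.
    + lra.
    + pose proof (slit_shift w s S1 Hs) as Q. destruct Q as [Q|Q]; [left; exact Q|right; simpl in Q |- *].
      change (0 + Im w <> 0) in Q. lra.
  - apply HD; auto. lra.
Qed.

Lemma Hf_ok1 (w : C) (a b : R) : slit_plane w -> 0 < a -> exists M, okC M (Hf a b w).
Proof.
  intros Hs Ha. destruct (Hf_ok w a (Rabs b) Hs) as (r & M & Hr & HM & HH); [lra|apply Rabs_pos|].
  exists M. apply (HH w a b); try lra. replace (w - w)%C with (RtoC 0) by ring. rewrite Cmod_0; auto.
Qed.

Lemma Cder_Hf (a b : R) (w : C) (s : R) : slit_plane w -> 0 <= s ->
  Cder (fun w => Hf a b w s) w (b * Hf a (b - 1) w s)%C.
Proof.
  intros Hsl Hs. unfold Hf. eapply Cder_eq.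
  - apply Cder_scal. apply (Cder_comp (Cpw b)).
    + apply Cder_Cpw, slit_shift; auto.
    + apply Cder_plus; [apply Cder_const|apply Cder_id].
  - ring.
Qed.

Lemma okC_scal_le (M N : R) (c : C) (f : R -> C) : okC M f -> Cmod c * M <= N -> okC N (fun s => c * f s)%C.
Proof.
  intros Hf L s Hs. destruct (okC_scal M c f Hf s Hs) as [A B]. split; auto.
  pose proof (exp_pos (- s / 2)). nra.
Qed.

Lemma okC_le (M N : R) (f : R -> C) : okC M f -> M <= N -> okC N f.
Proof.
  intros Hf L s Hs. destruct (Hf s Hs) as [A B]. split; auto.
  pose proof (exp_pos (- s / 2)). nra.
Qed.

Lemma Cder_H (a b : R) (w : C) : slit_plane w -> 0 < a -> Cder (H a b) w (b * H a (b - 1) w)%C.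
Proof.
  intros Hsl Ha.
  set (B := Rabs b + 2). pose proof (Rabs_pos b) as Pb.
  destruct (Hf_ok w a B Hsl) as (r & M & Hr & HM & HH); [lra|unfold B; lra|].
  assert (b0 : Rabs b <= B) by (unfold B; lra).
  assert (b1 : Rabs (b - 1) <= B).
  { unfold Rminus. eapply Rle_trans; [apply Rabs_triang|]. rewrite Rabs_Ropp, Rabs_R1. unfold B; lra. }
  assert (b2 : Rabs (b - 1 - 1) <= B).
  { replace (b - 1 - 1) with (b + - 2) by ring. eapply Rle_trans; [apply Rabs_triang|].
    rewrite (Rabs_left (-2)) by lra. unfold B; lra. }
  (* One constant for the integrand and its first two w-derivatives, whose factors b and b - 1 are
     at most B in absolute value. *)
  set (M' := M * (1 + B) * (1 + B)).
  assert (B0 : 0 < B) by (unfold B; lra).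
  eapply Cder_eq.
  - apply (CInt0oo_der (Hf a b) (fun w s => b * Hf a (b - 1) w s)%C
      (fun w s => b * ((b - 1)%R * Hf a (b - 1 - 1) w s))%C w r M' Hr).
    + intros v Hv. apply (okC_le M); [apply HH; auto; lra|unfold M'; nra].
    + intros v Hv. apply (okC_scal_le M); [apply HH; auto; lra|]. rewrite Cmod_R. unfold M'.
      apply Rle_trans with (B * M); [nra|]. nra.
    + intros v s Hv Hs. destruct (HH v a b Hv ltac:(lra) b0) as [Hv1 _].
      split; [apply Cder_Hf; auto|]. split; [apply Cder_scal, Cder_Hf; auto|].
      destruct (HH v a (b - 1 - 1) Hv ltac:(lra) b2) as [_ O]. destruct (O s Hs) as [_ O2].
      rewrite !Cmod_mult, !Cmod_R.
      pose proof (Cmod_ge_0 (Hf a (b - 1 - 1) v s)). pose proof (exp_pos (- s / 2)).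
      pose proof (Rabs_pos (b - 1)).
      apply Rle_trans with (B * (B * (M * exp (- s / 2)))).
      * apply Rmult_le_compat; auto; [apply Rmult_le_pos; auto|].
        apply Rmult_le_compat; auto.
      * unfold M'. replace (M * (1 + B) * (1 + B) * exp (- s / 2)) with ((1 + B) * ((1 + B) * (M * exp (- s / 2)))) by ring.
        assert (0 < M * exp (- s / 2)) by nra. nra.
  - destruct (Hf_ok1 w a (b - 1) Hsl Ha) as [N O]. apply (CInt0oo_scal N), O.
Qed.

Definition UC : UniformSpace := prod_UniformSpace R_UniformSpace C_UniformSpace.

Lemma locally_UC (m0 : R) (w0 : C) (P : UC -> Prop) : locally ((m0, w0) : UC) P ->
  exists d, 0 < d /\ forall m w, Rabs (m - m0) < d -> Cmod (w - w0)%C < d -> P (m, w).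
Proof.
  intros [d Hd]. exists d. split; [apply cond_pos|]. intros m w Hm Hw.
  apply Hd. split; [exact Hm|]. split.
  - eapply Rle_lt_trans; [apply (re_le_Cmod (w - w0)%C)|exact Hw].
  - eapply Rle_lt_trans; [apply (Im_le_Cmod (w - w0)%C)|exact Hw].
Qed.

Lemma locally_UC' (m0 : R) (w0 : C) (d : R) (P : UC -> Prop) : 0 < d ->
  (forall m w, Rabs (m - m0) < d -> Cmod (w - w0)%C < d -> P (m, w)) -> locally ((m0, w0) : UC) P.
Proof.
  intros Hd HP. exists (mkposreal (d / 2) ltac:(lra)). intros [m w] [H1 [H2 H3]].
  change (Rabs (m - m0) < d / 2) in H1.
  change (Rabs (Re w - Re w0) < d / 2) in H2. change (Rabs (Im w - Im w0) < d / 2) in H3.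
  apply HP; [lra|]. eapply Rle_lt_trans; [apply Cmod_le_abs|].
  change (Rabs (Re w - Re w0) + Rabs (Im w - Im w0) < d). lra.
Qed.

Lemma cUC_m {V : UniformSpace} (p : UC) (v : V) : continuous (fun q : UC * V => fst (fst q) : R) (p, v).
Proof.
  apply (continuous_comp (fun q : UC * V => fst q) (fun u : UC => fst u)).
  - apply continuous_fst.
  - destruct p. apply (continuous_fst (U := R_UniformSpace) (V := C_UniformSpace)).
Qed.
Lemma cUC_w {V : UniformSpace} (p : UC) (v : V) :
  continuous (fun q : UC * V => Re (snd (fst q))) (p, v) /\ continuous (fun q : UC * V => Im (snd (fst q))) (p, v).
Proof.
  assert (K : continuous (U := C_UniformSpace) (fun q : UC * V => snd (fst q)) (p, v)).
  { apply (continuous_comp (fun q : UC * V => fst q) (fun u : UC => snd u)).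
    - apply continuous_fst.
    - destruct p. apply (continuous_snd (U := R_UniformSpace) (V := C_UniformSpace)). }
  split.
  - exact (continuous_comp (fun q : UC * V => snd (fst q)) (Re : C_UniformSpace -> R_UniformSpace) (p, v) K (cRe _)).
  - exact (continuous_comp (fun q : UC * V => snd (fst q)) (Im : C_UniformSpace -> R_UniformSpace) (p, v) K (cIm _)).
Qed.
Lemma cUC_s (p : UC) (s : R) : continuous (fun q : UC * R => snd q) (p, s).
Proof. apply continuous_snd. Qed.

(** The offset k = 0 gives H_m itself, and k = -1 gives its w-derivative up to the factor m. *)
Lemma H_cont (k m0 : R) (w0 : C) : slit_plane w0 -> 0 < m0 -> forall eps, 0 < eps ->
  exists d, 0 < d /\ forall m w, Rabs (m - m0) < d -> Cmod (w - w0)%C < d ->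
    Cmod (H m (m + k) w - H m0 (m0 + k) w0)%C < eps.
Proof.
  intros Hsl Hm eps He.
  pose proof (Rabs_pos k) as Pk.
  destruct (Hf_ok w0 (2 * m0) (2 * m0 + Rabs k) Hsl) as (r & M & Hr & HM & HH); [lra|lra|].
  apply (locally_UC m0 w0 (fun p => Cmod (H (fst p) (fst p + k) (snd p) - H m0 (m0 + k) w0)%C < eps)).
  cut (locally ((m0, w0) : UC) (fun p : UC => True ->
    Cmod (CInt0oo (Hf (fst p) (fst p + k) (snd p)) - CInt0oo (Hf m0 (m0 + k) w0))%C < eps)).
  { apply filter_imp. intros p Hp. exact (Hp I). }
  apply (CInt0oo_param (U := UC) (fun _ => True) (fun p => Hf (fst p) (fst p + k) (snd p)) (m0, w0) M I); auto.
  - apply (locally_UC' m0 w0 (Rmin r m0)); [apply Rmin_pos; lra|].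
    intros m w H1 H2 _. pose proof (Rmin_l r m0). pose proof (Rmin_r r m0). simpl.
    apply Rabs_lt_between in H1.
    apply HH; [lra|lra|]. eapply Rle_trans; [apply Rabs_triang|]. rewrite (Rabs_pos_eq m); lra.
  - intros s Hs. destruct (cUC_w (V := R_UniformSpace) (m0, w0) s) as [W1 W2].
    pose proof (cUC_m (V := R_UniformSpace) (m0, w0) s) as W3.
    pose proof (cUC_s (m0, w0) s) as W4.
    destruct (cU_Hf (U := prod_UniformSpace UC R_UniformSpace) (fun q => fst (fst q)) (fun q => fst (fst q) + k)
      (fun q => Re (snd (fst q))) (fun q => Im (snd (fst q))) (fun q => snd q) ((m0, w0), s)) as [K1 K2]; auto.
    + apply cU_plus; [exact W3|apply cU_const].
    + simpl. destruct Hsl as [Q|Q]; [left; change (0 < s + Re w0); lra|right; exact Q].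

Qed.

(** * The differential equation of H_m and uniqueness of its solutions *)

Lemma Cder_real (f : C -> C) (l : C) (t : R) : Cder f t l ->
  is_derive (fun t : R => Re (f t)) t (Re l) /\ is_derive (fun t : R => Im (f t)) t (Im l).
Proof.
  intros Hd.
  assert (E : forall x : R, (0 + x * 1)%C = RtoC x) by (intros x; ring).
  destruct (Cder_line f 0 1 l t) as [A B]; [rewrite E; exact Hd|].
  replace (1 * l)%C with l in A, B by ring.
  split; [revert A|revert B]; apply is_derive_ext; intros x; rewrite E; reflexivity.
Qed.

Lemma exp_lim0 (N : R) : is_lim (fun s => N * exp (- s / 2)) p_infty 0.
Proof.
  replace (Finite 0) with (Rbar_mult N 0) by (simpl; f_equal; ring).
  apply (is_lim_scal_l (fun s => exp (- s / 2)) N p_infty 0).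
  apply (is_lim_comp exp (fun s => - s / 2) p_infty 0 m_infty).
  - exact is_lim_exp_m.
  - apply (is_lim_ext (fun s => (- / 2) * s)); [intros; field|].
    replace m_infty with (Rbar_mult (- / 2) p_infty).
    + apply (is_lim_scal_l (fun s => s)). apply is_lim_id.
    + simpl. destruct (Rle_dec 0 (- / 2)) as [L|L]; [exfalso; lra|]. reflexivity.
  - exists 0. intros; discriminate.
Qed.

Lemma dom_lim0 (N : R) (F : R -> R) : (forall s, 0 <= s -> Rabs (F s) <= N * exp (- s / 2)) ->
  is_lim F p_infty 0.
Proof.
  intros HF. apply (is_lim_le_le_loc (fun s => - N * exp (- s / 2)) (fun s => N * exp (- s / 2)) F).
  - exists 0. intros s Hs. specialize (HF s (Rlt_le _ _ Hs)). apply Rabs_le_between in HF. lra.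
  - apply exp_lim0.
  - apply exp_lim0.
Qed.

Lemma CInt0oo_ftc (M N : R) (g F : R -> C) : okC M g -> okC N F ->
  (forall s, 0 < s -> is_derive (fun s => Re (F s)) s (Re (g s)) /\ is_derive (fun s => Im (F s)) s (Im (g s))) ->
  CInt0oo g = (- F 0)%C.
Proof.
  intros Hg HF HD.
  apply C_ext; unfold CInt0oo; simpl Re; simpl Im.
  - change (Re (- F 0)%C) with (- Re (F 0)).
    apply (RInt0oo_ftc M (fun s => Re (g s)) (fun s => Re (F s))).
    + apply okC_Re, Hg.
    + intros s Hs. apply HD, Hs.
    + apply (HF 0 (Rle_refl 0)).
    + apply (dom_lim0 N). intros s Hs. apply (okC_Re N F HF s Hs).
  - change (Im (- F 0)%C) with (- Im (F 0)).
    apply (RInt0oo_ftc M (fun s => Im (g s)) (fun s => Im (F s))).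
    + apply okC_Im, Hg.
    + intros s Hs. apply HD, Hs.
    + apply (HF 0 (Rle_refl 0)).
    + apply (dom_lim0 N). intros s Hs. apply (okC_Im N F HF s Hs).
Qed.

Lemma Hw_Cexp (a s : R) : 0 < s -> RtoC (Hw a s) = (Cexp (- s) * Cpw a s)%C.
Proof.
  intros Hs. unfold Hw. rewrite spow_pos, Cpw_R by auto.
  rewrite <- RtoC_opp, Cexp_R, <- RtoC_mult. reflexivity.
Qed.

Lemma slit_R (s : R) : 0 < s -> slit_plane s.
Proof. intros Hs. left. exact Hs. Qed.

(** Multiplied by m this reads w y'' - (w + 2m) y' + m y = 0 for y = H_m. It holds because the
    combined integrand is the s-derivative of - e^(-s) s^(m+1) (s + w)^(m-1), which vanishes at 0
    and at infinity. *)
Lemma H_ode (m : R) (w : C) : slit_plane w -> 0 < m ->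
  (w * ((m - 1)%R * H m (m - 1 - 1) w) - (w + 2 * m) * H m (m - 1) w + H m m w)%C = 0.
Proof.
  intros Hsl Hm.
  destruct (Hf_ok1 w m (m - 1 - 1) Hsl Hm) as [M2 O2].
  destruct (Hf_ok1 w m (m - 1) Hsl Hm) as [M1 O1].
  destruct (Hf_ok1 w m m Hsl Hm) as [M0 O0].
  destruct (Hf_ok1 w (m + 1) (m - 1) Hsl ltac:(lra)) as [MF OF].
  set (c2 := (w * (m - 1)%R)%C). set (c1 := (- (w + 2 * m))%C).
  assert (OK : okC (Cmod c2 * M2 + Cmod c1 * M1 + M0)
     (fun s => c2 * Hf m (m - 1 - 1) w s + c1 * Hf m (m - 1) w s + Hf m m w s)%C).
  { apply okC_plus; [apply okC_plus|]; auto; apply okC_scal; auto. }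
  assert (E : CInt0oo (fun s => c2 * Hf m (m - 1 - 1) w s + c1 * Hf m (m - 1) w s + Hf m m w s)%C =
    (c2 * H m (m - 1 - 1) w + c1 * H m (m - 1) w + H m m w)%C).
  { rewrite (CInt0oo_plus (Cmod c2 * M2 + Cmod c1 * M1) M0); auto.
    - rewrite (CInt0oo_plus (Cmod c2 * M2) (Cmod c1 * M1)); try (apply okC_scal; auto).
      rewrite (CInt0oo_scal M2), (CInt0oo_scal M1) by auto. reflexivity.
    - apply okC_plus; apply okC_scal; auto. }
  transitivity (c2 * H m (m - 1 - 1) w + c1 * H m (m - 1) w + H m m w)%C; [unfold c1, c2; ring|].
  rewrite <- E.
  rewrite (CInt0oo_ftc _ _ _ (fun s => (-1) * Hf (m + 1) (m - 1) w s)%C OK (okC_scal _ _ _ OF)).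
  { unfold Hf, Hw. rewrite spow_np by lra.
    replace (exp (- 0) * 0) with 0 by ring. ring. }
  intros s Hs.
  (* A holomorphic extension of the antiderivative off the real axis, so that the complex rules
     compute its derivative; it agrees with the real integrand's primitive for t > 0. *)
  set (Phi := fun z : C => ((-1) * ((Cexp (- z) * Cpw (m + 1) z) * Cpw (m - 1) (z + w)))%C).
  assert (D : Cder Phi s (c2 * Hf m (m - 1 - 1) w s + c1 * Hf m (m - 1) w s + Hf m m w s)%C).
  { eapply Cder_eq.
    - apply Cder_scal, Cder_mult; [apply Cder_mult|].
      + apply (Cder_comp Cexp); [apply Cder_Cexp|apply Cder_opp, Cder_id].
      + apply Cder_Cpw, slit_R, Hs.
      + apply (Cder_comp (Cpw (m - 1))); [apply Cder_Cpw, slit_shift; auto; lra|].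
        apply Cder_plus; [apply Cder_id|apply Cder_const].
    - cbv beta. unfold Hf. rewrite (Hw_Cexp m s Hs).
      assert (Ssl := slit_shift w s Hsl (Rlt_le _ _ Hs)).
      replace (m + 1 - 1) with m by ring.
      rewrite (Cpw_S m s) by (apply slit_R, Hs).
      replace (Cpw m (s + w)) with (Cpw (m - 1 - 1 + 1 + 1) (s + w)) by (f_equal; ring).
      replace (Cpw (m - 1) (s + w)) with (Cpw (m - 1 - 1 + 1) (s + w)) by (f_equal; ring).
      rewrite !Cpw_S by auto.
      unfold c1, c2. rewrite !RtoC_minus, !RtoC_plus. ring. }
  apply Cder_real in D. destruct D as [D1 D2].
  assert (L : locally s (fun t : R => Phi t = ((-1) * Hf (m + 1) (m - 1) w t)%C)).
  { exists (mkposreal s Hs). intros t Ht. change (Rabs (t - s) < s) in Ht. apply Rabs_lt_between in Ht.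
    unfold Phi, Hf. rewrite (Hw_Cexp (m + 1) t) by lra. reflexivity. }
  split.
  - apply (is_derive_ext_loc (fun t : R => Re (Phi t))); [|exact D1].
    revert L. apply filter_imp. intros t ->. reflexivity.
  - apply (is_derive_ext_loc (fun t : R => Im (Phi t))); [|exact D2].
    revert L. apply filter_imp. intros t ->. reflexivity.
Qed.

(** The product exp (- K t) * u t is nonnegative, starts at 0 and cannot increase. *)
Lemma gronwall0 (u du : R -> R) (K : R) :
  (forall t, 0 <= t <= 1 -> is_derive u t (du t)) -> (forall t, 0 <= t <= 1 -> 0 <= u t) ->
  (forall t, 0 <= t <= 1 -> du t <= K * u t) -> u 0 = 0 -> u 1 = 0.
Proof.
  intros HD HP HK H0.
  destruct (MVT_gen (fun t => exp (- K * t) * u t) 0 1 (fun t => exp (- K * t) * (du t - K * u t))) as (c & Hc & E).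
  - intros x Hx. rewrite Rmin_left, Rmax_right in Hx by lra.
    specialize (HD x ltac:(lra)). auto_derive.
    + exists (du x); exact HD.
    + change (Derive (fun x : R => u x) x) with (Derive u x). rewrite (is_derive_unique u x _ HD). ring.
  - intros x Hx. rewrite Rmin_left, Rmax_right in Hx by lra.
    specialize (HD x ltac:(lra)).
    apply continuity_pt_filterlim. apply (c_der (fun t => exp (- K * t) * u t)). auto_derive. exists (du x); exact HD.
  - rewrite Rmin_left, Rmax_right in Hc by lra.
    rewrite H0 in E. pose proof (HP 1 ltac:(lra)). pose proof (exp_pos (- K * 1)).
    pose proof (exp_pos (- K * c)). specialize (HK c Hc).
    assert (exp (- K * 1) * u 1 <= 0) by nra. nra.
Qed.

(** The energy |y|^2 + |y'|^2 along the segment satisfies a Gronwall inequality and vanishes at the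
    starting point. *)
Lemma ode_unique (y dy ddy : C -> C) (a h : C) (p q : C -> C) (K : R) :
  (forall t : R, 0 <= t <= 1 -> Cder y (a + t * h)%C (dy (a + t * h)%C)) ->
  (forall t : R, 0 <= t <= 1 -> Cder dy (a + t * h)%C (ddy (a + t * h)%C)) ->
  (forall t : R, 0 <= t <= 1 -> ddy (a + t * h)%C = (p (a + t * h) * dy (a + t * h) + q (a + t * h) * y (a + t * h))%C) ->
  (forall t : R, 0 <= t <= 1 -> Cmod (p (a + t * h)%C) <= K /\ Cmod (q (a + t * h)%C) <= K) ->
  y a = 0 -> dy a = 0 -> y (a + h)%C = 0.
Proof.
  intros D1 D2 E B Y0 Y1.
  set (u := fun t : R => (Re (y (a + t * h)%C) * Re (y (a + t * h)%C) + Im (y (a + t * h)%C) * Im (y (a + t * h)%C))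
     + (Re (dy (a + t * h)%C) * Re (dy (a + t * h)%C) + Im (dy (a + t * h)%C) * Im (dy (a + t * h)%C))).
  assert (U : forall t, u t = Cmod (y (a + t * h)%C) * Cmod (y (a + t * h)%C) + Cmod (dy (a + t * h)%C) * Cmod (dy (a + t * h)%C)).
  { intros t. rewrite !Cmod_sq. reflexivity. }
  assert (U1 : u 1 = 0).
  { apply (gronwall0 u (fun t => 2 * (Re (y (a + t * h)%C) * Re (h * dy (a + t * h))%C + Im (y (a + t * h)%C) * Im (h * dy (a + t * h))%C)
       + 2 * (Re (dy (a + t * h)%C) * Re (h * ddy (a + t * h))%C + Im (dy (a + t * h)%C) * Im (h * ddy (a + t * h))%C))
       (2 * (2 * Cmod h * (1 + 2 * K)))).
    - intros t Ht.
      destruct (Cder_line y a h _ t (D1 t Ht)) as [A1 A2].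
      destruct (Cder_line dy a h _ t (D2 t Ht)) as [A3 A4].
      unfold u.
      assert (S : forall (f : R -> R) l, is_derive f t l -> is_derive (fun t => f t * f t) t (2 * (f t * l))).
      { intros f l Hf. replace (2 * (f t * l)) with (l * f t + f t * l) by ring.
        exact (is_derive_mult (K := R_AbsRing) f f t l l Hf Hf Rmult_comm). }
      replace (2 * (Re (y (a + t * h)%C) * Re (h * dy (a + t * h))%C + Im (y (a + t * h)%C) * Im (h * dy (a + t * h))%C)
       + 2 * (Re (dy (a + t * h)%C) * Re (h * ddy (a + t * h))%C + Im (dy (a + t * h)%C) * Im (h * ddy (a + t * h))%C))
      with ((2 * (Re (y (a + t * h)%C) * Re (h * dy (a + t * h))%C) + 2 * (Im (y (a + t * h)%C) * Im (h * dy (a + t * h))%C))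
       + (2 * (Re (dy (a + t * h)%C) * Re (h * ddy (a + t * h))%C) + 2 * (Im (dy (a + t * h)%C) * Im (h * ddy (a + t * h))%C))) by ring.
      pose proof (S _ _ A1) as S1. pose proof (S _ _ A2) as S2. pose proof (S _ _ A3) as S3. pose proof (S _ _ A4) as S4.
      exact (is_derive_plus (K := R_AbsRing) (V := R_NormedModule) _ _ t _ _
        (is_derive_plus (K := R_AbsRing) (V := R_NormedModule) _ _ t _ _ S1 S2)
        (is_derive_plus (K := R_AbsRing) (V := R_NormedModule) _ _ t _ _ S3 S4)).
    - intros t Ht. rewrite U. nra.
    - intros t Ht. rewrite U. specialize (E t Ht). specialize (B t Ht). destruct B as [Bp Bq].
      set (Y := y (a + t * h)%C) in *. set (Z := dy (a + t * h)%C) in *. set (W := ddy (a + t * h)%C) in *.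
      (* A crude Cauchy-Schwarz inequality, with factor 2 from estimating the coordinates
         separately; its loss is absorbed in the Gronwall constant. *)
      assert (CS : forall z w, Re z * Re w + Im z * Im w <= 2 * (Cmod z * Cmod w)).
      { intros z w. pose proof (re_le_Cmod z) as G1. pose proof (re_le_Cmod w) as G2. pose proof (Im_le_Cmod z) as G3. pose proof (Im_le_Cmod w) as G4.
        assert (X : forall a b c d : R, Rabs a <= c -> Rabs b <= d -> a * b <= c * d).
        { intros x1 x2 x3 x4 P1 P2. eapply Rle_trans; [apply Rle_abs|]. rewrite Rabs_mult.
          apply Rmult_le_compat; auto; apply Rabs_pos. }
        pose proof (X _ _ _ _ G1 G2). pose proof (X _ _ _ _ G3 G4). lra. }
      pose proof (CS Y (h * Z)%C) as C1. pose proof (CS Z (h * W)%C) as C2.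
      rewrite Cmod_mult in C1, C2.
      assert (WB : Cmod W <= K * Cmod Z + K * Cmod Y).
      { rewrite E. eapply Rle_trans; [apply Cmod_triangle|]. rewrite !Cmod_mult.
        pose proof (Cmod_ge_0 Z). pose proof (Cmod_ge_0 Y). nra. }
      pose proof (Cmod_ge_0 Z) as Z0. pose proof (Cmod_ge_0 Y) as Y0'. pose proof (Cmod_ge_0 h) as h0.
      pose proof (Cmod_ge_0 (p (a + t * h)%C)) as p0.
      set (y0 := Cmod Y) in *. set (z0 := Cmod Z) in *. set (k := Cmod h) in *.
      assert (K0 : 0 <= K) by lra.
      assert (Q1 : z0 * (k * Cmod W) <= z0 * (k * (K * z0 + K * y0))).
      { apply Rmult_le_compat_l; auto. apply Rmult_le_compat_l; auto. }
      assert (YZ : 2 * (y0 * z0) <= y0 * y0 + z0 * z0).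
      { pose proof (Rle_0_sqr (y0 - z0)) as G. unfold Rsqr in G. lra. }
      assert (R1 : 2 * (y0 * (k * z0)) <= k * (y0 * y0 + z0 * z0)).
      { replace (2 * (y0 * (k * z0))) with (k * (2 * (y0 * z0))) by ring. apply Rmult_le_compat_l; auto. }
      assert (R2 : 2 * (z0 * (k * (K * z0 + K * y0))) <= k * K * (3 * (y0 * y0 + z0 * z0))).
      { replace (2 * (z0 * (k * (K * z0 + K * y0)))) with (k * K * (2 * (z0 * z0) + 2 * (y0 * z0))) by ring.
        apply Rmult_le_compat_l; [apply Rmult_le_pos; auto|].
        pose proof (Rle_0_sqr y0) as G. unfold Rsqr in G. pose proof (Rle_0_sqr z0) as G'. unfold Rsqr in G'. lra. }
      assert (0 <= k * K * (y0 * y0 + z0 * z0)) by (apply Rmult_le_pos; [apply Rmult_le_pos; auto|nra]).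
      assert (0 <= k * (y0 * y0 + z0 * z0)) by (apply Rmult_le_pos; [auto|nra]). lra.
    - rewrite U. replace (a + 0%R * h)%C with a by ring. rewrite Y0, Y1, Cmod_0. ring. }
  rewrite U in U1. replace (a + 1%R * h)%C with (a + h)%C in U1 by ring.
  apply Cmod_eq_0. pose proof (Cmod_ge_0 (y (a + h)%C)). pose proof (Cmod_ge_0 (dy (a + h)%C)). nra.
Qed.

Lemma H_pos (m x : R) : 0 < m -> 0 < x -> H m m x <> 0.
Proof.
  intros Hm Hx E.
  destruct (Hf_ok1 x m m (slit_R x Hx) Hm) as [M O].
  assert (P : 0 < Re (H m m x)).
  { change (Re (H m m x)) with (RInt0oo (fun s => Re (Hf m m x s))). apply (RInt0oo_pos M _ 0 1).
    - apply okC_Re, O.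
    - intros s Hs. unfold Hf. rewrite <- RtoC_plus, Cpw_R, <- RtoC_mult by lra. simpl.
      pose proof (Hw_ge0 m s). pose proof (exp_pos (m * ln (s + x))). nra.
    - lra.
    - lra.
    - intros s Hs. unfold Hf. rewrite <- RtoC_plus, Cpw_R, <- RtoC_mult by lra. simpl.
      apply Rmult_lt_0_compat; [apply Hw_pos; lra|apply exp_pos]. }
  rewrite E in P. unfold Re in P; simpl in P. lra.
Qed.

Lemma Cder_inv (f : C -> C) (z l : C) : Cder f z l -> f z <> 0 ->
  Cder (fun x => / f x)%C z (- (l / (f z * f z)))%C.
Proof.
  intros Hf Hz.
  assert (K : forall w : C, w <> 0 -> Cder Cinv w (- (/ (w * w)))%C).
  { intros w Hw eps He. pose proof (proj1 (Cmod_gt_0 w) Hw) as Pw. set (m := Cmod w) in *.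
    exists (Rmin (m / 2) (eps * (m * m * m) / 2)).
    split; [apply Rmin_pos; [lra|]; apply Rdiv_lt_0_compat; [|lra]; repeat apply Rmult_lt_0_compat; auto|].
    intros h Hh.
    destruct (Rmin_Rgt_l _ _ _ Hh) as [h1 h2].
    assert (B : m / 2 <= Cmod (w + h)%C).
    { pose proof (Cmod_minus_ge w (- h)%C) as L. rewrite Cmod_opp in L. fold m in L.
      replace (w - - h)%C with (w + h)%C in L by ring. lra. }
    assert (N : (w + h)%C <> 0) by (apply Cmod_gt_0; lra).
    replace (/ (w + h) - / w - h * - / (w * w))%C with (h * h / (w * w * (w + h)))%C by (field; auto).
    rewrite Cmod_div by (repeat apply Cmult_neq_0; auto). rewrite !Cmod_mult. fold m.
    pose proof (Cmod_ge_0 h) as hp.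
    apply Rle_trans with (Cmod h * Cmod h / (m * m * (m / 2))).
    - unfold Rdiv. apply Rmult_le_compat_l; [nra|]. apply Rinv_le_contravar; [apply Rmult_lt_0_compat; nra|].
      apply Rmult_le_compat_l; [nra|lra].
    - assert (M3 : 0 < m * m * m) by (repeat apply Rmult_lt_0_compat; auto).
      replace (Cmod h * Cmod h / (m * m * (m / 2))) with (Cmod h * (Cmod h * 2 / (m * m * m))) by (field; lra).
      rewrite (Rmult_comm eps). apply Rmult_le_compat_l; auto.
      apply Rmult_le_reg_r with (m * m * m); auto.
      replace (Cmod h * 2 / (m * m * m) * (m * m * m)) with (Cmod h * 2) by (field; lra). lra. }
  eapply Cder_eq.
  - apply (Cder_comp Cinv f); [apply K, Hz|exact Hf].
  - field. auto.
Qed.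

Lemma const_of_der0 (g : R -> R) : (forall t, 0 < t -> is_derive g t 0) -> forall x, 0 < x -> g x = g 1.
Proof.
  intros D x Hx.
  destruct (MVT_gen g 1 x (fun _ => 0)) as (c & Hc & E).
  - intros t Ht. apply D. pose proof (Rmin_glb_lt 1 x 0). lra.
  - intros t Ht. apply continuity_pt_filterlim, c_der. exists 0. apply D.
    pose proof (Rmin_glb_lt 1 x 0). lra.
  - lra.
Qed.

Lemma Cconst_of_der0 (f : C -> C) : (forall t : R, 0 < t -> Cder f t 0) ->
  forall x : R, 0 < x -> f x = f 1.
Proof.
  intros D x Hx. apply C_ext.
  - apply (const_of_der0 (fun t : R => Re (f t))); auto. intros t Ht. apply (Cder_real f 0 t (D t Ht)).
  - apply (const_of_der0 (fun t : R => Im (f t))); auto. intros t Ht. apply (Cder_real f 0 t (D t Ht)).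
Qed.

(** * The Macdonald integral *)

(** The exponent k of cosh t counts derivatives in x of the Macdonald integrand, up to sign. *)
Definition kf (k : nat) (nu x t : R) : R := cosh t ^ k * cosh (nu * t) * exp (- x * cosh t).
Definition Kf (k : nat) (nu : R) (z : C) (t : R) : C := ((cosh t ^ k * cosh (nu * t))%R * Cexp (- z * cosh t))%C.

Lemma Kf_R (k : nat) (nu x t : R) : Kf k nu x t = RtoC (kf k nu x t).
Proof. unfold Kf, kf. rewrite <- RtoC_opp, <- RtoC_mult, Cexp_R, <- RtoC_mult. reflexivity. Qed.

Lemma cosh_bounds (t : R) : 0 <= t -> exp t / 2 <= cosh t <= exp t.
Proof.
  intros Ht. unfold cosh. pose proof (exp_pos (- t)). pose proof (exp_le (- t) t ltac:(lra)). lra.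
Qed.
Lemma cosh_abs (a t : R) : 0 <= t -> 0 < cosh (a * t) <= exp (Rabs a * t).
Proof.
  intros Ht. unfold cosh. pose proof (exp_pos (a * t)). pose proof (exp_pos (- (a * t))).
  pose proof (Rle_abs a). pose proof (Rle_abs (- a)) as G. rewrite Rabs_Ropp in G.
  pose proof (exp_le (a * t) (Rabs a * t) ltac:(nra)). pose proof (exp_le (- (a * t)) (Rabs a * t) ltac:(nra)). lra.
Qed.

(** exp is bounded below by its tangent line at a. The point a satisfies c e^a / 2 = A, so x cosh t
    >= A (1 + t - a); the extra 1/2 in A is the decay rate that remains. *)
Lemma kf_dom (k : nat) (nu c : R) : 0 < c -> exists M, 0 < M /\ forall x t g, c <= x -> 0 <= t ->
  0 <= g <= exp ((INR k + Rabs nu) * t) -> g * exp (- x * cosh t) <= M * exp (- t / 2).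
Proof.
  intros Hc. set (A := INR k + Rabs nu + 1/2).
  assert (HA : 0 < A) by (unfold A; pose proof (pos_INR k); pose proof (Rabs_pos nu); lra).
  set (a := ln (2 * A / c)).
  assert (Ha : c * exp a / 2 = A).
  { unfold a. rewrite exp_ln by (apply Rdiv_lt_0_compat; lra). field. lra. }
  exists (exp (A * (a - 1))). split; [apply exp_pos|]. intros x t g Hx Ht Hg.
  apply Rle_trans with (exp ((INR k + Rabs nu) * t) * exp (- x * cosh t)).
  { apply Rmult_le_compat_r; [left; apply exp_pos|apply Hg]. }
  rewrite <- !exp_plus. apply exp_le.
  pose proof (cosh_bounds t Ht) as [B _].
  assert (B2 : x * cosh t >= c * (exp t / 2)).
  { pose proof (exp_pos t). apply Rle_ge. apply Rmult_le_compat; lra. }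
  assert (B3 : exp t >= exp a * (1 + (t - a))).
  { replace (exp t) with (exp a * exp (t - a)) by (rewrite <- exp_plus; f_equal; ring).
    apply Rle_ge, Rmult_le_compat_l; [left; apply exp_pos|apply exp_ineq1_le]. }
  assert (B4 : c * (exp t / 2) >= A * (1 + (t - a))).
  { rewrite <- Ha. nra. }
  unfold A in *. nra.
Qed.

Lemma cont_cosh (f : R -> R) (t : R) : continuous f t -> continuous (fun t => cosh (f t)) t.
Proof.
  intros Hf. unfold cosh. apply cU_mult; [|apply cU_const]. apply cU_plus; apply cU_exp; auto. apply cU_opp; auto.
Qed.

Lemma cont_pow (f : R -> R) (k : nat) (t : R) : continuous f t -> continuous (fun t => f t ^ k) t.
Proof. intros Hf. induction k; simpl; [apply cU_const|apply cU_mult; auto]. Qed.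

Lemma kg_bound (k : nat) (nu t : R) : 0 <= t -> 0 <= cosh t ^ k * cosh (nu * t) <= exp ((INR k + Rabs nu) * t).
Proof.
  intros Ht. pose proof (cosh_bounds t Ht) as [B1 B2]. pose proof (cosh_abs nu t Ht) as [B3 B4].
  pose proof (exp_pos t).
  assert (P : 0 <= cosh t ^ k) by (apply pow_le; lra).
  assert (Q : cosh t ^ k <= exp (INR k * t)).
  { clear P. induction k as [|k IH]; [simpl; rewrite Rmult_0_l, exp_0; lra|].
    rewrite S_INR. replace ((INR k + 1) * t) with (t + INR k * t) by ring. rewrite exp_plus. simpl.
    apply Rmult_le_compat; auto; [lra|apply pow_le; lra]. }
  split; [nra|]. rewrite Rmult_plus_distr_r, exp_plus. apply Rmult_le_compat; auto; lra.
Qed.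

Lemma Kf_ok (k : nat) (nu c : R) : 0 < c -> exists M, 0 < M /\ forall z, c <= Re z -> okC M (Kf k nu z).
Proof.
  intros Hc. destruct (kf_dom k nu c Hc) as (M & HM & B). exists M. split; auto.
  intros z Hz t Ht. split.
  - assert (Cid : continuous (fun t : R => t) t) by apply continuous_id.
    assert (C1 : continuous (fun t => cosh t ^ k * cosh (nu * t)) t).
    { apply cU_mult; [apply (cont_pow cosh), (cont_cosh (fun t => t)), Cid|].
      apply (cont_cosh (fun t => nu * t)). apply cU_mult; [apply cU_const|exact Cid]. }
    assert (C2 : forall a, continuous (fun t => a * cosh t) t).
    { intros a. apply cU_mult; [apply cU_const|apply (cont_cosh (fun t => t)), Cid]. }
    apply (Ccts_mult (fun t => RtoC (cosh t ^ k * cosh (nu * t))) (fun t => Cexp (- z * cosh t))).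
    + split; [exact C1|apply cU_const].
    + split.
      * apply (continuous_ext (fun t => exp (- Re z * cosh t) * cos (- Im z * cosh t))).
        { intros s. unfold Cexp, Re, Im; simpl. f_equal; f_equal; ring. }
        apply cU_mult; [apply cU_exp|apply cU_cos]; apply C2.
      * apply (continuous_ext (fun t => exp (- Re z * cosh t) * sin (- Im z * cosh t))).
        { intros s. unfold Cexp, Re, Im; simpl. f_equal; f_equal; ring. }
        apply cU_mult; [apply cU_exp|apply cU_sin]; apply C2.
  - unfold Kf. rewrite Cmod_mult, Cmod_R, Cmod_Cexp.
    pose proof (kg_bound k nu t Ht) as G. rewrite Rabs_pos_eq by apply G.
    replace (Re (- z * cosh t)%C) with (- Re z * cosh t) by (unfold Re; simpl; ring).
    apply B; auto.
Qed.

Lemma Cder_Kf (k : nat) (nu : R) (z : C) (t : R) : Cder (fun z => Kf k nu z t) z (- Kf (S k) nu z t)%C.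
Proof.
  unfold Kf. eapply Cder_eq.
  - apply Cder_scal. apply (Cder_comp Cexp); [apply Cder_Cexp|].
    apply Cder_mult; [apply Cder_opp, Cder_id|apply Cder_const].
  - cbv beta. simpl pow. rewrite !RtoC_mult. ring.
Qed.

Definition KI (k : nat) (nu : R) (z : C) : C := CInt0oo (Kf k nu z).

Lemma Cder_KI (k : nat) (nu : R) (z : C) : 0 < Re z -> Cder (KI k nu) z (- KI (S k) nu z)%C.
Proof.
  intros Hz.
  destruct (Kf_ok k nu (Re z / 2) ltac:(lra)) as (M0 & P0 & O0).
  destruct (Kf_ok (S k) nu (Re z / 2) ltac:(lra)) as (M1 & P1 & O1).
  destruct (Kf_ok (S (S k)) nu (Re z / 2) ltac:(lra)) as (M2 & P2 & O2).
  assert (B : forall w, Cmod (w - z)%C < Re z / 2 -> Re z / 2 <= Re w).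
  { intros w Hw. pose proof (re_le_Cmod (w - z)%C) as L. change (Re (w - z)%C) with (Re w - Re z) in L.
    apply Rabs_le_between in L. lra. }
  eapply Cder_eq.
  - apply (CInt0oo_der (Kf k nu) (fun w t => (-1) * Kf (S k) nu w t)%C (fun w t => (-1) * - Kf (S (S k)) nu w t)%C
      z (Re z / 2) (M0 + M1 + M2)); [lra| | |].
    + intros w Hw. apply (okC_le M0); [apply O0, B, Hw|lra].
    + intros w Hw. apply (okC_scal_le M1); [apply O1, B, Hw|].
      rewrite Cmod_R, Rabs_left by lra. lra.
    + intros w t Hw Ht. split; [|split].
      * eapply Cder_eq; [apply Cder_Kf|ring].
      * apply Cder_scal, Cder_Kf.
      * replace (-1 * - Kf (S (S k)) nu w t)%C with (Kf (S (S k)) nu w t) by ring.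
        destruct (O2 w (B w Hw) t Ht) as [_ Q]. pose proof (exp_pos (- t / 2)). nra.
  - rewrite (CInt0oo_scal M1) by (apply O1; lra). unfold KI. ring.
Qed.

Lemma KI_R (k : nat) (nu x : R) : KI k nu x = RtoC (RInt0oo (kf k nu x)).
Proof.
  apply C_ext.
  - change (Re (KI k nu x)) with (RInt0oo (fun t => Re (Kf k nu x t))).
    apply RInt0oo_ext. intros t _. rewrite Kf_R. reflexivity.
  - change (Im (KI k nu x)) with (RInt0oo (fun t => Im (Kf k nu x t))). transitivity (RInt0oo (fun _ => 0)); [apply RInt0oo_ext; intros t _; rewrite Kf_R; reflexivity|].
    change (Im (RtoC (RInt0oo (kf k nu x)))) with 0.
    transitivity (RInt0oo (fun s => 0 * 0)); [apply RInt0oo_ext; intros; ring|].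
    rewrite (RInt0oo_scal 1 0 (fun _ => 0)); [ring|]. intros s Hs. split; [apply cU_const|].
    rewrite Rabs_R0. pose proof (exp_pos (- s / 2)). lra.
Qed.

Lemma kf_ok (k : nat) (nu x : R) : 0 < x -> exists M, okR M (kf k nu x).
Proof.
  intros Hx. destruct (Kf_ok k nu x Hx) as (M & _ & O). exists M.
  intros t Ht. destruct (okC_Re M _ (O x (Rle_refl x)) t Ht) as [A B]. split.
  - revert A. apply continuous_ext. intros s. rewrite Kf_R. reflexivity.
  - rewrite Kf_R in B. exact B.
Qed.

(** Since the derivative of [KI k] is - [KI (S k)], this is the modified Bessel equation. The
    integrand is the t-derivative of F, which vanishes at 0 through the factors sinh and tends to 0
    at infinity. *)
Lemma KI_ode (nu x : R) : 0 < x ->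
  (x * x * KI 2 nu x - x * KI 1 nu x - (x * x + nu * nu) * KI 0 nu x)%C = 0.
Proof.
  intros Hx. rewrite !KI_R, <- !RtoC_mult, <- RtoC_plus, <- !RtoC_mult, <- !RtoC_minus. f_equal.
  destruct (kf_ok 0 nu x Hx) as [M0 O0]. destruct (kf_ok 1 nu x Hx) as [M1 O1].
  destruct (kf_ok 2 nu x Hx) as [M2 O2].
  set (F := fun t => - (x * sinh t * cosh (nu * t) + nu * sinh (nu * t)) * exp (- x * cosh t)).
  pose proof (okR_scal _ (x * x) _ O2) as Q2. pose proof (okR_scal _ (- x) _ O1) as Q1.
  pose proof (okR_scal _ (- (x * x + nu * nu)) _ O0) as Q0.
  assert (okP : forall M N f g, okR M f -> okR N g -> okR (M + N) (fun s => f s + g s)).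
  { intros M N f g Hf Hg s Hs. destruct (Hf s Hs), (Hg s Hs). split; [apply cU_plus; auto|].
    eapply Rle_trans; [apply Rabs_triang|]. lra. }
  assert (E : RInt0oo (fun t => x * x * kf 2 nu x t + - x * kf 1 nu x t + - (x * x + nu * nu) * kf 0 nu x t) = - F 0).
  { apply (RInt0oo_ftc _ _ F (okP _ _ _ _ (okP _ _ _ _ Q2 Q1) Q0)).
    - intros t _. unfold F, kf. unfold cosh, sinh.
      auto_derive; auto.
      assert (E1 : exp t * exp (- t) = 1) by (rewrite <- exp_plus; replace (t + - t) with 0 by ring; apply exp_0).
      set (a := exp t) in *. set (b := exp (- t)) in *. set (p := exp (nu * t)). set (q := exp (- (nu * t))).
      set (g := exp (- x * ((a + b) * / 2))).
      replace (exp (- x * ((a + b) / 2))) with g by reflexivity.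
      apply Rminus_diag_uniq. transitivity (x * x * (1 - a * b) * ((p + q) / 2) * g); [field|rewrite E1; ring].
    - apply c_der. unfold F, sinh, cosh. auto_derive. auto.
    - destruct (kf_dom 1 nu x Hx) as (M & HM & B).
      apply (dom_lim0 (x * M + Rabs nu * M)). intros t Ht. unfold F.
      assert (S1 : Rabs (sinh t) <= cosh t).
      { unfold sinh, cosh. pose proof (exp_pos t). pose proof (exp_pos (- t)).
        apply Rabs_le. lra. }
      assert (S2 : Rabs (sinh (nu * t)) <= cosh (nu * t)).
      { unfold sinh, cosh. pose proof (exp_pos (nu * t)). pose proof (exp_pos (- (nu * t))).
        apply Rabs_le. lra. }
      pose proof (kg_bound 1 nu t Ht) as G1.
      pose proof (kg_bound 0 nu t Ht) as G0. rewrite pow_1 in G1. simpl pow in G0.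
      pose proof (B x t _ (Rle_refl x) Ht G1) as B1.
      assert (G0' : 0 <= cosh (nu * t) <= exp ((INR 1 + Rabs nu) * t)).
      { split; [lra|]. eapply Rle_trans; [rewrite Rmult_1_l in G0; apply G0|]. apply exp_le. simpl. nra. }
      pose proof (B x t _ (Rle_refl x) Ht G0') as B0.
      rewrite Rabs_mult, Rabs_Ropp. pose proof (exp_pos (- x * cosh t)) as Pe. rewrite (Rabs_pos_eq (exp _)) by lra.
      apply Rle_trans with ((x * (cosh t * cosh (nu * t)) + Rabs nu * cosh (nu * t)) * exp (- x * cosh t)).
      + apply Rmult_le_compat_r; [lra|]. eapply Rle_trans; [apply Rabs_triang|].
        rewrite !Rabs_mult, (Rabs_pos_eq x), (Rabs_pos_eq (cosh (nu * t))) by lra.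
        pose proof (Rabs_pos nu). apply Rplus_le_compat.
        * rewrite Rmult_assoc. apply Rmult_le_compat_l; [lra|]. apply Rmult_le_compat_r; lra.
        * apply Rmult_le_compat_l; lra.
      + pose proof (Rabs_pos nu). nra. }
  rewrite (RInt0oo_plus _ _ _ _ (okP _ _ _ _ Q2 Q1) Q0), (RInt0oo_plus _ _ _ _ Q2 Q1) in E.
  rewrite (RInt0oo_scal M2), (RInt0oo_scal M1), (RInt0oo_scal M0) in E by auto.
  unfold F in E. replace (nu * 0) with 0 in E by ring. rewrite sinh_0 in E. lra.
Qed.

(* Up to a constant factor this is [besselK nu] on the slit plane. *)
Definition Y2 (nu : R) (z : C) : C := (Cexp (- z) * Cpw (- nu) z * H (nu - 1/2) (nu - 1/2) (2 * z))%C.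
Definition dY2 (nu : R) (z : C) : C :=
  (Cexp (- z) * Cpw (- nu) z * (- (1 + nu / z) * H (nu - 1/2) (nu - 1/2) (2 * z)
     + 2 * ((nu - 1/2)%R * H (nu - 1/2) (nu - 1/2 - 1) (2 * z))))%C.

Lemma slit_scal (r : R) (z : C) : 0 < r -> slit_plane z -> slit_plane (r * z)%C.
Proof.
  intros Hr [P|P]; [left|right].
  - rewrite re_scal_l. nra.
  - replace (Im (r * z)%C) with (r * Im z) by (unfold Im; simpl; ring). apply Rmult_integral_contrapositive_currified; auto; lra.
Qed.

Lemma Cpw_pred (a : R) (z : C) : slit_plane z -> Cpw (a - 1) z = (Cpw a z / z)%C.
Proof.
  intros Hz. replace (Cpw a z) with (Cpw (a - 1 + 1) z) by (f_equal; ring).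
  rewrite Cpw_S by auto. field. apply slit_neq_0, Hz.
Qed.

Lemma Cder_H2 (a b : R) (z : C) : slit_plane z -> 0 < a ->
  Cder (fun z => H a b (2 * z)%C) z (2 * (b * H a (b - 1) (2 * z)))%C.
Proof.
  intros Hz Ha. eapply Cder_eq.
  - apply (Cder_comp (H a b) (fun z => 2 * z)%C).
    + apply Cder_H; auto. apply slit_scal; auto; lra.
    + apply Cder_scal, Cder_id.
  - ring.
Qed.

Lemma Cder_Y2 (nu : R) (z : C) : slit_plane z -> 1/2 < nu -> Cder (Y2 nu) z (dY2 nu z).
Proof.
  intros Hz Hnu. unfold Y2. eapply Cder_eq.
  - apply Cder_mult; [apply Cder_mult|].
    + apply (Cder_comp Cexp); [apply Cder_Cexp|apply Cder_opp, Cder_id].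
    + apply Cder_Cpw, Hz.
    + apply Cder_H2; auto; lra.
  - cbv beta. unfold dY2. rewrite Cpw_pred by auto. rewrite RtoC_opp. field. apply slit_neq_0, Hz.
Qed.

Lemma C2_neq_0 : RtoC 2 <> 0.
Proof. intro E. apply RtoC_inj in E. lra. Qed.

(** This is the modified Bessel equation for [Y2]: [H_ode] at 2 z eliminates the second derivative
    of H_m, and the rest is rational algebra. *)
Lemma Cder_dY2 (nu : R) (z : C) : slit_plane z -> 1/2 < nu ->
  Cder (dY2 nu) z (((z * z + nu * nu) * Y2 nu z - z * dY2 nu z) / (z * z))%C.
Proof.
  intros Hz Hnu. pose proof (slit_neq_0 z Hz) as Z0. unfold dY2 at 1.
  pose proof (H_ode (nu - 1/2) (2 * z)%C (slit_scal 2 z ltac:(lra) Hz) ltac:(lra)) as O.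
  eapply Cder_eq.
  - apply Cder_mult; [apply Cder_mult|].
    + apply (Cder_comp Cexp); [apply Cder_Cexp|apply Cder_opp, Cder_id].
    + apply Cder_Cpw, Hz.
    + apply Cder_plus; [apply Cder_mult|].
      * apply Cder_opp, Cder_plus; [apply Cder_const|]. apply Cder_scal. apply Cder_inv; [apply Cder_id|exact Z0].
      * apply Cder_H2; auto; lra.
      * apply Cder_scal, Cder_scal, Cder_H2; auto; lra.
  - cbv beta. unfold dY2, Y2. rewrite Cpw_pred by auto. rewrite RtoC_opp.
    set (m := nu - 1/2) in *.
    replace (RtoC nu) with (m + / 2)%C.
    2:{ unfold m. apply C_ext; unfold Re, Im; simpl; field. }
    set (h0 := H m m (2 * z)) in *. set (h1 := H m (m - 1) (2 * z)) in *. set (h2 := H m (m - 1 - 1) (2 * z)) in *.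
    set (E := Cexp (- z)). set (P := Cpw (- nu) z).
    assert (Eh : ((m - 1)%R * h2)%C = (((2 * z + 2 * m) * h1 - h0) / (2 * z))%C).
    { replace ((m - 1)%R * h2)%C with ((2 * z * ((m - 1)%R * h2) - (2 * z + 2 * m) * h1 + h0 + ((2 * z + 2 * m) * h1 - h0)) / (2 * z))%C by (field; auto using C2_neq_0).
      rewrite O. f_equal. ring. }
    rewrite Eh. field. auto.
Qed.

(** From s + 2 x <= (1 + s) (1 + 2 x), each factor being absorbed at rate 1/8. The resulting growth
    exp (x / 4) stays below the decay exp (- x) contained in [Y2]. *)
Lemma H_growth (m b : R) : 0 < m -> 0 <= b -> exists N, 0 < N /\ forall x : R, 1 <= x ->
  Cmod (H m b (2 * x)%C) <= N * exp (x / 4).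
Proof.
  intros Hm Hb. destruct (exp_ln_growth b Hb) as (K & HK & G).
  destruct (Hw_dom m ltac:(lra)) as (M & HM & D).
  exists (4 * (M * (K * K))). split; [repeat apply Rmult_lt_0_compat; lra|].
  intros x Hx. rewrite <- RtoC_mult.
  assert (O : okC (M * (K * K * exp (x / 4))) (Hf m b (2 * x)%R)).
  { intros s Hs. destruct (Hf_ok1 (2 * x)%R m b (slit_R (2 * x) ltac:(lra)) Hm) as [M' O'].
    split; [apply (O' s Hs)|]. apply D; [exact Hs|lra|].
    rewrite <- RtoC_plus, Cpw_R, Cmod_R, Rabs_pos_eq by (try (left; apply exp_pos); lra).
    apply Rle_trans with (exp (b * ln (1 + s)) * exp (b * ln (1 + 2 * x))).
    - rewrite <- exp_plus. apply exp_le. rewrite <- Rmult_plus_distr_l. apply Rmult_le_compat_l; auto.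
      rewrite <- ln_mult by lra. apply ln_le'; [lra|]. nra.
    - replace (K * K * exp (x / 4) * exp (s / 8)) with ((K * exp (s / 8)) * (K * exp (2 * x / 8))).
      + apply Rmult_le_compat; try (left; apply exp_pos); apply G; lra.
      + replace (2 * x / 8) with (x / 4) by field. ring. }
  eapply Rle_trans; [apply (CInt0oo_bound _ _ O)|]. right; ring.
Qed.

Lemma Y2_neq_0 (nu x : R) : 1/2 < nu -> 0 < x -> Y2 nu x <> 0.
Proof.
  intros Hnu Hx. unfold Y2. apply Cmult_neq_0; [apply Cmult_neq_0|].
  - apply Cexp_neq_0.
  - apply Cpw_neq_0.
  - rewrite <- RtoC_mult. apply H_pos; lra.
Qed.

(* The Wronskian [x (y1 y2' - y1' y2)] of the two recessive solutions is constant and tends to 0 at infinity. *)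
Lemma wronskian0 (nu x : R) : 3/2 < nu -> 0 < x ->
  (KI 0 nu x * dY2 nu x + KI 1 nu x * Y2 nu x)%C = 0.
Proof.
  intros Hnu Hx.
  set (W := fun z : C => (z * (KI 0 nu z * dY2 nu z + KI 1 nu z * Y2 nu z))%C).
  assert (DW : forall t : R, 0 < t -> Cder W t 0).
  { intros t Ht. unfold W. assert (S := slit_R t Ht). pose proof (slit_neq_0 t S) as T0.
    eapply Cder_eq.
    - apply Cder_mult; [apply Cder_id|]. apply Cder_plus; apply Cder_mult.
      + apply Cder_KI, Ht.
      + apply Cder_dY2; auto; lra.
      + apply Cder_KI, Ht.
      + apply Cder_Y2; auto; lra.
    - cbv beta. pose proof (KI_ode nu t Ht) as O.
      set (k2 := KI 2 nu t) in *. set (k1 := KI 1 nu t) in *. set (k0 := KI 0 nu t) in *.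
      assert (E2 : k2 = ((t * k1 + (t * t + nu * nu) * k0) / (t * t))%C).
      { replace k2 with (((t * t * k2 - t * k1 - (t * t + nu * nu) * k0) + (t * k1 + (t * t + nu * nu) * k0)) / (t * t))%C by (field; auto).
        rewrite O. f_equal. ring. }
      rewrite E2. field. auto. }
  pose proof (Cconst_of_der0 W DW) as CW.
  destruct (Kf_ok 0 nu 1 Rlt_0_1) as (M0 & PM0 & O0).
  destruct (Kf_ok 1 nu 1 Rlt_0_1) as (M1 & PM1 & O1).
  set (m := nu - 1/2).
  destruct (H_growth m m) as (N0 & PN0 & G0); [unfold m; lra|unfold m; lra|].
  destruct (H_growth m (m - 1)) as (N1 & PN1 & G1); [unfold m; lra|unfold m; lra|].
  set (D := 4 * M0 * ((1 + nu) * N0 + 2 * (m * N1)) + 4 * M1 * N0).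
  assert (B : forall t : R, 1 <= t -> Cmod (W 1) <= D * (t * exp (- t) * exp (t / 4))).
  { intros t Ht. rewrite <- (CW t) by lra. unfold W.
    assert (BE : Cmod (Cexp (- t) * Cpw (- nu) t)%C <= exp (- t)).
    { rewrite Cmod_mult, Cmod_Cexp, Cpw_R, Cmod_R, Rabs_pos_eq by (try (left; apply exp_pos); lra).
      change (Re (- t)%C) with (- t). pose proof (exp_pos (- t)).
      assert (X0 : exp (- nu * ln t) <= exp 0).
      { apply exp_le. assert (0 <= ln t) by (rewrite <- ln_1; apply ln_le'; lra). nra. }
      rewrite exp_0 in X0. nra. }
    assert (B0 : Cmod (KI 0 nu t) <= 4 * M0) by (apply CInt0oo_bound, O0; exact Ht).
    assert (B1 : Cmod (KI 1 nu t) <= 4 * M1) by (apply CInt0oo_bound, O1; exact Ht).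
    specialize (G0 t Ht). specialize (G1 t Ht).
    pose proof (exp_pos (- t)) as E0. pose proof (exp_pos (t / 4)) as E1.
    assert (BY : Cmod (Y2 nu t) <= exp (- t) * (N0 * exp (t / 4))).
    { unfold Y2. rewrite Cmod_mult. fold m. apply Rmult_le_compat; auto; apply Cmod_ge_0. }
    assert (T0 : RtoC t <> 0) by (apply slit_neq_0, slit_R; lra).
    assert (BD : Cmod (dY2 nu t) <= exp (- t) * (((1 + nu) * N0 + 2 * (m * N1)) * exp (t / 4))).
    { unfold dY2. rewrite Cmod_mult. fold m. apply Rmult_le_compat; auto; try apply Cmod_ge_0.
      eapply Rle_trans; [apply Cmod_triangle|]. rewrite !Cmod_mult, Cmod_opp, !Cmod_R.
      rewrite (Rabs_pos_eq 2), (Rabs_pos_eq m) by (unfold m; lra).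
      assert (HA1 : Cmod (1 + nu / t)%C <= 1 + nu).
      { eapply Rle_trans; [apply Cmod_triangle|]. rewrite Cmod_1, Cmod_div, !Cmod_R, !Rabs_pos_eq by (auto; lra).
        assert (HA0 : nu / t <= nu); [|lra]. apply Rmult_le_reg_r with t; [lra|].
        replace (nu / t * t) with nu by (field; lra). nra. }
      assert (HA2 : Cmod (1 + nu / t)%C * Cmod (H m m (2 * t)) <= (1 + nu) * (N0 * exp (t / 4))).
      { apply Rmult_le_compat; auto; apply Cmod_ge_0. }
      assert (HA3 : m * Cmod (H m (m - 1) (2 * t)) <= m * (N1 * exp (t / 4))).
      { apply Rmult_le_compat_l; [unfold m; lra|auto]. }
      lra. }
    rewrite Cmod_mult, Cmod_R, Rabs_pos_eq by lra.
    apply Rle_trans with (t * (4 * M0 * (exp (- t) * (((1 + nu) * N0 + 2 * (m * N1)) * exp (t / 4))) + 4 * M1 * (exp (- t) * (N0 * exp (t / 4))))).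
    - apply Rmult_le_compat_l; [lra|]. eapply Rle_trans; [apply Cmod_triangle|]. rewrite !Cmod_mult.
      apply Rplus_le_compat; apply Rmult_le_compat; auto; apply Cmod_ge_0.
    - unfold D. right; ring. }
  assert (W0 : W 1 = 0).
  { apply Cmod_eq_0. apply Rle_antisym; [|apply Cmod_ge_0]. apply Rnot_lt_le. intro P.
    assert (D0 : 0 <= D).
    { unfold D. assert (0 < m) by (unfold m; lra).
      assert (0 < M0 * ((1 + nu) * N0 + 2 * (m * N1))).
      { apply Rmult_lt_0_compat; auto. assert (0 < (1 + nu) * N0) by (apply Rmult_lt_0_compat; lra).
        assert (0 < m * N1) by (apply Rmult_lt_0_compat; lra). lra. }
      assert (0 < M1 * N0) by (apply Rmult_lt_0_compat; lra). lra. }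
    set (c := Cmod (W 1)) in *.
    (* With this t the left side of c (1 + t / 4) <= 2 D equals 2 D + 5 c / 4, a contradiction for c
       > 0. *)
    set (t := 8 * D / c + 1).
    assert (Ht : 1 <= t).
    { unfold t. assert (0 <= D / c) by (apply Rmult_le_pos; [auto|left; apply Rinv_0_lt_compat; auto]). lra. }
    specialize (B t Ht).
    assert (X1 : t <= 2 * exp (t / 2)) by (pose proof (exp_ineq1_le (t / 2)); lra).
    assert (X2 : t * exp (- t) * exp (t / 4) <= 2 * exp (- (t / 4))).
    { apply Rle_trans with (2 * exp (t / 2) * exp (- t) * exp (t / 4)).
      - apply Rmult_le_compat_r; [left; apply exp_pos|]. apply Rmult_le_compat_r; [left; apply exp_pos|auto].
      - right. rewrite !Rmult_assoc, <- !exp_plus. f_equal. f_equal. field. }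
    assert (X3 : (1 + t / 4) * exp (- (t / 4)) <= 1).
    { pose proof (exp_ineq1_le (t / 4)). pose proof (exp_pos (- (t / 4))).
      assert (exp (t / 4) * exp (- (t / 4)) = 1).
      { rewrite <- exp_plus, Rplus_opp_r. apply exp_0. }
      nra. }
    assert (X4 : c * (1 + t / 4) <= 2 * D).
    { assert (c <= D * (2 * exp (- (t / 4)))) by (eapply Rle_trans; [apply B|apply Rmult_le_compat_l; auto]).
      apply Rle_trans with (D * (2 * exp (- (t / 4))) * (1 + t / 4)).
      - apply Rmult_le_compat_r; lra.
      - replace (D * (2 * exp (- (t / 4))) * (1 + t / 4)) with (2 * D * ((1 + t / 4) * exp (- (t / 4)))) by ring. nra. }
    assert (c * t = 8 * D + c) by (unfold t; field; lra). nra. }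
  specialize (CW x Hx). rewrite W0 in CW. unfold W in CW.
  assert (X0 : RtoC x <> 0) by (apply slit_neq_0, slit_R, Hx).
  replace (KI 0 nu x * dY2 nu x + KI 1 nu x * Y2 nu x)%C with
    (x * (KI 0 nu x * dY2 nu x + KI 1 nu x * Y2 nu x) / x)%C by (field; auto).
  rewrite CW. field. auto.
Qed.

Lemma KI_pos (nu x : R) : 0 < x -> KI 0 nu x <> 0.
Proof.
  intros Hx E. rewrite KI_R in E. apply RtoC_inj in E.
  destruct (kf_ok 0 nu x Hx) as [M O].
  assert (P : forall t, 0 <= t -> 0 < kf 0 nu x t).
  { intros t Ht. unfold kf. rewrite pow_O, Rmult_1_l. apply Rmult_lt_0_compat; [apply cosh_abs, Ht|apply exp_pos]. }
  assert (0 < RInt0oo (kf 0 nu x)).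
  { apply (RInt0oo_pos M _ 0 1); auto; try lra.
    - intros s Hs. left. apply P, Hs.
    - intros s Hs. apply P; lra. }
  lra.
Qed.

(** The vanishing Wronskian makes the quotient [KI 0 nu] / [Y2 nu] constant on the half-line. Since
    [Y2] is holomorphic on the whole slit plane, the continuation of the Macdonald function exists
    and is found at the same time. *)
Lemma besselK_pos_prop (nu : R) : 3/2 < nu -> exists c : C, c <> 0 /\
  is_besselK nu (fun z => c * Y2 nu z)%C.
Proof.
  intros Hnu.
  set (Q := fun z : C => (KI 0 nu z * / Y2 nu z)%C).
  assert (DQ : forall t : R, 0 < t -> Cder Q t 0).
  { intros t Ht. pose proof (Y2_neq_0 nu t ltac:(lra) Ht) as N. unfold Q. eapply Cder_eq.
    - apply Cder_mult; [apply Cder_KI, Ht|]. apply Cder_inv; [|exact N]. apply Cder_Y2; [apply slit_R, Ht|lra].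
    - cbv beta. pose proof (wronskian0 nu t Hnu Ht) as W0.
      transitivity (- (KI 0 nu t * dY2 nu t + KI 1 nu t * Y2 nu t) / (Y2 nu t * Y2 nu t))%C; [field; auto|].
      rewrite W0. field. auto. }
  pose proof (Cconst_of_der0 Q DQ) as CQ.
  exists (Q 1). split.
  - unfold Q. apply Cmult_neq_0; [apply KI_pos; lra|]. pose proof (Y2_neq_0 nu 1 ltac:(lra) Rlt_0_1) as N.
    apply Cmod_gt_0. rewrite Cmod_inv by auto. apply Rinv_0_lt_compat, Cmod_gt_0, N.
  - split.
    + intros z Hz. exists (Q 1 * dY2 nu z)%C. apply Cder_is_derive, Cder_scal, Cder_Y2; auto; lra.
    + intros x Hx. rewrite <- (CQ x Hx). unfold Q.
      pose proof (Y2_neq_0 nu x ltac:(lra) Hx) as N.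
      replace (KI 0 nu x * / Y2 nu x * Y2 nu x)%C with (KI 0 nu x) by (field; auto).
      rewrite KI_R. f_equal. unfold besselK_pos. apply RInt0oo_ext. intros t _. unfold kf. simpl. ring.
Qed.

(** * Goursat's theorem and analytic continuation *)

Definition CRInt (g : R -> C) (a b : R) : C := (RInt (fun t => Re (g t)) a b, RInt (fun t => Im (g t)) a b).

Definition cJ (g : R -> C) (a b : R) : Prop := a <= b /\ forall t, a <= t <= b -> Ccts g t.

Lemma cJ_ex (g : R -> C) (a b : R) : cJ g a b ->
  ex_RInt (fun t => Re (g t)) a b /\ ex_RInt (fun t => Im (g t)) a b.
Proof.
  intros [L Hc]. split; apply (ex_RInt_continuous (V := R_CompleteNormedModule)); intros t Ht;
    rewrite Rmin_left, Rmax_right in Ht by lra; [exact (proj1 (Hc t Ht))|exact (proj2 (Hc t Ht))].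
Qed.

Lemma cJ_sub (g : R -> C) (a b c d : R) : cJ g a b -> a <= c -> c <= d -> d <= b -> cJ g c d.
Proof. intros [L Hc] H1 H2 H3. split; auto. intros t Ht; apply Hc; lra. Qed.

Lemma CRInt_chasles (g : R -> C) (a m b : R) : a <= m <= b -> cJ g a b -> (CRInt g a m + CRInt g m b)%C = CRInt g a b.
Proof.
  intros Hm Hc.
  destruct (cJ_ex g a m) as [A1 A2]; [apply (cJ_sub g a b); auto; lra|].
  destruct (cJ_ex g m b) as [B1 B2]; [apply (cJ_sub g a b); auto; lra|].
  unfold CRInt. apply C_ext.
  - exact (RInt_Chasles (fun t => Re (g t)) a m b A1 B1).
  - exact (RInt_Chasles (fun t => Im (g t)) a m b A2 B2).
Qed.

Lemma CRInt_bound (g : R -> C) (a b M : R) : cJ g a b -> (forall t, a <= t <= b -> Cmod (g t) <= M) ->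
  Cmod (CRInt g a b) <= 2 * (M * (b - a)).
Proof.
  intros Hc HM. destruct (cJ_ex g a b Hc) as [A1 A2]. destruct Hc as [L _].
  eapply Rle_trans; [apply Cmod_le_abs|].
  assert (Rabs (RInt (fun t => Re (g t)) a b) <= (b - a) * M).
  { apply abs_RInt_le_const; auto. intros t Ht. eapply Rle_trans; [apply re_le_Cmod|auto]. }
  assert (Rabs (RInt (fun t => Im (g t)) a b) <= (b - a) * M).
  { apply abs_RInt_le_const; auto. intros t Ht. eapply Rle_trans; [apply Im_le_Cmod|auto]. }
  change (Rabs (RInt (fun t => Re (g t)) a b) + Rabs (RInt (fun t => Im (g t)) a b) <= 2 * (M * (b - a))). lra.
Qed.

Lemma CRInt_minus (g k : R -> C) (a b : R) : cJ g a b -> cJ k a b ->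
  CRInt (fun t => g t - k t)%C a b = (CRInt g a b - CRInt k a b)%C.
Proof.
  intros Hg Hk. destruct (cJ_ex g a b Hg) as [A1 A2]. destruct (cJ_ex k a b Hk) as [B1 B2].
  unfold CRInt. apply C_ext.
  - exact (RInt_minus (V := R_CompleteNormedModule) (fun t => Re (g t)) (fun t => Re (k t)) a b A1 B1).
  - exact (RInt_minus (V := R_CompleteNormedModule) (fun t => Im (g t)) (fun t => Im (k t)) a b A2 B2).
Qed.

Lemma CRInt_ext (g k : R -> C) (a b : R) : (forall t, g t = k t) -> CRInt g a b = CRInt k a b.
Proof.
  intros E. unfold CRInt. f_equal; apply (RInt_ext (V := R_CompleteNormedModule)); intros; rewrite E; reflexivity.
Qed.

Lemma Ccont_line (f : C -> C) (w h : C) (t : R) : Ccont f (w + t * h)%C -> Ccts (fun t => f (w + t * h)%C) t.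
Proof.
  intros Hf.
  assert (K : forall eps, 0 < eps -> exists d, 0 < d /\ forall s : R, Rabs (s - t) < d ->
    Cmod (f (w + s * h) - f (w + t * h))%C < eps).
  { intros eps He. destruct (Hf eps He) as (d & Hd & B). pose proof (Cmod_ge_0 h) as Hh.
    exists (d / (1 + Cmod h)). split; [apply Rdiv_lt_0_compat; lra|]. intros s Hs.
    specialize (B ((s - t)%R * h)%C).
    replace (w + t * h + (s - t)%R * h)%C with (w + s * h)%C in B by (rewrite RtoC_minus; ring).
    apply B. rewrite Cmod_mult, Cmod_R. pose proof (Rabs_pos (s - t)).
    apply Rlt_div_r in Hs; [|lra]. nra. }
  split; apply filterlim_locally; intros eps; destruct (K eps (cond_pos eps)) as (d & Hd & B);
    exists (mkposreal d Hd); intros s Hs; specialize (B s Hs).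
  - eapply Rle_lt_trans; [apply (re_le_Cmod (f (w + s * h) - f (w + t * h))%C)|exact B].
  - eapply Rle_lt_trans; [apply (Im_le_Cmod (f (w + s * h) - f (w + t * h))%C)|exact B].
Qed.

Definition seg_int (f : C -> C) (w h : C) (a b : R) : C := CRInt (fun t => h * f (w + t * h))%C a b.

Definition holo (f : C -> C) (z : C) : Prop := exists l, Cder f z l.

Lemma cJ_line (f : C -> C) (w h : C) (a b : R) : a <= b ->
  (forall t : R, a <= t <= b -> Ccont f (w + t * h)%C) -> cJ (fun t => h * f (w + t * h))%C a b.
Proof.
  intros L Hf. split; auto. intros t Ht. apply Ccts_mult; [apply Ccts_const|]. apply Ccont_line, Hf, Ht.
Qed.

Lemma seg_int_ftc (F f : C -> C) (w h : C) (a b : R) : a <= b ->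
  (forall t : R, a <= t <= b -> Cder F (w + t * h)%C (f (w + t * h)%C)) ->
  (forall t : R, a <= t <= b -> Ccont f (w + t * h)%C) ->
  seg_int f w h a b = (F (w + b * h) - F (w + a * h))%C.
Proof.
  intros L HF Hf. destruct (cJ_line f w h a b L Hf) as [_ Hc].
  unfold seg_int, CRInt. apply C_ext.
  - apply (is_RInt_unique (V := R_CompleteNormedModule)).
    apply (is_RInt_derive (V := R_CompleteNormedModule) (fun t : R => Re (F (w + t * h)%C))).
    + intros t Ht. rewrite Rmin_left, Rmax_right in Ht by lra. apply (Cder_line F w h _ t (HF t Ht)).
    + intros t Ht. rewrite Rmin_left, Rmax_right in Ht by lra. exact (proj1 (Hc t Ht)).
  - apply (is_RInt_unique (V := R_CompleteNormedModule)).
    apply (is_RInt_derive (V := R_CompleteNormedModule) (fun t : R => Im (F (w + t * h)%C))).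
    + intros t Ht. rewrite Rmin_left, Rmax_right in Ht by lra. apply (Cder_line F w h _ t (HF t Ht)).
    + intros t Ht. rewrite Rmin_left, Rmax_right in Ht by lra. exact (proj2 (Hc t Ht)).
Qed.

(** The boundary integral, counterclockwise. The parameter on each side is the running coordinate
    itself, so sub-rectangles reuse the same parametrisation and splitting is additivity of real
    integrals. *)
Definition Rect (f : C -> C) (a b c d : R) : C :=
  (seg_int f (0, c)%R 1 a b + seg_int f (b, 0)%R Ci c d - seg_int f (0, d)%R 1 a b - seg_int f (a, 0)%R Ci c d)%C.

Lemma ptH (x y : R) : (((0, y)%R : C) + x * 1)%C = (x, y).
Proof. apply C_ext; unfold Re, Im; simpl; ring. Qed.
Lemma ptV (x y : R) : (((x, 0)%R : C) + y * Ci)%C = (x, y).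
Proof. apply C_ext; unfold Re, Im; simpl; ring. Qed.

Definition inR (a b c d : R) (z : C) : Prop := a <= Re z <= b /\ c <= Im z <= d.

Lemma seg_int_chasles (f : C -> C) (w h : C) (a m b : R) : a <= m <= b ->
  (forall t : R, a <= t <= b -> Ccont f (w + t * h)%C) ->
  (seg_int f w h a m + seg_int f w h m b)%C = seg_int f w h a b.
Proof. intros Hm Hf. apply CRInt_chasles; auto. apply cJ_line; auto. lra. Qed.

Lemma Rect_split (f : C -> C) (a m b c n d : R) : a <= m <= b -> c <= n <= d ->
  (forall z, inR a b c d z -> Ccont f z) ->
  Rect f a b c d = (Rect f a m c n + Rect f m b c n + Rect f a m n d + Rect f m b n d)%C.
Proof.
  intros Hm Hn Hf. unfold Rect.
  assert (HH : forall y, c <= y <= d -> seg_int f (0, y)%R 1 a b = (seg_int f (0, y)%R 1 a m + seg_int f (0, y)%R 1 m b)%C).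
  { intros y Hy. symmetry. apply seg_int_chasles; auto. intros t Ht. rewrite ptH. apply Hf. split; simpl; lra. }
  assert (VV : forall x, a <= x <= b -> seg_int f (x, 0)%R Ci c d = (seg_int f (x, 0)%R Ci c n + seg_int f (x, 0)%R Ci n d)%C).
  { intros x Hx. symmetry. apply seg_int_chasles; auto. intros t Ht. rewrite ptV. apply Hf. split; simpl; lra. }
  rewrite (HH c), (HH d), (VV a), (VV b) by lra. ring.
Qed.

(** An affine function has a global quadratic primitive, whose values at the corners cancel. *)
Lemma Rect_affine (A B z0 : C) (a b c d : R) : a <= b -> c <= d ->
  Rect (fun z => A + (z - z0) * B)%C a b c d = 0.
Proof.
  intros Hab Hcd.
  set (F := fun z : C => (A * z + / 2 * B * ((z - z0) * (z - z0)))%C).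
  assert (D : forall z, Cder F z (A + (z - z0) * B)%C).
  { intros z. unfold F. eapply Cder_eq.
    - apply Cder_plus; [apply Cder_scal, Cder_id|]. apply Cder_scal.
      apply Cder_mult; apply Cder_minus; try apply Cder_id; apply Cder_const.
    - cbv beta. field. }
  assert (D' : forall z, Ccont (fun z => A + (z - z0) * B)%C z).
  { intros z. eapply Cder_cont. apply Cder_plus; [apply Cder_const|]. apply Cder_mult; [|apply Cder_const].
    apply Cder_minus; [apply Cder_id|apply Cder_const]. }
  unfold Rect. rewrite !(seg_int_ftc F) by auto. rewrite !ptH, !ptV. ring.
Qed.

Lemma Rect_minus (f g : C -> C) (a b c d : R) : a <= b -> c <= d ->
  (forall z, inR a b c d z -> Ccont f z) -> (forall z, inR a b c d z -> Ccont g z) ->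
  Rect (fun z => f z - g z)%C a b c d = (Rect f a b c d - Rect g a b c d)%C.
Proof.
  intros Hab Hcd Hf Hg. unfold Rect.
  assert (K : forall w h u v, u <= v -> (forall t : R, u <= t <= v -> inR a b c d (w + t * h)%C) ->
    seg_int (fun z => f z - g z)%C w h u v = (seg_int f w h u v - seg_int g w h u v)%C).
  { intros w h u v Huv Hin. unfold seg_int. rewrite <- CRInt_minus.
    - apply CRInt_ext. intros t. ring.
    - apply cJ_line; auto.
    - apply cJ_line; auto. }
  rewrite !K; auto; try ring; intros t Ht; rewrite ?ptH, ?ptV; split; simpl; lra.
Qed.

Lemma seg_int_bound (f : C -> C) (w h : C) (a b M : R) : a <= b ->
  (forall t : R, a <= t <= b -> Ccont f (w + t * h)%C) ->
  (forall t : R, a <= t <= b -> Cmod (f (w + t * h)%C) <= M) ->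
  Cmod (seg_int f w h a b) <= 2 * (Cmod h * M * (b - a)).
Proof.
  intros L Hc HM. apply CRInt_bound; [apply cJ_line; auto|]. intros t Ht. rewrite Cmod_mult.
  apply Rmult_le_compat_l; [apply Cmod_ge_0|auto].
Qed.

Lemma Rect_bound (f : C -> C) (a b c d M : R) : a <= b -> c <= d ->
  (forall z, inR a b c d z -> Ccont f z) -> (forall z, inR a b c d z -> Cmod (f z) <= M) ->
  Cmod (Rect f a b c d) <= 4 * M * ((b - a) + (d - c)).
Proof.
  intros Hab Hcd Hc HM. unfold Rect.
  assert (K1 : forall y, c <= y <= d -> Cmod (seg_int f (0, y)%R 1 a b) <= 2 * (M * (b - a))).
  { intros y Hy. pose proof (seg_int_bound f (0, y)%R 1 a b M Hab) as B. rewrite Cmod_1, Rmult_1_l in B.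
    apply B; intros t Ht; rewrite ptH; [apply Hc|apply HM]; split; simpl; lra. }
  assert (K2 : forall x, a <= x <= b -> Cmod (seg_int f (x, 0)%R Ci c d) <= 2 * (M * (d - c))).
  { intros x Hx. pose proof (seg_int_bound f (x, 0)%R Ci c d M Hcd) as B. rewrite Cmod_Ci, Rmult_1_l in B.
    apply B; intros t Ht; rewrite ptV; [apply Hc|apply HM]; split; simpl; lra. }
  pose proof (K1 c ltac:(lra)). pose proof (K1 d ltac:(lra)). pose proof (K2 a ltac:(lra)). pose proof (K2 b ltac:(lra)).
  unfold Cminus.
  eapply Rle_trans; [apply Cmod_triangle|]. rewrite Cmod_opp.
  eapply Rle_trans; [apply Rplus_le_compat_r, Cmod_triangle|]. rewrite Cmod_opp.
  eapply Rle_trans; [apply Rplus_le_compat_r, Rplus_le_compat_r, Cmod_triangle|]. lra.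
Qed.

(** Bisection: a rectangle whose integral exceeds E times its squared half-perimeter has a quarter
    with the same property. At the common point of the nested rectangles f is nearly affine, and
    [Rect_affine] contradicts the excess. *)
Theorem goursat (f : C -> C) (a b c d : R) : a <= b -> c <= d ->
  (forall z, inR a b c d z -> holo f z) -> Rect f a b c d = 0.
Proof.
  intros Hab Hcd Hf.
  assert (Hc : forall z, inR a b c d z -> Ccont f z).
  { intros z Hz. destruct (Hf z Hz) as [l Hl]. eapply Cder_cont, Hl. }
  destruct (Req_dec (Cmod (Rect f a b c d)) 0) as [|N]; [apply Cmod_eq_0; auto|exfalso].
  pose proof (Cmod_ge_0 (Rect f a b c d)) as P.
  set (S := (b - a) + (d - c)).
  assert (HS : 0 <= S) by (unfold S; lra).
  (* The added 1 keeps the denominator positive for a degenerate rectangle, and the factor 2 makes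
     the initial inequality strict. *)
  set (E := Cmod (Rect f a b c d) / (2 * (S * S + 1))).
  assert (HE : 0 < E) by (apply Rdiv_lt_0_compat; nra).
  assert (B0 : Cmod (Rect f a b c d) > E * (S * S)).
  { unfold E. apply Rlt_gt. apply Rmult_lt_reg_r with (2 * (S * S + 1)); [nra|].
    replace (Cmod (Rect f a b c d) / (2 * (S * S + 1)) * (S * S) * (2 * (S * S + 1))) with (Cmod (Rect f a b c d) * (S * S)) by (field; nra).
    nra. }
  set (lx := fun n => (b - a) / 2 ^ n). set (ly := fun n => (d - c) / 2 ^ n).
  assert (P2 : forall n, 0 < 2 ^ n) by (intros; apply pow_lt; lra).
  assert (lxS : forall n, lx (Datatypes.S n) = lx n / 2) by (intros n; unfold lx; simpl; field; apply pow_nonzero; lra).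
  assert (lyS : forall n, ly (Datatypes.S n) = ly n / 2) by (intros n; unfold ly; simpl; field; apply pow_nonzero; lra).
  assert (lx0 : forall n, 0 <= lx n) by (intros n; unfold lx; apply Rmult_le_pos; [lra|left; apply Rinv_0_lt_compat, P2]).
  assert (ly0 : forall n, 0 <= ly n) by (intros n; unfold ly; apply Rmult_le_pos; [lra|left; apply Rinv_0_lt_compat, P2]).
  set (Bad := fun n (p : R * R) => a <= fst p /\ fst p + lx n <= b /\ c <= snd p /\ snd p + ly n <= d /\
     Cmod (Rect f (fst p) (fst p + lx n) (snd p) (snd p + ly n)) > E * ((lx n + ly n) * (lx n + ly n))).
  set (Sub := fun n (p q : R * R) => fst p <= fst q /\ fst q + lx (Datatypes.S n) <= fst p + lx n /\
     snd p <= snd q /\ snd q + ly (Datatypes.S n) <= snd p + ly n).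
  (* Stated for all pairs so that [choice] yields a total function; on a pair that is not bad any
     answer is accepted. *)
  assert (Step : forall np : nat * (R * R), exists q, Bad (fst np) (snd np) -> Bad (Datatypes.S (fst np)) q /\ Sub (fst np) (snd np) q).
  { intros [n [x y]]. simpl fst. simpl snd.
    destruct (classic (Bad n (x, y))) as [HB|HB]; [|exists (x, y); intros; contradiction].
    pose proof HB as (b1 & b2 & b3 & b4 & b5). simpl in b1, b2, b3, b4, b5.
    pose proof (lx0 n) as X0. pose proof (ly0 n) as Y0.
    apply NNPP. intro NE.
    assert (Q : forall u v, (u = x \/ u = x + lx n / 2) -> (v = y \/ v = y + ly n / 2) ->
      Cmod (Rect f u (u + lx n / 2) v (v + ly n / 2)) <= E * ((lx n / 2 + ly n / 2) * (lx n / 2 + ly n / 2))).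
    { intros u v Hu Hv. apply Rnot_lt_le. intro L. apply NE. exists (u, v). intros _.
      unfold Bad, Sub; simpl fst; simpl snd. rewrite lxS, lyS.
      destruct Hu; destruct Hv; subst; repeat split; lra. }
    pose proof (Rect_split f x (x + lx n / 2) (x + lx n) y (y + ly n / 2) (y + ly n)) as Sp.
    rewrite Sp in b5; try lra.
    2:{ intros z [Hz1 Hz2]. apply Hc. split; lra. }
    pose proof (Q x y ltac:(auto) ltac:(auto)) as q1. pose proof (Q _ y (or_intror eq_refl) (or_introl eq_refl)) as q2.
    pose proof (Q x _ (or_introl eq_refl) (or_intror eq_refl)) as q3.
    pose proof (Q _ _ (or_intror eq_refl) (or_intror eq_refl)) as q4.
    replace (x + lx n / 2 + lx n / 2) with (x + lx n) in q2, q4 by field.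
    replace (y + ly n / 2 + ly n / 2) with (y + ly n) in q3, q4 by field.
    revert b5. apply Rle_not_gt.
    eapply Rle_trans; [apply Cmod_triangle|].
    eapply Rle_trans; [apply Rplus_le_compat_r, Cmod_triangle|].
    eapply Rle_trans; [apply Rplus_le_compat_r, Rplus_le_compat_r, Cmod_triangle|].
    replace (E * ((lx n + ly n) * (lx n + ly n))) with (4 * (E * ((lx n / 2 + ly n / 2) * (lx n / 2 + ly n / 2)))) by field.
    lra. }
  destruct (choice _ Step) as [st Hst].
  set (p := fix p (n : nat) : R * R := match n with O => (a, c) | Datatypes.S n => st (n, p n) end).
  assert (HB : forall n, Bad n (p n)).
  { induction n as [|n IH].
    - unfold Bad; simpl. unfold lx, ly. simpl. rewrite !Rdiv_1_r.
      replace (a + (b - a)) with b by ring. replace (c + (d - c)) with d by ring. repeat split; try lra. exact B0.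
    - exact (proj1 (Hst (n, p n) IH)). }
  assert (HSub : forall n, Sub n (p n) (p (Datatypes.S n))) by (intros n; exact (proj2 (Hst (n, p n) (HB n)))).
  assert (Nest : forall k n, fst (p n) <= fst (p (n + k)%nat) /\ fst (p (n + k)%nat) + lx (n + k)%nat <= fst (p n) + lx n /\
     snd (p n) <= snd (p (n + k)%nat) /\ snd (p (n + k)%nat) + ly (n + k)%nat <= snd (p n) + ly n).
  { induction k as [|k IH]; intros n.
    - rewrite Nat.add_0_r. lra.
    - rewrite Nat.add_succ_r. destruct (IH n) as (i1 & i2 & i3 & i4). destruct (HSub (n + k)%nat) as (j1 & j2 & j3 & j4). lra. }
  assert (Nest2 : forall n m, fst (p m) <= fst (p n) + lx n /\ snd (p m) <= snd (p n) + ly n).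
  { intros n m. destruct (Nat.le_ge_cases n m) as [L|L].
    - replace m with (n + (m - n))%nat by lia. pose proof (Nest (m - n)%nat n) as K.
      pose proof (lx0 (n + (m - n))%nat). pose proof (ly0 (n + (m - n))%nat). lra.
    - replace n with (m + (n - m))%nat by lia. pose proof (Nest (n - m)%nat m) as K.
      pose proof (lx0 (m + (n - m))%nat). pose proof (ly0 (m + (n - m))%nat). lra. }
  assert (Sup : forall u : nat -> R, (forall n m, u m <= u n + (lx n + ly n)) -> (exists B, forall n, u n <= B) ->
     exists l, forall n, u n <= l /\ forall B, (forall m, u m <= B) -> l <= B).
  { intros u Hu [B HBd]. destruct (completeness (fun x => exists n, x = u n)) as [l [L1 L2]].
    - exists B. intros x [n ->]. apply HBd.
    - exists (u O). exists O; auto.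
    - exists l. intros n. split; [apply L1; exists n; auto|]. intros B' HB'. apply L2. intros x [m ->]. apply HB'. }
  destruct (Sup (fun n => fst (p n))) as [xs Hxs].
  { intros n m. pose proof (Nest2 n m). pose proof (ly0 n). lra. }
  { exists (fst (p O) + lx O). intros n. apply (Nest2 O n). }
  destruct (Sup (fun n => snd (p n))) as [ys Hys].
  { intros n m. pose proof (Nest2 n m). pose proof (lx0 n). lra. }
  { exists (snd (p O) + ly O). intros n. apply (Nest2 O n). }
  assert (In : forall n, inR (fst (p n)) (fst (p n) + lx n) (snd (p n)) (snd (p n) + ly n) (xs, ys)).
  { intros n. split; simpl.
    - split; [apply Hxs|apply (Hxs n)]. intros m; apply Nest2.
    - split; [apply Hys|apply (Hys n)]. intros m; apply Nest2. }
  set (z0 := (xs, ys) : C).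
  assert (Hz0 : inR a b c d z0).
  { pose proof (proj1 (In O)) as I1. change (fst (p O) <= xs <= fst (p O) + lx O) in I1.
    pose proof (proj2 (In O)) as I2. change (snd (p O) <= ys <= snd (p O) + ly O) in I2.
    destruct (HB O) as (b1 & b2 & b3 & b4 & _). change (a <= xs <= b /\ c <= ys <= d). lra. }
  destruct (Hf z0 Hz0) as [l Hl].
  (* On a rectangle of half-perimeter s the remainder is at most E / 16 * (2 s), so [Rect_bound]
     gives E / 2 * s^2, less than the excess demands. *)
  destruct (Hl (E / 16)) as (dl & Hdl & Hd); [lra|].
  assert (Hn : exists n, lx n + ly n < dl).
  { assert (H2 : Rabs (/ 2) < 1) by (rewrite Rabs_pos_eq by lra; lra).
    assert (H3 : 0 < dl / (S + 1)) by (apply Rdiv_lt_0_compat; lra).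
    destruct (pow_lt_1_zero (/ 2) H2 (dl / (S + 1)) H3) as [n Hn].
    exists n. specialize (Hn n (le_n n)). rewrite Rabs_pos_eq in Hn by (apply pow_le; lra).
    assert (EQ : lx n + ly n = S * (/ 2) ^ n).
    { unfold lx, ly, S. rewrite pow_inv. field. apply pow_nonzero; lra. }
    rewrite EQ. apply Rlt_div_r in Hn; [|lra].
    assert (0 < (/ 2) ^ n) by (apply pow_lt; lra). nra. }
  destruct Hn as [n Hn].
  destruct (HB n) as (b1 & b2 & b3 & b4 & b5). specialize (In n).
  set (x := fst (p n)) in *. set (y := snd (p n)) in *. set (s := lx n + ly n) in *.
  pose proof (lx0 n) as X0. pose proof (ly0 n) as Y0.
  set (A := fun z : C => (f z0 + (z - z0) * l)%C).
  assert (HA : forall z, Ccont A z).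
  { intros z. eapply Cder_cont. unfold A. apply Cder_plus; [apply Cder_const|]. apply Cder_mult; [|apply Cder_const].
    apply Cder_minus; [apply Cder_id|apply Cder_const]. }
  assert (HcR : forall z, inR x (x + lx n) y (y + ly n) z -> Ccont f z).
  { intros z [K1 K2]. apply Hc. split; lra. }
  assert (EqR : Rect (fun z => f z - A z)%C x (x + lx n) y (y + ly n) = Rect f x (x + lx n) y (y + ly n)).
  { rewrite Rect_minus; auto; try lra. unfold A. rewrite Rect_affine by lra. ring. }
  rewrite <- EqR in b5. revert b5. apply Rle_not_gt.
  assert (BM : Cmod (Rect (fun z => f z - A z)%C x (x + lx n) y (y + ly n)) <=
     4 * (E / 16 * (2 * s)) * (x + lx n - x + (y + ly n - y))).
  { apply Rect_bound; try lra.
    - intros z Hz. specialize (HcR z Hz). intros eps He.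
      destruct (HcR (eps / 2) ltac:(lra)) as (d1 & Hd1 & K1). destruct (HA z (eps / 2) ltac:(lra)) as (d2 & Hd2 & K2).
      exists (Rmin d1 d2). split; [apply Rmin_pos; auto|]. intros h Hh.
      pose proof (Rmin_l d1 d2). pose proof (Rmin_r d1 d2).
      specialize (K1 h ltac:(lra)). specialize (K2 h ltac:(lra)).
      replace (f (z + h) - A (z + h) - (f z - A z))%C with ((f (z + h) - f z) + - (A (z + h) - A z))%C by ring.
      eapply Rle_lt_trans; [apply Cmod_triangle|]. rewrite Cmod_opp. lra.
    - intros z [K1 K2]. pose proof (proj1 In) as I1. change (x <= xs <= x + lx n) in I1.
      pose proof (proj2 In) as I2. change (y <= ys <= y + ly n) in I2.
      assert (Rz : Re z0 = xs) by reflexivity. assert (Iz : Im z0 = ys) by reflexivity.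
      assert (Dz : Cmod (z - z0)%C <= s).
      { eapply Rle_trans; [apply Cmod_le_abs|]. change (Rabs (Re z - Re z0) + Rabs (Im z - Im z0) <= s).
        assert (Rabs (Re z - Re z0) <= lx n) by (apply Rabs_le; lra).
        assert (Rabs (Im z - Im z0) <= ly n) by (apply Rabs_le; lra). unfold s; lra. }
      specialize (Hd (z - z0)%C ltac:(lra)).
      replace (z0 + (z - z0))%C with z in Hd by ring.
      replace (f z - A z)%C with (f z - f z0 - (z - z0) * l)%C by (unfold A; ring).
      eapply Rle_trans; [apply Hd|]. apply Rmult_le_compat_l; [lra|].
      pose proof (Cmod_ge_0 (z - z0)%C). lra. }
  eapply Rle_trans; [apply BM|].
  replace (x + lx n - x + (y + ly n - y)) with s by (unfold s; ring).
  assert (0 <= s * s) by nra. 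
  replace (4 * (E / 16 * (2 * s)) * s) with (E / 2 * (s * s)) by field. nra.
Qed.

(** * An identity theorem for the slit plane *)

Lemma holo_comp (f g : C -> C) (z : C) : holo f (g z) -> holo g z -> holo (fun x => f (g x)) z.
Proof. intros [l Hl] [m Hm]. exists (m * l)%C. apply Cder_comp; auto. Qed.

Lemma holo_cont (f : C -> C) (z : C) : holo f z -> Ccont f z.
Proof. intros [l Hl]. eapply Cder_cont, Hl. Qed.

(* In polar coordinates [eta = exp w] the two horizontal sides of the rectangle
   [-T, ln r] x [0, 2 pi] cancel, and the left side tends to [2 pi i h 0]. *)
Lemma circle_zero (h : C -> C) (r : R) : 0 < r < 1 ->
  (forall z, Cmod z < 1 -> holo h z) -> (forall z, Cmod z = r -> h z = 0) -> h 0 = 0.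
Proof.
  intros Hr Hh Hz.
  set (k := fun w => h (Cexp w)).
  pose proof PI_RGT_0 as Ppi.
  assert (Hk : forall w, Re w < 0 -> holo k w).
  { intros w Hw. apply (holo_comp h Cexp).
    - apply Hh. rewrite Cmod_Cexp, <- exp_0. apply exp_increasing, Hw.
    - exists (Cexp w). apply Cder_Cexp. }
  assert (Lr : ln r < 0) by (rewrite <- ln_1; apply ln_increasing; lra).
  assert (Per : forall x y, Cexp (x, y + 2 * PI) = Cexp (x, y)).
  { intros x y. unfold Cexp; simpl. rewrite cos_plus, sin_plus, cos_2PI, sin_2PI. f_equal; ring. }
  assert (H_zero : forall T, T < ln r -> seg_int k (T, 0)%R Ci 0 (2 * PI) = 0).
  { intros T HT.
    assert (G : Rect k T (ln r) 0 (2 * PI) = 0).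
    { apply goursat; try lra. intros z [K1 K2]. apply Hk. lra. }
    unfold Rect in G.
    assert (E1 : seg_int k (0, 2 * PI)%R 1 T (ln r) = seg_int k (0, 0)%R 1 T (ln r)).
    { apply CRInt_ext. intros t. rewrite !ptH. unfold k.
      replace ((t, 2 * PI) : C) with ((t, 0 + 2 * PI) : C) by (f_equal; ring). rewrite Per. reflexivity. }
    assert (E2 : seg_int k (ln r, 0)%R Ci 0 (2 * PI) = 0).
    { unfold seg_int. transitivity (CRInt (fun _ => RtoC 0) 0 (2 * PI)).
      - apply CRInt_ext. intros t. rewrite ptV. unfold k. rewrite Hz; [ring|].
        rewrite Cmod_Cexp. simpl Re. apply exp_ln; lra.
      - unfold CRInt. simpl. rewrite RInt_const. apply C_ext; unfold scal; simpl; unfold mult; simpl; ring. }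
    rewrite E1, E2 in G.
    replace (seg_int k (T, 0)%R Ci 0 (2 * PI)) with (- (seg_int k (0, 0)%R 1 T (ln r) + 0 - seg_int k (0, 0)%R 1 T (ln r) - seg_int k (T, 0)%R Ci 0 (2 * PI)))%C by ring.
    rewrite G. ring. }
  apply Cmod_eq_0. apply Rle_antisym; [|apply Cmod_ge_0]. apply Rnot_lt_le. intro P.
  assert (H0 : holo h 0) by (apply Hh; rewrite Cmod_0; lra).
  (* Near 0 the deviation is below |h 0| / 4. With the factor 2 lost in [seg_int_bound] this bounds
     by pi |h 0| an integral whose exact modulus is 2 pi |h 0|. *)
  destruct (holo_cont h 0 H0 (Cmod (h 0) / 4)) as (d & Hd & Hc); [lra|].
  set (T := Rmin (ln r - 1) (ln d - 1)).
  assert (T1 : T < ln r) by (unfold T; pose proof (Rmin_l (ln r - 1) (ln d - 1)); lra).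
  assert (T2 : T < ln d) by (unfold T; pose proof (Rmin_r (ln r - 1) (ln d - 1)); lra).
  specialize (H_zero T T1).
  assert (CT : forall t : R, Ccont k ((T, 0)%R + t * Ci)%C).
  { intros t. rewrite ptV. apply holo_cont, Hk. simpl. lra. }
  assert (E : seg_int (fun w => h 0 - k w)%C (T, 0)%R Ci 0 (2 * PI) = (2 * PI * Ci * h 0)%C).
  { transitivity (CRInt (fun t => Ci * h 0 - Ci * k ((T, 0)%R + t * Ci))%C 0 (2 * PI)).
    { apply CRInt_ext. intros t. ring. }
    rewrite CRInt_minus.
    - change (CRInt (fun t => (Ci * k ((T, 0)%R + t * Ci))%C) 0 (2 * PI)) with (seg_int k (T, 0)%R Ci 0 (2 * PI)).
      rewrite H_zero.
      unfold CRInt. rewrite !RInt_const. apply C_ext; unfold scal, Re, Im; simpl; unfold mult; simpl; ring.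
    - split; [lra|]. intros; apply Ccts_const.
    - apply cJ_line; [lra|]. intros; apply CT. }
  assert (B : Cmod (seg_int (fun w => h 0 - k w)%C (T, 0)%R Ci 0 (2 * PI)) <= 2 * (Cmod Ci * (Cmod (h 0) / 4) * (2 * PI - 0))).
  { apply seg_int_bound; [lra| |].
    - intros t _. specialize (CT t). intros eps He. destruct (CT eps He) as (d1 & Hd1 & K).
      exists d1. split; auto. intros u Hu. specialize (K u Hu). rewrite <- Cmod_opp.
      match goal with |- Cmod ?x < _ => replace x with (k ((T, 0)%R + t * Ci + u) - k ((T, 0)%R + t * Ci))%C by ring end.
      exact K.
    - intros t _. rewrite ptV. unfold k. rewrite <- Cmod_opp.
      replace (- (h 0 - h (Cexp (T, t))))%C with (h (0 + Cexp (T, t)) - h 0)%C by (rewrite Cplus_0_l; ring).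
      left. apply Hc. rewrite Cmod_Cexp. simpl Re. rewrite <- (exp_ln d) by auto. apply exp_increasing, T2. }
  rewrite E, Cmod_Ci, !Cmod_mult, Cmod_Ci, !Cmod_R, !Rabs_pos_eq in B by lra. nra.
Qed.

Fixpoint rotprod (h : C -> C) (a : R) (n : nat) (z : C) : C :=
  match n with
  | O => 1
  | S n => (rotprod h a n z * h (Cexp (0, INR n * a)%R * z))%C
  end.

Lemma holo_rotprod (h : C -> C) (a : R) (n : nat) : (forall z, Cmod z < 1 -> holo h z) ->
  forall z, Cmod z < 1 -> holo (rotprod h a n) z.
Proof.
  intros Hh z Hz. induction n as [|n [l IH]].
  - exists 0. exact (Cder_const 1 z).
  - assert (K : holo (fun z => h (Cexp (0, INR n * a)%R * z)%C) z).
    { apply (holo_comp h (fun z => Cexp (0, INR n * a)%R * z)%C).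
      - apply Hh. rewrite Cmod_mult, Cmod_Cexp. simpl Re. rewrite exp_0. lra.
      - eexists. apply Cder_scal, Cder_id. }
    destruct K as [m Hm]. eexists. simpl. apply Cder_mult; eauto.
Qed.

Lemma rotprod_0 (h : C -> C) (a : R) (n : nat) : rotprod h a n 0 = (h 0 ^ n)%C.
Proof. induction n as [|n IH]; simpl; [reflexivity|]. rewrite IH. rewrite Cmult_0_r. ring. Qed.

Lemma rotprod_zero (h : C -> C) (a : R) (n j : nat) (z : C) : (j < n)%nat ->
  h (Cexp (0, INR j * a)%R * z)%C = 0 -> rotprod h a n z = 0.
Proof.
  intros Hj E. induction n as [|n IH]; [lia|]. simpl.
  destruct (Nat.eq_dec j n) as [->|N].
  - rewrite E. ring.
  - rewrite IH by lia. ring.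
Qed.

Lemma unit_arg (u : C) : Cmod u = 1 -> exists t, 0 <= t < 2 * PI /\ u = Cexp (0, t).
Proof.
  intros Hu. pose proof PI_RGT_0 as Ppi.
  destruct (classic (slit_plane u)) as [S|S].
  - assert (E : u = Cexp (0, carg u)).
    { rewrite <- (Cexp_Clog u S) at 1. unfold Clog. rewrite Hu, ln_1. reflexivity. }
    pose proof (carg_bound u) as B.
    destruct (Rle_lt_dec 0 (carg u)).
    + exists (carg u). split; [lra|auto].
    + exists (carg u + 2 * PI). split; [lra|]. rewrite E at 1.
      unfold Cexp; simpl. rewrite cos_plus, sin_plus, cos_2PI, sin_2PI. f_equal; ring.
  - exists PI. split; [lra|].
    assert (I0 : Im u = 0) by (apply NNPP; intro N; apply S; right; auto).
    assert (R0 : Re u <= 0) by (apply Rnot_lt_le; intro N; apply S; left; auto).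
    pose proof (Cmod_sq u) as Q. rewrite Hu, I0 in Q.
    apply C_ext; unfold Cexp, Re, Im in *; simpl; rewrite exp_0, ?cos_PI, ?sin_PI; nra.
Qed.

Lemma Cexp_small (e : R) : 0 < e -> exists d, 0 < d /\ forall t, Rabs t < d -> Cmod (Cexp (0, t) - 1)%C < e.
Proof.
  intros He. destruct (Cder_cont _ _ _ (Cder_Cexp 0) e He) as (d & Hd & B).
  exists d. split; auto. intros t Ht. specialize (B (0, t)%R).
  rewrite Cplus_0_l in B. rewrite (Cexp_R 0), exp_0 in B. apply B.
  eapply Rle_lt_trans; [apply Cmod_le_abs|]. unfold Re, Im; simpl. rewrite Rabs_R0. lra.
Qed.

(* The product of the rotates of [h] by small angles vanishes on a whole circle around 0, hence
   at 0 by the mean value property; there it is a power of [h 0]. *)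
Lemma disc_identity (h : C -> C) (p : C) : (forall z, Cmod z < 1 -> holo h z) ->
  0 < Cmod p < 1 -> (exists e, 0 < e /\ forall u, Cmod u < e -> h (p + u)%C = 0) -> h 0 = 0.
Proof.
  intros Hh Hp (e & He & Hz). pose proof PI_RGT_0 as Ppi.
  destruct (Cexp_small e He) as (d & Hd & Hs).
  destruct (nfloor_ex (2 * PI / d)) as [N HN].
  { apply Rmult_le_pos; [lra|]. left; apply Rinv_0_lt_compat, Hd. }
  (* M exceeds 2 pi / d, so the step a is below d, and some rotation by a multiple of a brings each
     point of the circle through p within e of p. *)
  set (M := S N). set (a := 2 * PI / INR M).
  assert (PM : 0 < INR M) by (apply lt_0_INR; unfold M; lia).
  assert (Pa : 0 < a) by (apply Rdiv_lt_0_compat; lra).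
  assert (Ha : a < d).
  { unfold a. apply Rmult_lt_reg_r with (INR M); auto.
    replace (2 * PI / INR M * INR M) with (2 * PI) by (field; lra).
    unfold M. rewrite S_INR. destruct HN as [_ HN].
    apply Rlt_div_l in HN; [|lra]. lra. }
  assert (E : (h 0 ^ M)%C = 0).
  { rewrite <- (rotprod_0 h a M). apply (circle_zero _ (Cmod p)); auto.
    - apply holo_rotprod, Hh.
    - intros z Hzp.
      assert (p0 : p <> 0) by (apply Cmod_gt_0; lra).
      assert (z0 : z <> 0) by (apply Cmod_gt_0; lra).
      destruct (unit_arg (p / z)%C) as (t & Ht & Et).
      { rewrite Cmod_div, Hzp by auto. field. lra. }
      destruct (nfloor_ex (t / a)) as [j [Hj1 Hj2]].
      { apply Rmult_le_pos; [lra|]. left; apply Rinv_0_lt_compat, Pa. }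
      assert (J1 : INR j * a <= t).
      { apply (Rmult_le_compat_r a) in Hj1; [|lra]. replace (t / a * a) with t in Hj1 by (field; lra). auto. }
      assert (J2 : t < INR j * a + a).
      { apply Rlt_div_l in Hj2; [|lra]. lra. }
      apply (rotprod_zero h a M j).
      + apply INR_lt. apply Rmult_lt_reg_r with a; auto. unfold a at 2.
        replace (INR M * (2 * PI / INR M)) with (2 * PI) by (field; lra). lra.
      + assert (Ez : (Cexp (0, INR j * a)%R * z)%C = (p + p * (Cexp (0, INR j * a - t)%R - 1))%C).
        { replace (p + p * (Cexp (0, INR j * a - t)%R - 1))%C with (p * Cexp (0, INR j * a - t)%R)%C by ring.
          replace p with (p / z * z)%C at 1 by (field; auto). rewrite Et.
          replace (Cexp (0, t)%R * z * Cexp (0, INR j * a - t)%R)%C with (Cexp (0, t)%R * Cexp (0, INR j * a - t)%R * z)%C by ring.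
          rewrite <- Cexp_plus. f_equal. f_equal. apply C_ext; unfold Re, Im; simpl; ring. }
        rewrite Ez. apply Hz. rewrite Cmod_mult.
        assert (Cmod (Cexp (0, INR j * a - t)%R - 1)%C < e).
        { apply Hs. apply Rabs_lt_between. lra. }
        pose proof (Cmod_ge_0 (Cexp (0, INR j * a - t)%R - 1)%C). nra. }
  apply NNPP. intro NZ. revert E. generalize M. induction M0 as [|m IH]; simpl.
  - intros E. apply RtoC_inj in E. lra.
  - intros E. destruct (classic ((h 0 ^ m)%C = 0)) as [|N2]; [auto|].
    revert E. apply Cmult_neq_0; auto.
Qed.

Lemma slit_sq (z : C) : 0 < Re z -> slit_plane (z * z)%C.
Proof.
  intros P. destruct (Req_dec (Im z) 0) as [E|N]; [left|right].
  - change (0 < Re z * Re z - Im z * Im z). rewrite E. nra.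
  - change (Re z * Im z + Im z * Re z <> 0). intro E. apply N. nra.
Qed.

(** The function equal to f above the real axis and 0 elsewhere is holomorphic on the slit plane and
    vanishes on an open set. A map of the disc into the slit plane with 0 going to p reduces the
    claim to [disc_identity]. *)
Lemma identity_upper (f : C -> C) : (forall z, slit_plane z -> holo f z) ->
  (forall x : R, 0 < x -> f x = 0) -> forall p, 0 < Im p -> f p = 0.
Proof.
  intros Hf H0 p Hp.
  (* Holomorphy across the positive axis is the point to check: f vanishes there, hence so does its
     derivative, and the two halves match to first order. *)
  set (F := fun z : C => if Rlt_dec 0 (Im z) then f z else 0).
  assert (HF : forall z, slit_plane z -> holo F z).
  { intros z Hz. destruct (Rtotal_order (Im z) 0) as [L|[L|L]].
    - exists 0. apply (Cder_ext_loc (fun _ => RtoC 0) F z 0 (- Im z)); [lra| |apply Cder_const].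
      intros h Hh. unfold F. destruct (Rlt_dec 0 (Im (z + h)%C)) as [Q|]; auto.
      pose proof (Im_le_Cmod h) as B. apply Rabs_le_between in B. change (0 < Im z + Im h) in Q. lra.
    - destruct (Hf z Hz) as [l Hl].
      assert (Hre : 0 < Re z) by (destruct Hz as [|N]; [auto|contradiction]).
      assert (Ez : z = RtoC (Re z)) by (apply C_ext; [reflexivity|exact L]).
      assert (fz : f z = 0) by (rewrite Ez; auto).
      assert (l0 : l = 0).
      { apply Cmod_eq_0. apply Rle_antisym; [|apply Cmod_ge_0]. apply Rnot_lt_le. intro P.
        destruct (Hl (Cmod l / 2)) as (d & Hd & B); [lra|].
        set (t := Rmin (d / 2) (Re z)).
        assert (Ht : 0 < t) by (apply Rmin_pos; lra).
        assert (Ht1 : t <= d / 2) by apply Rmin_l.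
        specialize (B t). rewrite Cmod_R, Rabs_pos_eq in B by lra. specialize (B ltac:(lra)).
        rewrite Ez, <- RtoC_plus, !H0 in B by lra.
        replace (0 - 0 - t * l)%C with (- (t * l))%C in B by ring.
        rewrite Cmod_opp, Cmod_mult, Cmod_R, Rabs_pos_eq in B by lra. nra. }
      subst l. exists 0. intros eps He. destruct (Hl eps He) as (d & Hd & B).
      exists d. split; auto. intros h Hh. specialize (B h Hh).
      assert (F z = 0) as -> by (unfold F; destruct (Rlt_dec 0 (Im z)); auto).
      unfold F. destruct (Rlt_dec 0 (Im (z + h)%C)).
      + rewrite fz in B. exact B.
      + replace (0 - 0 - h * 0)%C with (RtoC 0) by ring. rewrite Cmod_0. pose proof (Cmod_ge_0 h). nra.
    - destruct (Hf z Hz) as [l Hl]. exists l. apply (Cder_ext_loc f F z l (Im z)); [lra| |exact Hl].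
      intros h Hh. unfold F. destruct (Rlt_dec 0 (Im (z + h)%C)) as [|Q]; auto.
      pose proof (Im_le_Cmod h) as B. apply Rabs_le_between in B. exfalso. apply Q. change (0 < Im z + Im h). lra. }
  set (q := Cexp (/ 2 * Clog p)%C).
  assert (Sp : slit_plane p) by (right; lra).
  assert (Hq : (q * q)%C = p).
  { unfold q. rewrite <- Cexp_plus. replace (/ 2 * Clog p + / 2 * Clog p)%C with (Clog p) by (field; apply C2_neq_0).
    apply Cexp_Clog, Sp. }
  assert (Ra : 0 < Re q).
  { unfold q, Cexp. simpl Re. apply Rmult_lt_0_compat; [apply exp_pos|].
    replace (Im (/ 2 * Clog p)%C) with (carg p / 2) by (unfold Clog, Im; simpl; field).
    pose proof (carg_bound p). apply cos_gt_0; lra. }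
  assert (Rb : 0 < Im q).
  { assert (E : Re q * Im q + Im q * Re q = Im p) by (rewrite <- Hq; reflexivity). nra. }
  set (a := Re q) in *. set (b := Im q) in *.
  (* The Cayley map sends the disc to the right half-plane; scaled by a and shifted by i b it sends
     0 to the square root q of p. Squaring then leads into the slit plane with 0 going to p. *)
  set (g := fun eta : C => (a * ((1 + eta) / (1 - eta)) + Ci * b)%C).
  assert (G1 : forall eta, Cmod eta < 1 -> (1 - eta)%C <> 0).
  { intros eta He E. assert (eta = 1) as -> by (replace eta with (1 - (1 - eta))%C by ring; rewrite E; ring).
    rewrite Cmod_1 in He. lra. }
  assert (G2 : forall eta, Cmod eta < 1 -> 0 < Re (g eta)).
  { intros eta He. pose proof (G1 eta He) as N.
    assert (E : Re (g eta) = a * Re ((1 + eta) / (1 - eta))%C).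
    { unfold g. rewrite re_plus, re_scal_l. unfold Ci, Re; simpl. ring. }
    rewrite E. apply Rmult_lt_0_compat; auto.
    destruct eta as [x y]. pose proof (Cmod_sq (x, y)) as Q. simpl in Q.
    pose proof (Cmod_ge_0 (x, y)) as Q0.
    assert (Q1 : x * x + y * y < 1) by nra.
    assert (Q2 : 0 < (1 - x) * (1 - x) + y * y).
    { assert (x < 1) by nra. nra. }
    unfold Re, Cdiv, Cinv, Cmult, Cplus, Cminus, Copp; simpl.
    match goal with |- 0 < ?e => replace e with ((1 - (x * x + y * y)) / ((1 - x) * (1 - x) + y * y)) end.
    - apply Rdiv_lt_0_compat; lra.
    - field. nra. }
  assert (G3 : forall eta, Cmod eta < 1 -> holo g eta).
  { intros eta He. pose proof (G1 eta He) as N. eexists. unfold g. apply Cder_plus; [|apply Cder_const].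
    apply Cder_scal. unfold Cdiv. apply Cder_mult.
    - apply Cder_plus; [apply Cder_const|apply Cder_id].
    - apply Cder_inv; [|exact N]. apply Cder_minus; [apply Cder_const|apply Cder_id]. }
  set (psi := fun eta : C => (g eta * g eta)%C).
  assert (Gpsi : forall eta, Cmod eta < 1 -> holo psi eta).
  { intros eta He. destruct (G3 eta He) as [l Hl]. eexists. unfold psi. apply Cder_mult; exact Hl. }
  set (h := fun eta => F (psi eta)).
  assert (Hh : forall eta, Cmod eta < 1 -> holo h eta).
  { intros eta He. apply (holo_comp F psi).
    - apply HF. unfold psi. apply slit_sq, G2, He.
    - apply Gpsi, He. }
  set (c := 2 * b / a).
  assert (Pc : 0 < c) by (apply Rdiv_lt_0_compat; lra).
  assert (N2 : (2 - Ci * c)%C <> 0).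
  { intro E. assert (K : Re (2 - Ci * c)%C = 0) by (rewrite E; reflexivity). unfold Re in K; simpl in K. lra. }
  (* The solution of g es = a - i b, the conjugate of q; its square is the conjugate of p and lies
     in the lower half-plane, where F is 0. *)
  set (es := (- (Ci * c) / (2 - Ci * c))%C).
  assert (Es : 0 < Cmod es < 1).
  { unfold es. rewrite Cmod_div, Cmod_opp, Cmod_mult, Cmod_Ci, Cmod_R, Rabs_pos_eq by (auto; lra).
    pose proof (Cmod_sq (2 - Ci * c)%C) as Q. pose proof (Cmod_ge_0 (2 - Ci * c)%C) as Q0.
    replace (Re (2 - Ci * c)%C) with 2 in Q by (unfold Re; simpl; ring).
    replace (Im (2 - Ci * c)%C) with (- c) in Q by (unfold Im; simpl; ring).
    set (m := Cmod (2 - Ci * c)%C) in *. assert (c < m) by nra.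
    split.
    - apply Rdiv_lt_0_compat; lra.
    - apply Rmult_lt_reg_r with m; [lra|]. replace (1 * c / m * m) with c by (field; lra). lra. }
  assert (gs : g es = (a - Ci * b)%C).
  { unfold g. replace ((1 + es) / (1 - es))%C with (1 - Ci * c)%C.
    - replace (RtoC b) with (a * c / 2)%C.
      + field. 
      + unfold c. apply C_ext; unfold Re, Im; simpl; field; lra.
    - assert (E1 : (1 - es)%C = (2 / (2 - Ci * c))%C) by (unfold es; field; auto).
      assert (E2 : (1 + es)%C = (2 * (1 - Ci * c) / (2 - Ci * c))%C) by (unfold es; field; auto).
      rewrite E1, E2. field. auto using C2_neq_0. }
  assert (K : h 0 = 0).
  { apply (disc_identity h es Hh Es).
    assert (Ip : Im (psi es) < 0).
    { unfold psi. rewrite gs. unfold Im; simpl. nra. }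
    destruct (holo_cont psi es (Gpsi es ltac:(lra)) (- Im (psi es)) ltac:(lra)) as (d & Hd & B).
    exists d. split; auto. intros u Hu. specialize (B u Hu).
    unfold h, F. destruct (Rlt_dec 0 (Im (psi (es + u)%C))) as [Q|]; auto.
    pose proof (Im_le_Cmod (psi (es + u) - psi es)%C) as L. apply Rabs_le_between in L.
    change (Im (psi (es + u) - psi es)%C) with (Im (psi (es + u)%C) - Im (psi es)) in L. lra. }
  unfold h, psi in K. assert (g0 : g 0 = q).
  { unfold g. replace ((1 + 0) / (1 - 0))%C with (RtoC 1) by (replace (1 - 0)%C with (RtoC 1) by ring; field).
    rewrite <- (pairC q). fold a b. clearbody a b. apply C_ext; unfold Re, Im; simpl; ring. }
  rewrite g0, Hq in K. unfold F in K. destruct (Rlt_dec 0 (Im p)); [exact K|contradiction].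
Qed.

Lemma slit_conj (z : C) : slit_plane z -> slit_plane (Cconj z).
Proof.
  intros [P|P]; [left; exact P|right]. change (- Im z <> 0). lra.
Qed.

Lemma Cconj_R (x : R) : Cconj x = x.
Proof. apply C_ext; simpl; ring. Qed.
Lemma Cconj_plus' (z w : C) : Cconj (z + w) = (Cconj z + Cconj w)%C.
Proof. apply C_ext; unfold Re, Im; simpl; ring. Qed.
Lemma Cconj_mult' (z w : C) : Cconj (z * w) = (Cconj z * Cconj w)%C.
Proof. apply C_ext; unfold Re, Im; simpl; ring. Qed.
Lemma Cconj_minus' (z w : C) : Cconj (z - w) = (Cconj z - Cconj w)%C.
Proof. apply C_ext; unfold Re, Im; simpl; ring. Qed.
Lemma Cconj_invol (z : C) : Cconj (Cconj z) = z.
Proof. apply C_ext; unfold Re, Im; simpl; ring. Qed.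

(** The lower half-plane is reduced to the upper one by z -> conj (f (conj z)), which is again
    holomorphic. *)
Theorem slit_identity (f : C -> C) : (forall z, slit_plane z -> holo f z) ->
  (forall x : R, 0 < x -> f x = 0) -> forall p, slit_plane p -> f p = 0.
Proof.
  intros Hf H0 p Hp. destruct (Rtotal_order (Im p) 0) as [L|[L|L]].
  - set (g := fun z => Cconj (f (Cconj z))).
    assert (K : g (Cconj p) = 0).
    { apply (identity_upper g).
      - intros z Hz. destruct (Hf _ (slit_conj z Hz)) as [l Hl]. exists (Cconj l). intros eps He.
        destruct (Hl eps He) as (d & Hd & B). exists d. split; auto. intros h Hh.
        specialize (B (Cconj h)). rewrite Cmod_conj in B. specialize (B Hh).
        rewrite <- Cmod_conj. unfold g. rewrite !Cconj_minus', !Cconj_invol, Cconj_mult', Cconj_invol, Cconj_plus'. exact B.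
      - intros x Hx. unfold g. rewrite Cconj_R, H0 by auto. apply Cconj_R.
      - change (0 < - Im p). lra. }
    unfold g in K. rewrite Cconj_invol in K. rewrite <- (Cconj_invol (f p)), K. apply Cconj_R.
  - destruct Hp as [P|P]; [|contradiction].
    replace p with (RtoC (Re p)) by (apply C_ext; [reflexivity|symmetry; exact L]). auto.
  - apply identity_upper; auto.
Qed.

(** * Zeros of [besselK] as zeros of H_m, and conjugation symmetry *)

Lemma is_besselK_unique (nu : R) (f g : C -> C) : is_besselK nu f -> is_besselK nu g ->
  forall z, slit_plane z -> f z = g z.
Proof.
  intros [F1 F2] [G1 G2] z Hz.
  assert (K : (f z - g z)%C = 0).
  { apply (slit_identity (fun z => f z - g z)%C); auto.
    - intros w Hw. destruct (F1 w Hw) as [l Hl]. destruct (G1 w Hw) as [m Hm].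
      exists (l - m)%C. apply Cder_minus; apply Cder_is_derive; auto.
    - intros x Hx. rewrite F2, G2 by auto. ring. }
  replace (f z) with (f z - g z + g z)%C by ring. rewrite K. ring.
Qed.

Lemma besselK_zero_H (nu : R) (z : C) : 3/2 < nu ->
  (besselK_zero nu z <-> slit_plane z /\ H (nu - 1/2) (nu - 1/2) (2 * z) = 0).
Proof.
  intros Hnu. destruct (besselK_pos_prop nu Hnu) as (c & Hc & His).
  (* [epsilon] picks some function of a class now known to be inhabited; the identity theorem makes
     it agree with c * [Y2] on the slit plane. *)
  assert (B : is_besselK nu (besselK nu)) by (unfold besselK; apply epsilon_spec; eexists; exact His).
  unfold besselK_zero. split; intros [S E]; split; auto.
  - rewrite (is_besselK_unique nu _ _ B His z S) in E. unfold Y2 in E.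
    apply NNPP. intro N. revert E. repeat apply Cmult_neq_0; auto; [apply Cexp_neq_0|apply Cpw_neq_0].
  - rewrite (is_besselK_unique nu _ _ B His z S). unfold Y2. rewrite E. ring.
Qed.

Lemma carg_conj (z : C) : carg (Cconj z) = - carg z.
Proof.
  unfold carg. rewrite Cmod_conj. change (Re (Cconj z)) with (Re z). change (Im (Cconj z)) with (- Im z).
  unfold Rdiv. rewrite Ropp_mult_distr_l_reverse, atan_opp. ring.
Qed.

Lemma Cpw_conj (a : R) (z : C) : Cpw a (Cconj z) = Cconj (Cpw a z).
Proof.
  unfold Cpw, Clog, Cexp. rewrite Cmod_conj, carg_conj.
  apply C_ext; unfold Re, Im, Cconj; simpl.
  - replace (a * - carg z + 0 * ln (Cmod z)) with (- (a * carg z + 0 * ln (Cmod z))) by ring.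
    rewrite cos_neg. f_equal. f_equal. ring.
  - replace (a * - carg z + 0 * ln (Cmod z)) with (- (a * carg z + 0 * ln (Cmod z))) by ring.
    rewrite sin_neg, Ropp_mult_distr_r. f_equal. f_equal. ring.
Qed.

Lemma H_conj (a b : R) (w : C) : slit_plane w -> 0 < a -> H a b (Cconj w) = Cconj (H a b w).
Proof.
  intros Hs Ha. destruct (Hf_ok1 w a b Hs Ha) as [M O].
  assert (E : forall s, Hf a b (Cconj w) s = Cconj (Hf a b w s)).
  { intros s. unfold Hf. rewrite Cconj_mult', Cconj_R, <- Cpw_conj, Cconj_plus', Cconj_R. reflexivity. }
  apply C_ext.
  - change (RInt0oo (fun s => Re (Hf a b (Cconj w) s)) = RInt0oo (fun s => Re (Hf a b w s))).
    apply RInt0oo_ext. intros s _. rewrite E. reflexivity.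
  - change (RInt0oo (fun s => Im (Hf a b (Cconj w) s)) = - RInt0oo (fun s => Im (Hf a b w s))).
    transitivity (RInt0oo (fun s => -1 * Im (Hf a b w s))).
    + apply RInt0oo_ext. intros s _. rewrite E. change (- Im (Hf a b w s) = -1 * Im (Hf a b w s)). ring.
    + rewrite (RInt0oo_scal M) by (apply okC_Im, O). ring.
Qed.

Lemma carg_ge0 (z : C) : slit_plane z -> 0 <= Im z -> 0 <= carg z.
Proof.
  intros Hs Hi. destruct (slit_pos z Hs) as [_ P]. unfold carg.
  assert (0 <= atan (Im z / (Re z + Cmod z))); [|lra].
  rewrite <- atan_0. assert (Q : 0 <= Im z / (Re z + Cmod z)).
  { apply Rmult_le_pos; auto. left. apply Rinv_0_lt_compat, P. }
  destruct Q as [Q|Q]; [left; apply atan_increasing, Q|rewrite <- Q; right; reflexivity].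
Qed.

Lemma carg_le0 (z : C) : slit_plane z -> Im z <= 0 -> carg z <= 0.
Proof.
  intros Hs Hi. pose proof (carg_ge0 _ (slit_conj z Hs)) as K. rewrite carg_conj in K.
  change (Im (Cconj z)) with (- Im z) in K. lra.
Qed.

(** * Boundary values on the cut *)
(* The argument in [0, pi] of a point of the closed upper half-plane, continuous across both half-axes. *)
Definition argu (z : C) : R := PI / 2 + carg (Im z, - Re z).
(* The power [z^a] with the branch of the closed upper half-plane; it vanishes at 0. *)
Definition pup (a : R) (z : C) : C := (spow a (Cmod z) * cos (a * argu z), spow a (Cmod z) * sin (a * argu z)).

Lemma argu_eq (z : C) : slit_plane z -> 0 <= Im z -> argu z = carg z.
Proof.
  intros Hs Hi. destruct (slit_pos z Hs) as [P _].
  assert (Hs2 : slit_plane (Im z, - Re z)).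
  { destruct Hi as [L|L]; [left; exact L|right]. destruct Hs as [Q|Q]; [|congruence].
    change (- Re z <> 0). lra. }
  assert (Em : Cmod (Im z, - Re z) = Cmod z).
  { unfold Cmod, Re, Im; simpl. f_equal. ring. }
  assert (E : Cexp (ln (Cmod z), argu z) = Cexp (ln (Cmod z), carg z)).
  { change (ln (Cmod z), carg z) with (Clog z). rewrite Cexp_Clog by auto.
    unfold argu. pose proof (Cexp_Clog _ Hs2) as K. unfold Clog in K. rewrite Em in K.
    set (x := carg (Im z, - Re z)) in *.
    replace (ln (Cmod z), PI / 2 + x) with ((0, PI / 2)%R + (ln (Cmod z), x))%C
      by (apply C_ext; unfold Re, Im; simpl; ring).
    rewrite Cexp_plus, K. unfold Cexp. simpl Re; simpl Im. rewrite cos_PI2, sin_PI2, exp_0.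
    apply C_ext; unfold Re, Im; simpl; ring. }
  apply Cexp_inj in E.
  - injection E. auto.
  - simpl. unfold argu. pose proof (carg_bound z). pose proof (carg_ge0 z Hs Hi).
    pose proof (carg_bound (Im z, - Re z)). pose proof PI_RGT_0. lra.
Qed.

Lemma pup_eq (a : R) (z : C) : slit_plane z -> 0 <= Im z -> pup a z = Cpw a z.
Proof.
  intros Hs Hi. unfold pup. rewrite argu_eq by auto. rewrite spow_pos by apply slit_pos, Hs.
  unfold Cpw, Cexp, Clog. apply C_ext; unfold Re, Im; simpl; f_equal; f_equal; ring.
Qed.

Lemma Cmod_pup (a : R) (z : C) : Cmod (pup a z) = spow a (Cmod z).
Proof.
  unfold pup. replace (spow a (Cmod z) * cos (a * argu z), spow a (Cmod z) * sin (a * argu z))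
    with (spow a (Cmod z) * Cexp (0, a * argu z)%R)%C.
  - rewrite Cmod_mult, Cmod_Cexp, Cmod_R, Rabs_pos_eq by apply spow_ge0. simpl. rewrite exp_0. ring.
  - apply C_ext; unfold Cexp, Re, Im; simpl; rewrite exp_0; ring.
Qed.

(** For the origin: the angle is discontinuous there, but its cosine and sine are bounded and
    multiply a modulus that tends to 0. *)
Lemma cU_mult0 {U : UniformSpace} (f g : U -> R) (p : U) : continuous f p -> f p = 0 ->
  (forall q, Rabs (g q) <= 1) -> continuous (fun q => f q * g q) p.
Proof.
  intros Hf E B. apply squeeze0; [rewrite E; ring|]. intros eps He.
  generalize (cont_loc f p Hf eps He). apply filter_imp. intros q Hq. rewrite E, Rminus_0_r in Hq.
  rewrite Rabs_mult. specialize (B q). pose proof (Rabs_pos (f q)). pose proof (Rabs_pos (g q)). nra.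
Qed.

Lemma cU_pup {U : UniformSpace} (A X Y : U -> R) (p : U) :
  continuous A p -> continuous X p -> continuous Y p -> 0 < A p -> 0 <= Y p ->
  continuous (fun q => Re (pup (A q) (X q, Y q))) p /\ continuous (fun q => Im (pup (A q) (X q, Y q))) p.
Proof.
  intros HA HX HY PA PY.
  assert (CS : continuous (fun q => spow (A q) (Cmod (X q, Y q))) p) by (apply cU_spow; auto; apply cU_Cmod; auto).
  destruct (classic (X p = 0 /\ Y p = 0)) as [[E1 E2]|N].
  - assert (H_zero : spow (A p) (Cmod (X p, Y p)) = 0).
    { rewrite E1, E2. change ((0, 0)%R : C) with (RtoC 0). rewrite Cmod_0. apply spow_np; lra. }
    split.
    + apply (cU_mult0 (fun q => spow (A q) (Cmod (X q, Y q))) (fun q => cos (A q * argu (X q, Y q)))); auto.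
      intros q. apply Rabs_le. apply COS_bound.
    + apply (cU_mult0 (fun q => spow (A q) (Cmod (X q, Y q))) (fun q => sin (A q * argu (X q, Y q)))); auto.
      intros q. apply Rabs_le. apply SIN_bound.
  - assert (Sl : slit_plane (Y p, - X p)).
    { destruct PY as [L|L]; [left; exact L|right]. simpl. intro K. apply N. split; [lra|auto]. }
    assert (CA : continuous (fun q => A q * argu (X q, Y q)) p).
    { apply cU_mult; auto. unfold argu. simpl. apply cU_plus; [apply cU_const|].
      apply cU_carg; auto. apply cU_opp; auto. }
    split.
    + apply (cU_mult (fun q => spow (A q) (Cmod (X q, Y q))) (fun q => cos (A q * argu (X q, Y q)))); auto.
      apply cU_cos; auto.
    + apply (cU_mult (fun q => spow (A q) (Cmod (X q, Y q))) (fun q => sin (A q * argu (X q, Y q)))); auto.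
      apply cU_sin; auto.
Qed.

Definition Hpf (a : R) (w : C) (s : R) : C := (Hw a s * pup a (s + w))%C.
Definition Hp (a : R) (w : C) : C := CInt0oo (Hpf a w).

Lemma cU_Hpf {U : UniformSpace} (A X Y S : U -> R) (p : U) :
  continuous A p -> continuous X p -> continuous Y p -> continuous S p -> 0 < A p -> 0 <= Y p ->
  continuous (fun q => Re (Hpf (A q) (X q, Y q) (S q))) p /\
  continuous (fun q => Im (Hpf (A q) (X q, Y q) (S q))) p.
Proof.
  intros HA HX HY HS PA PY.
  assert (CX : continuous (fun q => S q + X q) p) by (apply cU_plus; auto).
  destruct (cU_pup A (fun q => S q + X q) Y p HA CX HY PA PY) as [K1 K2].
  pose proof (cU_Hw A S p HA HS PA) as K3.
  split.
  - apply (continuous_ext (fun q => Hw (A q) (S q) * Re (pup (A q) (S q + X q, Y q)))).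
    + intros q. unfold Hpf. rewrite re_scal_l. f_equal. f_equal. f_equal. apply C_ext; unfold Re, Im; simpl; ring.
    + apply cU_mult; auto.
  - apply (continuous_ext (fun q => Hw (A q) (S q) * Im (pup (A q) (S q + X q, Y q)))).
    + intros q. unfold Hpf.
      replace (S q + (X q, Y q))%C with ((S q + X q, Y q) : C) by (apply C_ext; unfold Re, Im; simpl; ring).
      unfold Im; simpl; ring.
    + apply cU_mult; auto.
Qed.

(** Uniform up to the cut: with positive exponents the integrand stays bounded where s + w is close
    to 0, so the distance to the cut does not enter. *)
Lemma Hpf_ok (A R0 : R) : 0 < A -> 0 < R0 -> exists M, 0 < M /\ forall a w, 0 < a <= A -> Cmod w <= R0 -> 0 <= Im w ->
  okC M (Hpf a w).
Proof.
  intros HA HR. destruct (exp_ln_growth A ltac:(lra)) as (K & HK & G).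
  destruct (Hw_dom A ltac:(lra)) as (M & HM & D).
  set (L := ln (1 + R0)). assert (L0 : 0 < L) by (unfold L; rewrite <- ln_1; apply ln_increasing; lra).
  exists (M * (exp (A * L) * K)). split; [repeat apply Rmult_lt_0_compat; auto; apply exp_pos|].
  intros a w Ha Hwn Hi s Hs. split.
  - rewrite <- (pairC w).
    apply (cU_Hpf (fun _ => a) (fun _ => Re w) (fun _ => Im w) (fun s => s)); try apply cU_const; try apply continuous_id; lra.
  - apply D; [exact Hs|lra|]. rewrite Cmod_pup.
    assert (B : Cmod (s + w)%C <= (1 + R0) * (1 + s)).
    { eapply Rle_trans; [apply Cmod_triangle|]. rewrite Cmod_R, Rabs_pos_eq by lra. nra. }
    destruct (Rle_lt_dec (Cmod (s + w)%C) 0) as [N|P].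
    + rewrite spow_np by auto. left. apply Rmult_lt_0_compat; [apply Rmult_lt_0_compat; auto|]; apply exp_pos.
    + rewrite spow_pos by auto.
      apply Rle_trans with (exp (A * L) * exp (a * ln (1 + s))).
      * rewrite <- exp_plus. apply exp_le.
        assert (ln (Cmod (s + w)%C) <= L + ln (1 + s)).
        { unfold L. rewrite <- ln_mult by lra. apply ln_le'; lra. }
        nra.
      * rewrite Rmult_assoc. apply Rmult_le_compat_l; [left; apply exp_pos|]. apply G; lra.
Qed.

Lemma Hp_cont (m0 p : R) : 0 < m0 -> forall eps, 0 < eps -> exists d, 0 < d /\
  forall m w, Rabs (m - m0) < d -> Cmod (w - p)%C < d -> 0 <= Im w -> Cmod (Hp m w - Hp m0 p)%C < eps.
Proof.
  intros Hm eps He.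
  destruct (Hpf_ok (2 * m0) (Rabs p + 1)) as (M & HM & O); [lra|pose proof (Rabs_pos p); lra|].
  assert (K : locally ((m0, RtoC p) : UC) (fun q : UC => 0 <= Im (snd q) ->
     Cmod (CInt0oo (Hpf (fst q) (snd q)) - CInt0oo (Hpf m0 p))%C < eps)).
  { apply (CInt0oo_param (U := UC) (fun q => 0 <= Im (snd q)) (fun q => Hpf (fst q) (snd q)) (m0, RtoC p) M).
    - simpl. lra.
    - apply (locally_UC' m0 p (Rmin 1 m0)); [apply Rmin_pos; lra|].
      intros m w H1 H2 H3. pose proof (Rmin_l 1 m0) as Ml. pose proof (Rmin_r 1 m0) as Mr. simpl in *.
      apply Rabs_lt_between in H1. apply O; auto; [lra|].
      replace w with (p + (w - p))%C by ring. eapply Rle_trans; [apply Cmod_triangle|]. rewrite Cmod_R. lra.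
    - intros s Hs. destruct (cUC_w (V := R_UniformSpace) (m0, RtoC p) s) as [W1 W2].
      pose proof (cUC_m (V := R_UniformSpace) (m0, RtoC p) s) as W3.
      pose proof (cUC_s (m0, RtoC p) s) as W4.
      apply (cU_Hpf (U := prod_UniformSpace UC R_UniformSpace) (fun q => fst (fst q))
        (fun q => Re (snd (fst q))) (fun q => Im (snd (fst q))) (fun q => snd q) ((m0, RtoC p), s)); auto.
      simpl. lra.
    - exact He. }
  destruct (locally_UC m0 p _ K) as (d & Hd & B). exists d. split; auto.
Qed.

Lemma Hp_eq (m : R) (w : C) : slit_plane w -> 0 <= Im w -> Hp m w = H m m w.
Proof.
  intros Hs Hi. apply CInt0oo_ext. intros s Ps. unfold Hpf, Hf. f_equal. apply pup_eq.
  - apply slit_shift; auto; lra.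
  - change (0 <= 0 + Im w). lra.
Qed.

Lemma pup_real (m x : R) : pup m x = if Rlt_dec x 0 then (spow m (Rabs x) * Cexp (0, m * PI)%R)%C else RtoC (spow m (Rabs x)).
Proof.
  destruct (Rlt_dec x 0) as [L|L].
  - assert (E : argu x = PI).
    { unfold argu, carg. change (Re (Im x, - Re x)) with 0. change (Im (Im x, - Re x)) with (- x).
      replace (Cmod (Im x, - Re x)) with (- x).
      - replace (- x / (0 + - x)) with 1 by (field; lra). rewrite atan_1. field.
      - transitivity (Cmod x); [rewrite Cmod_R, Rabs_left by auto; reflexivity|].
        unfold Cmod; simpl. f_equal. ring. }
    unfold pup. rewrite E, Cmod_R. apply C_ext; unfold Cexp, Re, Im; simpl; rewrite exp_0; ring.
  - destruct (Req_dec x 0) as [->|N].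
    + unfold pup. rewrite Cmod_0, Rabs_R0, spow_np by lra. apply C_ext; simpl; ring.
    + rewrite pup_eq, Cpw_R by (try apply slit_R; simpl; lra). rewrite Rabs_pos_eq, spow_pos by lra. reflexivity.
Qed.

(* Multiplying the boundary value by [exp (- i pi (m - 2n) / 2)] makes the real part of the
   integrand a positive multiple of [|s + p|^m] on both sides of [s = - p]. *)
Lemma Hp_real_neq_0 (n : nat) (m p : R) : 0 < m -> 2 * INR n - 1 < m < 2 * INR n + 1 -> Hp m p <> 0.
Proof.
  intros Pm Hm E. pose proof PI_RGT_0 as Ppi.
  set (th := PI * (m - 2 * INR n)).
  assert (Hth : - PI < th < PI) by (unfold th; split; nra).
  assert (Pc : 0 < cos (th / 2)) by (apply cos_gt_0; lra).
  destruct (Hpf_ok m (Rabs p + 1)) as (M & HM & O); [lra|pose proof (Rabs_pos p); lra|].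
  assert (O1 : okC M (Hpf m p)).
  { apply O; [lra| |simpl; lra]. rewrite Cmod_R. lra. }
  set (e := Cexp (0, - (th / 2))).
  assert (Ce : cos (m * PI) = cos th /\ sin (m * PI) = sin th).
  { replace (m * PI) with (th + 2 * INR n * PI) by (unfold th; ring). rewrite cos_period, sin_period. auto. }
  assert (R1 : forall s, Re (e * Hpf m p s)%C = Hw m s * spow m (Rabs (s + p)) * cos (th / 2)).
  { intros s. unfold Hpf. rewrite <- RtoC_plus, pup_real. unfold e. destruct (Rlt_dec (s + p) 0).
    - replace (Cexp (0, - (th / 2))%R * (Hw m s * (spow m (Rabs (s + p)) * Cexp (0, m * PI)%R)))%C
        with (Hw m s * spow m (Rabs (s + p)) * (Cexp (0, - (th / 2))%R * Cexp (0, m * PI)%R))%C by ring.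
      rewrite <- RtoC_mult, re_scal_l. f_equal. unfold Cexp, Re, Im; simpl.
      destruct Ce as [-> ->]. rewrite exp_0, cos_neg, sin_neg.
      replace (cos (th / 2)) with (cos (th - th / 2)) at 2 by (f_equal; field). rewrite cos_minus. ring.
    - rewrite <- RtoC_mult. rewrite re_scal_r. unfold Cexp, Re, Im; simpl. rewrite exp_0, cos_neg. ring. }
  assert (H_zero : CInt0oo (fun s => e * Hpf m p s)%C = 0).
  { rewrite (CInt0oo_scal M) by exact O1. change (CInt0oo (Hpf m p)) with (Hp m p). rewrite E. ring. }
  assert (P : 0 < RInt0oo (fun s => Re (e * Hpf m p s)%C)).
  { pose proof (Rabs_pos p) as Pp. pose proof (Rle_abs (- p)) as Q. rewrite Rabs_Ropp in Q.
    apply (RInt0oo_pos (Cmod e * M) _ (Rabs p + 1) (Rabs p + 2)); [| |lra|lra|].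
    - apply okC_Re. apply okC_scal, O1.
    - intros s Hs. rewrite R1. pose proof (Hw_ge0 m s). pose proof (spow_ge0 m (Rabs (s + p))).
      apply Rmult_le_pos; [apply Rmult_le_pos; auto|lra].
    - intros s Hs. rewrite R1. apply Rmult_lt_0_compat; [|exact Pc]. apply Rmult_lt_0_compat.
      + apply Hw_pos; lra.
      + rewrite Rabs_pos_eq, spow_pos by lra. apply exp_pos. }
  assert (K : Re (CInt0oo (fun s => e * Hpf m p s)%C) = 0) by (rewrite H_zero; reflexivity).
  change (RInt0oo (fun s => Re (e * Hpf m p s)%C) = 0) in K. lra.
Qed.

(** The boundary value at p is nonzero and [Hp] is continuous up to the boundary from above; the
    lower half-plane follows by conjugation. The point p may be negative, zero or positive. *)
Lemma near_real (n : nat) (m0 p : R) : 0 < m0 -> 2 * INR n - 1 < m0 < 2 * INR n + 1 ->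
  exists d, 0 < d /\ forall m w, Rabs (m - m0) < d -> Cmod (w - p)%C < d -> slit_plane w -> H m m w <> 0.
Proof.
  intros P0 Hm. pose proof (Hp_real_neq_0 n m0 p P0 Hm) as N. apply Cmod_gt_0 in N.
  destruct (Hp_cont m0 p P0 _ N) as (d & Hd & B).
  exists (Rmin d m0). split; [apply Rmin_pos; auto|]. intros m w H1 H2 Hs.
  pose proof (Rmin_l d m0) as Ml. pose proof (Rmin_r d m0) as Mr.
  assert (K : forall w, Cmod (w - p)%C < d -> slit_plane w -> 0 <= Im w -> H m m w <> 0).
  { clear w H2 Hs. intros w H2 Hs Hi E. specialize (B m w ltac:(lra) H2 Hi). rewrite Hp_eq in B by auto.
    rewrite E in B. replace (0 - Hp m0 p)%C with (- Hp m0 p)%C in B by ring. rewrite Cmod_opp in B. lra. }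
  apply Rabs_lt_between in H1.
  destruct (Rle_lt_dec 0 (Im w)) as [L|L]; [apply K; auto; lra|].
  intro E. apply (K (Cconj w)).
  - rewrite <- (Cconj_R p), <- Cconj_minus', Cmod_conj. lra.
  - apply slit_conj, Hs.
  - simpl. unfold Im in L. lra.
  - rewrite H_conj, E by (auto; lra). apply Cconj_R.
Qed.

(** * Behaviour at infinity *)
(** With v = 1 / w the integral of [Jf m v] is w^(-m) H_m (w). Thus v = 0 stands for infinity, where
    the value is the positive number Gamma (m + 1). *)
Definition Jf (m : R) (v : C) (s : R) : C := (Hw m s * Cpw m (1 + s * v))%C.

Lemma slit_1sv (v : C) (s : R) : slit_plane v \/ v = 0 -> 0 <= s -> slit_plane (1 + s * v)%C.
Proof.
  intros [[P|P]| ->] Hs.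
  - left. change (0 < 1 + (s * Re v - 0 * Im v)). nra.
  - destruct (Req_dec s 0) as [->|N].
    + left. unfold Re; simpl. lra.
    + right. change (0 + (s * Im v + 0 * Re v) <> 0). intro E. apply P. nra.
  - left. unfold Re; simpl. lra.
Qed.

Lemma Cpw_Re (a : R) (z : C) : Re (Cpw a z) = exp (a * ln (Cmod (Re z, Im z))) * cos (a * carg (Re z, Im z)).
Proof. rewrite pairC. unfold Cpw, Cexp, Clog, Re, Im; simpl. f_equal; f_equal; ring. Qed.
Lemma Cpw_Im (a : R) (z : C) : Im (Cpw a z) = exp (a * ln (Cmod (Re z, Im z))) * sin (a * carg (Re z, Im z)).
Proof. rewrite pairC. unfold Cpw, Cexp, Clog, Re, Im; simpl. f_equal; f_equal; ring. Qed.

Lemma cU_Jf {U : UniformSpace} (A X Y S : U -> R) (p : U) :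
  continuous A p -> continuous X p -> continuous Y p -> continuous S p -> 0 < A p ->
  slit_plane (1 + S p * (X p, Y p))%C ->
  continuous (fun q => Re (Jf (A q) (X q, Y q) (S q))) p /\
  continuous (fun q => Im (Jf (A q) (X q, Y q) (S q))) p.
Proof.
  intros HA HX HY HS PA Hs.
  assert (E : forall q, (1 + S q * (X q, Y q))%C = (1 + S q * X q, S q * Y q)).
  { intros q. apply C_ext; unfold Re, Im; simpl; ring. }
  rewrite E in Hs.
  assert (C0 : continuous (fun q => 1 + S q * X q) p) by (apply cU_plus; [apply cU_const|apply cU_mult; auto]).
  assert (C0' : continuous (fun q => S q * Y q) p) by (apply cU_mult; auto).
  assert (C1 : continuous (fun q => ln (Cmod (1 + S q * X q, S q * Y q))) p) by (apply cU_ln; [apply cU_Cmod; auto|apply slit_pos, Hs]).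
  assert (C2 : continuous (fun q => carg (1 + S q * X q, S q * Y q)) p) by (apply cU_carg; auto).
  pose proof (cU_Hw A S p HA HS PA) as C3.
  split.
  - apply (continuous_ext (fun q => Hw (A q) (S q) * (exp (A q * ln (Cmod (1 + S q * X q, S q * Y q))) * cos (A q * carg (1 + S q * X q, S q * Y q))))).
    + intros q. unfold Jf. rewrite re_scal_l, Cpw_Re, E. reflexivity.
    + apply cU_mult; auto. apply cU_mult; [apply cU_exp|apply cU_cos]; apply cU_mult; auto.
  - apply (continuous_ext (fun q => Hw (A q) (S q) * (exp (A q * ln (Cmod (1 + S q * X q, S q * Y q))) * sin (A q * carg (1 + S q * X q, S q * Y q))))).
    + intros q. unfold Jf. replace (Im (Hw (A q) (S q) * Cpw (A q) (1 + S q * (X q, Y q)))%C) with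
       (Hw (A q) (S q) * Im (Cpw (A q) (1 + S q * (X q, Y q)))) by (unfold Im; simpl; ring).
      rewrite Cpw_Im, E. reflexivity.
    + apply cU_mult; auto. apply cU_mult; [apply cU_exp|apply cU_sin]; apply cU_mult; auto.
Qed.

Lemma Jf_ok (A : R) : 0 < A -> exists M, 0 < M /\ forall a v, 0 < a <= A -> Cmod v <= 1 -> slit_plane v \/ v = 0 ->
  okC M (Jf a v).
Proof.
  intros HA. destruct (exp_ln_growth A ltac:(lra)) as (K & HK & G).
  destruct (Hw_dom A ltac:(lra)) as (M & HM & D).
  exists (M * K). split; [apply Rmult_lt_0_compat; auto|].
  intros a v Ha Hv Hsl s Hs. pose proof (slit_1sv v s Hsl Hs) as S1. split.
  - rewrite <- (pairC v).
    apply (cU_Jf (fun _ => a) (fun _ => Re v) (fun _ => Im v) (fun s => s)); try apply cU_const; try apply continuous_id; [lra|].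
    rewrite pairC. exact S1.
  - apply D; [exact Hs|lra|]. rewrite Cmod_Cpw.
    eapply Rle_trans; [|apply (G a s Hs); lra]. apply exp_le. apply Rmult_le_compat_l; [lra|].
    apply ln_le'; [apply slit_pos, S1|]. eapply Rle_trans; [apply Cmod_triangle|].
    rewrite Cmod_1, Cmod_mult, Cmod_R, Rabs_pos_eq by lra. pose proof (Cmod_ge_0 v). nra.
Qed.

Lemma Jf_near0 (m0 : R) : 0 < m0 -> exists d, 0 < d /\ forall m v, Rabs (m - m0) < d -> Cmod v < d -> slit_plane v ->
  CInt0oo (Jf m v) <> 0.
Proof.
  intros Hm.
  destruct (Jf_ok (2 * m0) ltac:(lra)) as (M & HM & O).
  assert (N : 0 < Cmod (CInt0oo (Jf m0 0))).
  { apply Cmod_gt_0. intro E.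
    assert (O0 : okC M (Jf m0 0)) by (apply O; [lra|rewrite Cmod_0; lra|auto]).
    assert (E1 : forall s, Jf m0 0 s = RtoC (Hw m0 s)).
    { intros s. unfold Jf. replace (1 + s * 0)%C with (RtoC 1) by ring.
      rewrite Cpw_R, ln_1, Rmult_0_r, exp_0 by lra. ring. }
    assert (P : 0 < RInt0oo (fun s => Re (Jf m0 0 s))).
    { apply (RInt0oo_pos M _ 0 1); [apply okC_Re, O0| |lra|lra|].
      - intros s Hs. rewrite E1. apply Hw_ge0.
      - intros s Hs. rewrite E1. apply Hw_pos. lra. }
    assert (K : Re (CInt0oo (Jf m0 0)) = 0) by (rewrite E; reflexivity).
    change (RInt0oo (fun s => Re (Jf m0 0 s)) = 0) in K. lra. }
  assert (K : locally ((m0, RtoC 0) : UC) (fun q : UC => (slit_plane (snd q) \/ snd q = RtoC 0) ->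
     Cmod (CInt0oo (Jf (fst q) (snd q)) - CInt0oo (Jf m0 0))%C < Cmod (CInt0oo (Jf m0 0)))).
  { apply (CInt0oo_param (U := UC) (fun q => slit_plane (snd q) \/ snd q = RtoC 0) (fun q => Jf (fst q) (snd q)) (m0, RtoC 0) M).
    - right. reflexivity.
    - apply (locally_UC' m0 0 (Rmin 1 m0)); [apply Rmin_pos; lra|].
      intros m w H1 H2 H3. pose proof (Rmin_l 1 m0) as Ml. pose proof (Rmin_r 1 m0) as Mr. simpl in *.
      apply Rabs_lt_between in H1. apply O; auto; [lra|].
      replace (w - 0)%C with w in H2 by ring. lra.
    - intros s Hs. destruct (cUC_w (V := R_UniformSpace) (m0, RtoC 0) s) as [W1 W2].
      pose proof (cUC_m (V := R_UniformSpace) (m0, RtoC 0) s) as W3.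
      pose proof (cUC_s (m0, RtoC 0) s) as W4.
      apply (cU_Jf (U := prod_UniformSpace UC R_UniformSpace) (fun q => fst (fst q))
        (fun q => Re (snd (fst q))) (fun q => Im (snd (fst q))) (fun q => snd q) ((m0, RtoC 0), s)); auto.
      simpl fst; simpl snd. rewrite pairC. apply slit_1sv; auto.
    - exact N. }
  destruct (locally_UC m0 0 _ K) as (d & Hd & B). exists d. split; auto. intros m v H1 H2 Hs E.
  specialize (B m v H1). replace (v - 0)%C with v in B by ring. specialize (B H2 (or_introl Hs)). simpl in B.
  rewrite E in B. replace (0 - CInt0oo (Jf m0 0))%C with (- CInt0oo (Jf m0 0))%C in B by ring. rewrite Cmod_opp in B. lra.
Qed.

Lemma slit_inv (w : C) : slit_plane w -> slit_plane (/ w)%C.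
Proof.
  intros Hs. pose proof (slit_neq_0 w Hs) as N.
  assert (P : 0 < Re w ^ 2 + Im w ^ 2).
  { destruct Hs as [Q|Q]; [nra|]. assert (0 < Im w * Im w) by nra. nra. }
  destruct Hs as [Q|Q]; [left|right].
  - change (0 < Re w / (Re w ^ 2 + Im w ^ 2)). apply Rdiv_lt_0_compat; auto.
  - change (- Im w / (Re w ^ 2 + Im w ^ 2) <> 0). intro E.
    apply Q. apply (Rmult_eq_compat_r (Re w ^ 2 + Im w ^ 2)) in E.
    unfold Rdiv in E. rewrite Rmult_assoc, Rinv_l in E by lra. lra.
Qed.

Lemma Cpw_factor (m s : R) (w : C) : slit_plane w -> 0 <= Im w -> 0 <= s ->
  Cpw m (s + w) = (Cpw m w * Cpw m (1 + s * / w))%C.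
Proof.
  intros Hs Hi Ps. pose proof (slit_neq_0 w Hs) as N.
  pose proof (slit_inv w Hs) as Si. pose proof (slit_1sv _ s (or_introl Si) Ps) as S1.
  pose proof (slit_shift w s Hs Ps) as S2.
  assert (E : Clog (s + w) = (Clog w + Clog (1 + s * / w))%C).
  { apply Cexp_inj.
    - rewrite Cexp_plus, !Cexp_Clog by auto. field. exact N.
    (* For Im w >= 0 the arguments of w and s + w lie in [0, pi) and that of 1 + s / w in (- pi, 0].
       The difference of the two sides therefore stays strictly between - 2 pi and 2 pi, and the
       logarithm is additive here. *)
    - change (- (2 * PI) < carg (s + w) - (carg w + carg (1 + s * / w)) < 2 * PI).
      pose proof (carg_ge0 w Hs Hi). pose proof (carg_bound w).
      assert (0 <= carg (s + w)) by (apply carg_ge0; auto; change (0 <= 0 + Im w); lra).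
      pose proof (carg_bound (s + w)%C). pose proof (carg_bound (1 + s * / w)%C).
      assert (carg (1 + s * / w) <= 0).
      { apply carg_le0; auto. change (0 + (s * (- Im w / (Re w ^ 2 + Im w ^ 2)) + 0 * Re (/ w)%C) <= 0).
        assert (P : 0 < Re w ^ 2 + Im w ^ 2).
        { destruct Hs as [Q|Q]; [nra|]. assert (0 < Im w * Im w) by nra. nra. }
        assert (0 <= Im w / (Re w ^ 2 + Im w ^ 2)) by (apply Rmult_le_pos; [auto|left; apply Rinv_0_lt_compat, P]).
        replace (- Im w / (Re w ^ 2 + Im w ^ 2)) with (- (Im w / (Re w ^ 2 + Im w ^ 2))) by (unfold Rdiv; ring). nra. }
      lra. }
  unfold Cpw. rewrite E, <- Cexp_plus. f_equal. ring.
Qed.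

(** The factorisation by w^m is valid in the closed upper half-plane, so the other points are
    handled by conjugation. The radius 2 / d makes |1 / w| at most d / 2. *)
Lemma near_inf (m0 : R) : 0 < m0 -> exists d R0, 0 < d /\ 0 < R0 /\
  forall m w, Rabs (m - m0) < d -> R0 <= Cmod w -> slit_plane w -> H m m w <> 0.
Proof.
  intros P0. destruct (Jf_near0 m0 P0) as (d1 & Hd1 & B1).
  set (d := Rmin d1 1). assert (Hd : 0 < d) by (apply Rmin_pos; lra).
  assert (D1 : d <= d1) by apply Rmin_l. assert (D2 : d <= 1) by apply Rmin_r.
  assert (B : forall m v, Rabs (m - m0) < d -> Cmod v < d -> slit_plane v -> CInt0oo (Jf m v) <> 0).
  { intros m v H1 H2. apply B1; lra. }
  exists (Rmin d m0), (2 / d). split; [apply Rmin_pos; auto|]. split; [apply Rdiv_lt_0_compat; lra|].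
  intros m w H1 H2 Hs. pose proof (Rmin_l d m0) as Ml. pose proof (Rmin_r d m0) as Mr.
  assert (Pm : 0 < m) by (apply Rabs_lt_between in H1; lra).
  assert (K : forall w, 2 / d <= Cmod w -> slit_plane w -> 0 <= Im w -> H m m w <> 0).
  { clear w H2 Hs. intros w H2 Hs Hi.
    assert (P2 : 0 < 2 / d) by (apply Rdiv_lt_0_compat; lra).
    pose proof (slit_neq_0 w Hs) as N.
    assert (Bi : Cmod (/ w)%C < d).
    { rewrite Cmod_inv by auto. apply Rle_lt_trans with (/ (2 / d)); [apply Rinv_le_contravar; auto|].
      replace (/ (2 / d)) with (d / 2) by (field; lra). lra. }
    pose proof (B m (/ w)%C ltac:(lra) Bi (slit_inv w Hs)) as NJ.
    assert (Bi1 : exists M, okC M (Jf m (/ w)%C)).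
    { destruct (Jf_ok m Pm) as (M & _ & O). exists M. apply O; [lra|lra|left; apply slit_inv, Hs]. }
    intro E. apply NJ. apply NNPP. intro NZ.
    assert (E2 : H m m w = (Cpw m w * CInt0oo (Jf m (/ w)%C))%C).
    { destruct Bi1 as [M O]. rewrite <- (CInt0oo_scal M) by exact O. apply CInt0oo_ext. intros s Ps.
      unfold Hf, Jf. rewrite Cpw_factor by (auto; lra). ring. }
    rewrite E2 in E. revert E. apply Cmult_neq_0; auto. apply Cpw_neq_0. }
  destruct (Rle_lt_dec 0 (Im w)) as [L|L]; [apply K; auto|].
  intro E. apply (K (Cconj w)).
  - rewrite Cmod_conj. auto.
  - apply slit_conj, Hs.
  - simpl. unfold Im in L. lra.
  - rewrite H_conj, E by auto. apply Cconj_R.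
Qed.

(* At a double zero the solution of the second-order equation would vanish along the whole
   horizontal ray from [w], contradicting [near_inf]. *)
Lemma H_simple (m : R) (w : C) : Im w <> 0 -> 1 < m -> H m m w = 0 -> H m (m - 1) w <> 0.
Proof.
  intros Hi Hm E0 E1.
  destruct (near_inf m ltac:(lra)) as (d & R0 & Hd & HR0 & B).
  (* A positive real step: the segment keeps the height Im w, hence stays off the cut, and its
     endpoint has modulus at least R0. *)
  set (h := RtoC (R0 + Cmod w)). set (c := Rabs (Im w)).
  pose proof (Cmod_ge_0 w) as W0. assert (Hc : 0 < c) by apply (Rabs_pos_lt _ Hi).
  assert (Hh : Cmod h = R0 + Cmod w) by (unfold h; rewrite Cmod_R, Rabs_pos_eq; lra).
  assert (It : forall t : R, Im (w + t * h)%C = Im w) by (intros t; unfold h, Im; simpl; ring).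
  assert (Sg : forall t : R, slit_plane (w + t * h)%C) by (intros t; right; rewrite It; exact Hi).
  assert (Hcb : forall t : R, c <= Cmod (w + t * h)%C).
  { intros t. unfold c. rewrite <- (It t). apply Im_le_Cmod. }
  set (L := Cmod w + Cmod h).
  assert (LB : forall t : R, 0 <= t <= 1 -> Cmod (w + t * h)%C <= L).
  { intros t Ht. eapply Rle_trans; [apply Cmod_triangle|]. rewrite Cmod_mult, Cmod_R, Rabs_pos_eq by lra.
    unfold L. pose proof (Cmod_ge_0 h). nra. }
  assert (Sh : slit_plane (w + h)%C) by (replace (w + h)%C with (w + 1%R * h)%C by ring; apply Sg).
  apply (B m (w + h)%C); [rewrite Rminus_diag, Rabs_R0; auto| |exact Sh|].
  { pose proof (Cmod_minus_ge h (- w)%C) as K. rewrite Cmod_opp in K.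
    replace (h - - w)%C with (w + h)%C in K by ring. lra. }
  apply (ode_unique (H m m) (fun z => m * H m (m - 1) z)%C (fun z => m * ((m - 1)%R * H m (m - 1 - 1) z))%C
    w h (fun z => (z + 2 * m) / z)%C (fun z => - (m / z))%C (((L + 2 * m) + m) / c)).
  - intros t Ht. apply Cder_H; [apply Sg|lra].
  - intros t Ht. apply Cder_scal, Cder_H; [apply Sg|lra].
  - intros t Ht. pose proof (Sg t) as S. set (z := (w + t * h)%C) in *.
    pose proof (H_ode m z S ltac:(lra)) as O. pose proof (slit_neq_0 z S) as z0.
    assert (O' : (z * ((m - 1)%R * H m (m - 1 - 1) z))%C = ((z + 2 * m) * H m (m - 1) z - H m m z)%C).
    { replace (z * ((m - 1)%R * H m (m - 1 - 1) z))%C with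
        (z * ((m - 1)%R * H m (m - 1 - 1) z) - (z + 2 * m) * H m (m - 1) z + H m m z + ((z + 2 * m) * H m (m - 1) z - H m m z))%C by ring.
      rewrite O. ring. }
    replace (m * ((m - 1)%R * H m (m - 1 - 1) z))%C with (m * (z * ((m - 1)%R * H m (m - 1 - 1) z)) / z)%C by (field; auto).
    rewrite O'. field; auto.
  - intros t Ht. pose proof (Sg t) as S. set (z := (w + t * h)%C) in *.
    pose proof (slit_neq_0 z S) as z0. specialize (Hcb t). specialize (LB t Ht). fold z in Hcb, LB.
    assert (IC : / Cmod z <= / c) by (apply Rinv_le_contravar; auto).
    assert (IP : 0 < / Cmod z) by (apply Rinv_0_lt_compat; lra).
    split.
    + rewrite Cmod_div by auto. unfold Rdiv. apply Rmult_le_compat; [apply Cmod_ge_0|lra| |auto].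
      eapply Rle_trans; [apply Cmod_triangle|]. rewrite Cmod_mult, !Cmod_R, !Rabs_pos_eq by lra. lra.
    + rewrite Cmod_opp, Cmod_div by auto. unfold Rdiv. apply Rmult_le_compat; [apply Cmod_ge_0|lra| |auto].
      rewrite Cmod_R, Rabs_pos_eq by lra. pose proof (Cmod_ge_0 z). lra.
  - exact E0.
  - cbv beta. rewrite E1. ring.
Qed.

(** * Counting zeros *)

Definition H_zero (m : R) (w : C) : Prop := slit_plane w /\ H m m w = 0.

Lemma H_zero_nonreal (m : R) (w : C) : 0 < m -> H_zero m w -> Im w <> 0.
Proof.
  intros Hm [Hs E] I0. destruct Hs as [P|P]; [|contradiction].
  apply (H_pos m (Re w) Hm P). rewrite <- E. f_equal. apply C_ext; [reflexivity|symmetry; exact I0].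
Qed.

(** The intervals u k +/- 4/3 * A / 4^k are nested, 4/3 being the sum of the geometric series, and
    the limit is the supremum of their left ends. *)
Lemma geom_lim (u : nat -> R) (A : R) : (forall k, Rabs (u (S k) - u k) <= A / 4 ^ k) ->
  exists l, forall k, Rabs (u k - l) <= 4 / 3 * (A / 4 ^ k).
Proof.
  intros Hu.
  assert (P4 : forall k, 0 < 4 ^ k) by (intros; apply pow_lt; lra).
  assert (A0 : 0 <= A).
  { specialize (Hu O). simpl in Hu. rewrite Rdiv_1_r in Hu. eapply Rle_trans; [apply Rabs_pos|exact Hu]. }
  assert (E4 : forall k, A / 4 ^ (S k) = A / 4 ^ k / 4) by (intros k; simpl; field; apply Rgt_not_eq, P4).
  assert (Q : forall k, 0 <= A / 4 ^ k) by (intros k; apply Rmult_le_pos; [auto|left; apply Rinv_0_lt_compat, P4]).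
  assert (Up : forall j k, u (k + j)%nat - 4 / 3 * (A / 4 ^ (k + j)) >= u k - 4 / 3 * (A / 4 ^ k) /\
                           u (k + j)%nat + 4 / 3 * (A / 4 ^ (k + j)) <= u k + 4 / 3 * (A / 4 ^ k)).
  { induction j as [|j IH]; intros k; [rewrite Nat.add_0_r; lra|].
    rewrite Nat.add_succ_r, E4. specialize (IH k). specialize (Hu (k + j)%nat).
    apply Rabs_le_between in Hu. lra. }
  assert (Cr : forall i k, u i - 4 / 3 * (A / 4 ^ i) <= u k + 4 / 3 * (A / 4 ^ k)).
  { intros i k. destruct (Nat.le_ge_cases i k) as [L|L].
    - pose proof (Up (k - i)%nat i) as K. replace (i + (k - i))%nat with k in K by lia. pose proof (Q k). lra.
    - pose proof (Up (i - k)%nat k) as K. replace (k + (i - k))%nat with i in K by lia. pose proof (Q i). lra. }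
  destruct (completeness (fun x => exists k, x = u k - 4 / 3 * (A / 4 ^ k))) as [l [L1 L2]].
  - exists (u O + 4 / 3 * (A / 4 ^ 0)). intros x [k ->]. apply Cr.
  - exists (u O - 4 / 3 * (A / 4 ^ 0)). exists O; auto.
  - exists l. intros k. apply Rabs_le.
    assert (u k - 4 / 3 * (A / 4 ^ k) <= l) by (apply L1; exists k; auto).
    assert (l <= u k + 4 / 3 * (A / 4 ^ k)) by (apply L2; intros x [i ->]; apply Cr). lra.
Qed.

Lemma Cgeom_lim (u : nat -> C) (A : R) : (forall k, Cmod (u (S k) - u k)%C <= A / 4 ^ k) ->
  exists l, forall k, Cmod (u k - l)%C <= 8 / 3 * (A / 4 ^ k).
Proof.
  intros Hu.
  destruct (geom_lim (fun k => Re (u k)) A) as [x Hx].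
  { intros k. eapply Rle_trans; [apply (re_le_Cmod (u (S k) - u k)%C)|apply Hu]. }
  destruct (geom_lim (fun k => Im (u k)) A) as [y Hy].
  { intros k. eapply Rle_trans; [apply (Im_le_Cmod (u (S k) - u k)%C)|apply Hu]. }
  exists (x, y). intros k. eapply Rle_trans; [apply Cmod_le_abs|]. specialize (Hx k). specialize (Hy k).
  change (Rabs (Re (u k) - x) + Rabs (Im (u k) - y) <= 8 / 3 * (A / 4 ^ k)). lra.
Qed.

Lemma contraction_fix (T : C -> C) (p : C) (r : R) : 0 < r ->
  (forall w w', Cmod (w - p)%C < r -> Cmod (w' - p)%C < r -> Cmod (T w - T w')%C <= Cmod (w - w')%C / 4) ->
  Cmod (T p - p)%C <= r / 4 -> exists w, Cmod (w - p)%C < r /\ T w = w.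
Proof.
  intros Hr HT H0.
  set (u := fix u (k : nat) : C := match k with O => p | S k => T (u k) end).
  assert (P4 : forall k, 0 < 4 ^ k) by (intros; apply pow_lt; lra).
  (* The first step is at most r / 4 and later ones shrink by 4, so the iterates stay within r / 3
     of p, safely inside the disc where T contracts. *)
  assert (B : forall k, Cmod (u (S k) - u k)%C <= r / 4 / 4 ^ k /\ Cmod (u k - p)%C <= r / 3 * (1 - / 4 ^ k)).
  { induction k as [|k [I1 I2]].
    - simpl. split; [lra|]. replace (p - p)%C with (RtoC 0) by ring. rewrite Cmod_0. lra.
    - assert (Pk : 0 < / 4 ^ k) by (apply Rinv_0_lt_compat, P4).
      assert (Ek : / 4 ^ (S k) = / 4 ^ k / 4) by (simpl; field; apply Rgt_not_eq, P4).
      assert (I3 : Cmod (u (S k) - p)%C <= r / 3 * (1 - / 4 ^ (S k))).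
      { replace (u (S k) - p)%C with ((u (S k) - u k) + (u k - p))%C by ring.
        eapply Rle_trans; [apply Cmod_triangle|]. rewrite Ek. unfold Rdiv in I1 at 1. nra. }
      split; [|exact I3].
      change (u (S (S k))) with (T (u (S k))). change (u (S k)) with (T (u k)) at 2.
      eapply Rle_trans; [apply HT|].
      + eapply Rle_lt_trans; [apply I3|]. rewrite Ek. nra.
      + eapply Rle_lt_trans; [apply I2|]. nra.
      + unfold Rdiv. rewrite Ek. unfold Rdiv. unfold Rdiv in I1. nra. }
  destruct (Cgeom_lim u (r / 4)) as [l Hl]; [intros k; apply B|].
  assert (Pl : Cmod (l - p)%C < r).
  { specialize (Hl O). simpl in Hl. rewrite <- Cmod_opp. replace (- (l - p))%C with (p - l)%C by ring. lra. }
  exists l. split; auto.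
  assert (K : Cmod (T l - l)%C = 0).
  { apply Rle_antisym; [|apply Cmod_ge_0]. apply Rnot_lt_le. intro P.
    set (c := Cmod (T l - l)%C) in *.
    destruct (pow_lt_1_zero (/ 4) ltac:(rewrite Rabs_pos_eq by lra; lra) (c / (2 * r))) as [k Hk].
    { apply Rdiv_lt_0_compat; lra. }
    specialize (Hk k (le_n k)). rewrite Rabs_pos_eq, pow_inv in Hk by (apply pow_le; lra).
    apply Rlt_div_r in Hk; [|lra].
    assert (Pk : 0 < / 4 ^ k) by (apply Rinv_0_lt_compat, P4).
    assert (Ek : / 4 ^ (S k) = / 4 ^ k / 4) by (simpl; field; apply Rgt_not_eq, P4).
    assert (K1 : Cmod (T l - T (u k))%C <= Cmod (l - u k)%C / 4).
    { apply HT; auto. eapply Rle_lt_trans; [apply B|]. nra. }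
    assert (K2 : Cmod (l - u k)%C <= 8 / 3 * (r / 4 / 4 ^ k)).
    { rewrite <- Cmod_opp. replace (- (l - u k))%C with (u k - l)%C by ring. apply Hl. }
    assert (K3 : Cmod (T (u k) - l)%C <= 8 / 3 * (r / 4 / 4 ^ (S k))) by apply (Hl (S k)).
    assert (K4 : c <= Cmod (T l - T (u k))%C + Cmod (T (u k) - l)%C).
    { unfold c. replace (T l - l)%C with ((T l - T (u k)) + (T (u k) - l))%C by ring. apply Cmod_triangle. }
    unfold Rdiv in K2, K3. rewrite Ek in K3. nra. }
  apply Cmod_eq_0 in K. replace (T l) with (T l - l + l)%C by ring. rewrite K. ring.
Qed.

(* [w - H m m w / D], with [D] the derivative of [H m0 m0] at [p], is a contraction near [p]. *)
Lemma persist (m0 : R) (p : C) : 1 < m0 -> H_zero m0 p -> exists r, 0 < r /\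
  (forall m w w', Rabs (m - m0) < r -> Cmod (w - p)%C < r -> Cmod (w' - p)%C < r -> H_zero m w -> H_zero m w' -> w = w') /\
  (forall e, 0 < e -> exists d, 0 < d /\ forall m, Rabs (m - m0) < d -> exists w, Cmod (w - p)%C < e /\ H_zero m w).
Proof.
  intros Hm HZp. pose proof (H_zero_nonreal m0 p ltac:(lra) HZp) as Np. destruct HZp as [Sp Ep].
  set (D := (m0 * H m0 (m0 - 1) p)%C).
  assert (m0C : RtoC m0 <> 0) by (intro E; apply RtoC_inj in E; lra).
  assert (ND : D <> 0) by (apply Cmult_neq_0; auto; apply H_simple; auto).
  pose proof (proj1 (Cmod_gt_0 D) ND) as PD.
  set (h0 := H m0 (m0 - 1) p) in *.
  pose proof (Cmod_ge_0 h0) as Ph.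
  (* The difference of m * H m (m - 1) w and D splits into m (h - h0) and (m - m0) h0, each to be at
     most |D| / 16; here |m| <= 2 m0. This gives 1/8 relative to D, and the factor 2 of
     [Cmean_value] turns it into the contraction constant 1/4. *)
  set (e1 := Cmod D / (16 * (2 * m0))).
  assert (Pe1 : 0 < e1) by (apply Rdiv_lt_0_compat; lra).
  destruct (H_cont (-1) m0 p Sp ltac:(lra) e1 Pe1) as (d1 & Hd1 & B1).
  destruct (slit_away p Sp) as (c & Hc & HS).
  set (r := Rmin (Rmin d1 c) (Rmin (m0 - 1) (Cmod D / (16 * (1 + Cmod h0))))).
  assert (Pr : 0 < r).
  { unfold r. repeat apply Rmin_pos; try lra. apply Rdiv_lt_0_compat; lra. }
  assert (r1 : r <= d1) by (eapply Rle_trans; [apply Rmin_l|apply Rmin_l]).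
  assert (r2 : r <= c) by (eapply Rle_trans; [apply Rmin_l|apply Rmin_r]).
  assert (r3 : r <= m0 - 1) by (eapply Rle_trans; [apply Rmin_r|apply Rmin_l]).
  assert (r4 : r <= Cmod D / (16 * (1 + Cmod h0))) by (eapply Rle_trans; [apply Rmin_r|apply Rmin_r]).
  assert (Sl : forall w, Cmod (w - p)%C < r -> slit_plane w) by (intros w Hw; apply (HS w 0); lra).
  assert (G : forall m w, Rabs (m - m0) < r -> Cmod (w - p)%C < r ->
     Cmod (1 - (m * H m (m - 1) w) / D)%C <= 1 / 8).
  { intros m w H1 H2. specialize (B1 m w ltac:(lra) ltac:(lra)).
    change (m + -1) with (m - 1) in B1. change (m0 + -1) with (m0 - 1) in B1. fold h0 in B1.
    set (h := H m (m - 1) w) in *.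
    assert (Bm : Rabs m <= 2 * m0) by (apply Rabs_lt_between in H1; apply Rabs_le; lra).
    replace (1 - m * h / D)%C with (- (m * (h - h0) + (m - m0)%R * h0) / D)%C.
    2:{ rewrite RtoC_minus. unfold D. field. split; auto. intro E. apply ND. unfold D. rewrite E. ring. }
    rewrite Cmod_div, Cmod_opp by auto.
    apply Rmult_le_reg_r with (Cmod D); auto. unfold Rdiv at 1. rewrite Rmult_assoc, Rinv_l, Rmult_1_r by lra.
    eapply Rle_trans; [apply Cmod_triangle|]. rewrite !Cmod_mult, !Cmod_R.
    assert (X1 : Rabs m * Cmod (h - h0)%C <= (2 * m0) * e1) by (apply Rmult_le_compat; try apply Rabs_pos; try apply Cmod_ge_0; lra).
    assert (X2 : (2 * m0) * e1 = Cmod D / 16) by (unfold e1; field; lra).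
    assert (X3 : Rabs (m - m0) * Cmod h0 <= Cmod D / 16).
    { apply Rle_trans with (Cmod D / (16 * (1 + Cmod h0)) * (1 + Cmod h0)).
      - apply Rmult_le_compat; try apply Rabs_pos; lra.
      - right. field. lra. }
    lra. }
  set (T := fun m w => (w - H m m w / D)%C).
  assert (CT : forall m w w', Rabs (m - m0) < r -> Cmod (w - p)%C < r -> Cmod (w' - p)%C < r ->
     Cmod (T m w - T m w')%C <= Cmod (w - w')%C / 4).
  { intros m w w' H1 H2 H3.
    assert (Sg : forall t : R, 0 <= t <= 1 -> Cmod (w' + t * (w - w') - p)%C < r).
    { intros t Ht. replace (w' + t * (w - w') - p)%C with ((1 - t)%R * (w' - p) + t * (w - p))%C by (rewrite RtoC_minus; ring).
      eapply Rle_lt_trans; [apply Cmod_triangle|]. rewrite !Cmod_mult, !Cmod_R, !Rabs_pos_eq by lra.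
      destruct (Req_dec t 0) as [->|N0]; [lra|].
      assert (t * Cmod (w - p)%C < t * r) by (apply Rmult_lt_compat_l; lra).
      assert ((1 - t) * Cmod (w' - p)%C <= (1 - t) * r) by (apply Rmult_le_compat_l; lra). lra. }
    pose proof (Cmean_value (T m) (fun w => 1 - (m * H m (m - 1) w) / D)%C w' (w - w')%C (1 / 8)) as K.
    replace (w' + (w - w'))%C with w in K by ring.
    replace (Cmod (w - w')%C / 4) with (2 * (1 / 8) * Cmod (w - w')%C) by field. apply K.
    - intros t Ht. unfold T. apply Cder_minus; [apply Cder_id|].
      eapply Cder_eq; [apply Cder_mult; [apply Cder_H; [apply Sl, Sg, Ht|apply Rabs_lt_between in H1; lra]|apply Cder_const]|].
      cbv beta. unfold Cdiv. ring.
    - intros t Ht. apply G; auto. }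
  exists r. split; [auto|]. split.
  - intros m w w' H1 H2 H3 [_ Z1] [_ Z2].
    pose proof (CT m w w' H1 H2 H3) as K. unfold T in K. rewrite Z1, Z2 in K.
    replace (w - 0 / D - (w' - 0 / D))%C with (w - w')%C in K by ring.
    assert (K0 : Cmod (w - w')%C = 0) by (pose proof (Cmod_ge_0 (w - w')%C); lra).
    apply Cmod_eq_0 in K0. replace w with (w - w' + w')%C by ring. rewrite K0. ring.
  - intros e He. set (e' := Rmin e r). assert (Pe' : 0 < e') by (apply Rmin_pos; auto).
    assert (E1 : e' <= e) by apply Rmin_l. assert (E2 : e' <= r) by apply Rmin_r.
    destruct (H_cont 0 m0 p Sp ltac:(lra) (Cmod D * (e' / 4))) as (d2 & Hd2 & B2).
    { apply Rmult_lt_0_compat; lra. }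
    exists (Rmin d2 r). split; [apply Rmin_pos; auto|]. intros m H1.
    pose proof (Rmin_l d2 r) as M1. pose proof (Rmin_r d2 r) as M2.
    assert (Zp : Cmod (p - p)%C = 0) by (replace (p - p)%C with (RtoC 0) by ring; apply Cmod_0).
    specialize (B2 m p ltac:(lra) ltac:(lra)). rewrite !Rplus_0_r, Ep in B2.
    replace (H m m p - 0)%C with (H m m p) in B2 by ring.
    (* The centre p is moved by H m m p / D only, which is small for m near m0 because p is a zero
       at m0. *)
    destruct (contraction_fix (T m) p e' Pe') as (w & Hw & Ew).
    + intros w w' H2 H3. apply CT; lra.
    + unfold T. replace (p - H m m p / D - p)%C with (- (H m m p / D))%C by ring.
      rewrite Cmod_opp, Cmod_div by auto. apply Rmult_le_reg_r with (Cmod D); auto.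
      unfold Rdiv at 1. rewrite Rmult_assoc, Rinv_l by lra. lra.
    + exists w. split; [lra|]. split; [apply Sl; lra|].
      unfold T in Ew.
      replace (H m m w) with ((w - (w - H m m w / D)) * D)%C by (field; auto). rewrite Ew. ring.
Qed.

(** One radius serves all m near m0, which suits a covering argument. Real points are settled by
    [near_real], non-real zeros by [persist], other points by continuity. *)
Lemma zero_isolation (n : nat) (m0 : R) (p : C) : 1 < m0 -> 2 * INR n - 1 < m0 < 2 * INR n + 1 ->
  exists d, 0 < d /\ ((H_zero m0 p /\ forall m w w', Rabs (m - m0) < d -> Cmod (w - p)%C < d -> Cmod (w' - p)%C < d -> H_zero m w -> H_zero m w' -> w = w')
    \/ (forall m w, Rabs (m - m0) < d -> Cmod (w - p)%C < d -> ~ H_zero m w)).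
Proof.
  intros Hm Hn. destruct (Req_dec (Im p) 0) as [I0|I0].
  - assert (Ep : p = RtoC (Re p)) by (apply C_ext; [reflexivity|exact I0]).
    destruct (near_real n m0 (Re p) ltac:(lra) Hn) as (d & Hd & B). exists d. split; auto. right.
    intros m w H1 H2 [Hs E]. rewrite Ep in H2. exact (B m w H1 H2 Hs E).
  - assert (Sp : slit_plane p) by (right; exact I0).
    destruct (classic (H m0 m0 p = 0)) as [E|N].
    + destruct (persist m0 p Hm (conj Sp E)) as (r & Hr & U & _). exists r. split; auto. left. split; auto. split; auto.
    + apply Cmod_gt_0 in N. destruct (H_cont 0 m0 p Sp ltac:(lra) _ N) as (d & Hd & B).
      exists d. split; auto. right. intros m w H1 H2 [_ E]. specialize (B m w H1 H2).
      rewrite !Rplus_0_r, E in B. replace (0 - H m0 m0 p)%C with (- H m0 m0 p)%C in B by ring.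
      rewrite Cmod_opp in B. lra.
Qed.

Definition enumZ (m : R) (l : list C) : Prop := NoDup l /\ forall w, H_zero m w <-> In w l.

Lemma list_min {A : Type} (d : A -> R) (l : list A) : (forall a, In a l -> 0 < d a) ->
  exists e, 0 < e /\ forall a, In a l -> e <= d a.
Proof.
  induction l as [|a l IH]; intros Hd.
  - exists 1. split; [lra|]. intros a [].
  - destruct IH as (e & He & B); [intros; apply Hd; right; auto|].
    exists (Rmin e (d a)). split; [apply Rmin_pos; auto; apply Hd; left; auto|].
    intros b [<-|Hb]; [apply Rmin_r|]. eapply Rle_trans; [apply Rmin_l|auto].
Qed.

Lemma list_sep (l : list C) : exists s, 0 < s /\ forall a b, In a l -> In b l -> a <> b -> 2 * s <= Cmod (a - b)%C.
Proof.
  assert (K : exists s, 0 < s /\ forall q : C * C, In q (list_prod l l) -> s <= (if excluded_middle_informative (fst q = snd q) then 1 else Cmod (fst q - snd q)%C)).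
  { apply list_min. intros [a b] _. simpl. destruct (excluded_middle_informative (a = b)) as [|N]; [lra|].
    apply Cmod_gt_0. intro E. apply N. replace a with (a - b + b)%C by ring. rewrite E. ring. }
  destruct K as (s & Hs & B). exists (s / 2). split; [lra|]. intros a b Ha Hb N.
  specialize (B (a, b) (in_prod l l a b Ha Hb)). simpl in B.
  destruct (excluded_middle_informative (a = b)); [contradiction|]. lra.
Qed.

(** Each zero moves by less than half the separation of the list, so the continued zeros remain
    distinct. *)
Lemma persist_list (m0 : R) (l : list C) : 1 < m0 -> NoDup l -> (forall p, In p l -> H_zero m0 p) ->
  forall e, 0 < e -> exists d, 0 < d /\ forall m, Rabs (m - m0) < d ->
    exists f : C -> C, (forall p, In p l -> Cmod (f p - p)%C < e /\ H_zero m (f p)) /\ NoDup (map f l).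
Proof.
  intros Hm ND HZ e He.
  destruct (list_sep l) as (s & Hs & Sep).
  set (e' := Rmin e s). assert (Pe' : 0 < e') by (apply Rmin_pos; auto).
  assert (E1 : e' <= e) by apply Rmin_l. assert (E2 : e' <= s) by apply Rmin_r.
  assert (K : forall p, exists d, In p l -> 0 < d /\ forall m, Rabs (m - m0) < d -> exists w, Cmod (w - p)%C < e' /\ H_zero m w).
  { intros p. destruct (classic (In p l)) as [I|N]; [|exists 0; contradiction].
    destruct (persist m0 p Hm (HZ p I)) as (r & Hr & _ & Ex). destruct (Ex e' Pe') as (d & Hd & B). exists d. auto. }
  destruct (choice _ K) as [dd Hdd].
  destruct (list_min dd l) as (d & Hd & Bd); [intros p Hp; apply Hdd, Hp|].
  exists d. split; auto. intros m H1.
  assert (K2 : forall p, exists w, In p l -> Cmod (w - p)%C < e' /\ H_zero m w).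
  { intros p. destruct (classic (In p l)) as [I|N]; [|exists 0; contradiction].
    destruct (Hdd p I) as [_ B]. specialize (Bd p I). destruct (B m ltac:(lra)) as [w Hw]. exists w. auto. }
  destruct (choice _ K2) as [f Hf]. exists f. split.
  - intros p Hp. destruct (Hf p Hp). split; auto. lra.
  - apply Injective_map_NoDup_in; auto. intros a b Ha Hb E. apply NNPP. intro N.
    specialize (Sep a b Ha Hb N). destruct (Hf a Ha) as [A1 _]. destruct (Hf b Hb) as [A2 _].
    assert (Cmod (a - b)%C <= Cmod (f a - a)%C + Cmod (f b - b)%C).
    { replace (a - b)%C with (- (f a - a) + (f b - b))%C by (rewrite E; ring).
      eapply Rle_trans; [apply Cmod_triangle|]. rewrite Cmod_opp. lra. }
    lra.
Qed.

(** Finitely many isolation discs cover the disc outside which [near_inf] forbids zeros. Each disc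
    around a zero at m0 carries exactly one continued zero, the others none, so the continued list
    is complete. *)
Lemma local_count (n : nat) (m0 : R) : 1 < m0 -> 2 * INR n - 1 < m0 < 2 * INR n + 1 ->
  exists d k, 0 < d /\ forall m, Rabs (m - m0) < d -> exists l, enumZ m l /\ length l = k.
Proof.
  intros Hm Hn.
  destruct (near_inf m0 ltac:(lra)) as (d1 & R0 & Hd1 & HR0 & Binf).
  assert (K : forall p : C, exists d, 0 < d /\
   ((H_zero m0 p /\ forall m w w', Rabs (m - m0) < d -> Cmod (w - p)%C < d -> Cmod (w' - p)%C < d -> H_zero m w -> H_zero m w' -> w = w')
    \/ (forall m w, Rabs (m - m0) < d -> Cmod (w - p)%C < d -> ~ H_zero m w))) by (intros p; apply (zero_isolation n); auto).
  destruct (choice _ K) as [dd Hdd]. clear K.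
  assert (Pdd : forall p : C, 0 < dd p / 2) by (intros p; destruct (Hdd p); lra).
  apply NNPP. intro NN.
  (* The cover consists of squares: coordinates within [dd p / 2] of the centre put the point within
     [dd p] of it. *)
  apply (compactness_list 2 (- R0, (- R0, tt)) (R0, (R0, tt)) (fun t => mkposreal _ (Pdd (fst t, fst (snd t))))).
  intros [lt Hl]. apply NN. clear NN.
  set (pt := fun t : Compactness.Tn 2 R => (fst t, fst (snd t)) : C).
  set (cs := map pt lt).
  assert (Cov : forall w, Cmod w <= R0 -> exists p, In p cs /\ Cmod (w - p)%C < dd p).
  { intros w Hw. destruct (Hl (Re w, (Im w, tt))) as (t & It & _ & Ct).
    - pose proof (re_le_Cmod w) as A1. pose proof (Im_le_Cmod w) as A2.
      apply Rabs_le_between in A1. apply Rabs_le_between in A2. simpl. repeat split; lra.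
    - exists (pt t). split; [apply in_map, It|]. destruct t as [x [y []]]. unfold pt. simpl fst; simpl snd in *.
      destruct Ct as (C1 & C2 & _). simpl in C1, C2.
      eapply Rle_lt_trans; [apply Cmod_le_abs|].
      change (Rabs (Re w - x) + Rabs (Im w - y) < dd (x, y)). lra. }
  clear Hl.
  (* Centres that are zeros at m0; the isolation disc of any other centre contains no zero for
     nearby m. *)
  set (zl := nodup (fun a b : C => excluded_middle_informative (a = b))
     (filter (fun p => if excluded_middle_informative (H_zero m0 p) then true else false) cs)).
  assert (Izl : forall p, In p zl <-> In p cs /\ H_zero m0 p).
  { intros p. unfold zl. rewrite nodup_In, filter_In. destruct (excluded_middle_informative (H_zero m0 p)); intuition discriminate. }
  assert (NDz : NoDup zl) by apply NoDup_nodup.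
  destruct (list_min dd cs) as (d2 & Hd2 & Bd2); [intros p _; apply Hdd|].
  destruct (persist_list m0 zl Hm NDz ltac:(intros p Hp; apply Izl, Hp) d2 Hd2) as (d3 & Hd3 & B3).
  exists (Rmin (Rmin d1 d2) d3), (length zl). split; [repeat apply Rmin_pos; auto|].
  intros m H1.
  assert (q1 : Rabs (m - m0) < d1) by (eapply Rlt_le_trans; [apply H1|]; eapply Rle_trans; [apply Rmin_l|apply Rmin_l]).
  assert (q2 : Rabs (m - m0) < d2) by (eapply Rlt_le_trans; [apply H1|]; eapply Rle_trans; [apply Rmin_l|apply Rmin_r]).
  assert (q3 : Rabs (m - m0) < d3) by (eapply Rlt_le_trans; [apply H1|]; apply Rmin_r).
  destruct (B3 m q3) as (f & Hf & NDf).
  exists (map f zl). split; [|apply length_map]. split; auto.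
  intros w. split.
  - intros Hw.
    assert (Wb : Cmod w <= R0).
    { apply Rnot_lt_le. intro L. destruct Hw as [S E]. apply (Binf m w); auto; lra. }
    destruct (Cov w Wb) as (p & Ip & Cp).
    pose proof (Bd2 p Ip) as Bp. destruct (Hdd p) as [_ [[Zp U]|B]].
    + assert (Iz : In p zl) by (apply Izl; auto).
      destruct (Hf p Iz) as [F1 F2].
      rewrite (U m w (f p)); auto; try lra. apply in_map, Iz.
    + exfalso. apply (B m w); auto. lra.
  - intros Hi. apply in_map_iff in Hi. destruct Hi as (p & <- & Ip). apply Hf, Ip.
Qed.

(** Connectedness of the interval through calculus: the indicator function of Q is locally constant,
    so its derivative is 0 and the mean value theorem makes it constant. *)
Lemma locally_const_pred (Q : R -> Prop) (a b : R) :
  (forall m, a < m < b -> exists d, 0 < d /\ ((forall m', Rabs (m' - m) < d -> Q m') \/ (forall m', Rabs (m' - m) < d -> ~ Q m'))) ->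
  forall x y, a < x < b -> a < y < b -> Q x -> Q y.
Proof.
  intros HQ x y Hx Hy Qx.
  set (g := fun m => if excluded_middle_informative (Q m) then 1 else 0).
  assert (D : forall m, a < m < b -> is_derive g m 0).
  { intros m Hm. destruct (HQ m Hm) as (d & Hd & B).
    apply (is_derive_ext_loc (fun _ => g m)).
    - exists (mkposreal d Hd). intros m' Hm'. change (Rabs (m' - m) < d) in Hm'.
      assert (H : Rabs (m - m) < d) by (rewrite Rminus_diag, Rabs_R0; auto).
      unfold g. destruct B as [B|B]; pose proof (B m' Hm') as Q1; pose proof (B m H) as Q2;
        destruct (excluded_middle_informative (Q m)); destruct (excluded_middle_informative (Q m')); (reflexivity || contradiction).
    - apply (is_derive_const (K := R_AbsRing) (V := R_NormedModule)). }
  destruct (MVT_gen g x y (fun _ => 0)) as (c & Hc & E).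
  - intros t Ht. apply D. pose proof (Rmin_glb_lt x y a). pose proof (Rmax_lub_lt x y b). lra.
  - intros t Ht. apply continuity_pt_filterlim, c_der. exists 0. apply D.
    pose proof (Rmin_glb_lt x y a). pose proof (Rmax_lub_lt x y b). lra.
  - unfold g in E. destruct (excluded_middle_informative (Q y)); auto.
    destruct (excluded_middle_informative (Q x)); [lra|contradiction].
Qed.

Lemma enumZ_length (m : R) (l l' : list C) : enumZ m l -> enumZ m l' -> length l = length l'.
Proof.
  intros [N1 E1] [N2 E2]. apply Nat.le_antisymm; apply NoDup_incl_length; auto; intros w Hw.
  - apply E2, E1, Hw.
  - apply E1, E2, Hw.
Qed.

Lemma count_const (n : nat) (m1 m : R) (l1 : list C) : (1 <= n)%nat ->
  2 * INR n - 1 < m1 < 2 * INR n + 1 -> 2 * INR n - 1 < m < 2 * INR n + 1 ->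
  enumZ m1 l1 -> exists l, enumZ m l /\ length l = length l1.
Proof.
  intros Hn H1 H2 He.
  assert (Hn1 : 1 <= INR n) by (apply (le_INR 1); exact Hn).
  apply (locally_const_pred (fun m => exists l, enumZ m l /\ length l = length l1) (2 * INR n - 1) (2 * INR n + 1)
    ) with (x := m1); auto.
  - intros m' Hm'. destruct (local_count n m' ltac:(lra) Hm') as (d & k & Hd & B).
    exists d. split; auto. destruct (Nat.eq_dec k (length l1)) as [->|N]; [left; exact B|right].
    intros m2 Hm2 (l & El & Ll). destruct (B m2 Hm2) as (l' & El' & Ll').
    apply N. rewrite <- Ll, <- Ll'. apply (enumZ_length m2); auto.
  - exists l1. auto.
Qed.

(** * Integer parameters *)

(** The integral of e^(-s) s^a (s + w)^b at natural exponents, as a polynomial in w: a! for b = 0,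
    and the recursion expands one factor s + w. *)
Fixpoint qC (a b : nat) (w : C) : C :=
  match b with
  | O => RtoC (INR (fact a))
  | S b => (qC (S a) b w + w * qC a b w)%C
  end.

Lemma Hw_S (a s : R) : 0 < s -> Hw (a + 1) s = s * Hw a s.
Proof.
  intros Hs. unfold Hw. rewrite !spow_pos by auto.
  replace ((a + 1) * ln s) with (a * ln s + ln s) by ring. rewrite exp_plus, exp_ln by auto. ring.
Qed.

Lemma Hw_okR (a : R) : 0 < a -> exists M, okR M (Hw a).
Proof.
  intros Ha. destruct (Hw_dom a ltac:(lra)) as (M & HM & D). exists (M * 1). intros s Hs. split.
  - apply (cU_Hw (fun _ => a) (fun s => s)); auto; [apply cU_const|apply continuous_id].
  - specialize (D 1 a s 1 Hs ltac:(lra)). rewrite Cmult_1_r, !Cmod_R in D. apply D.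
    rewrite Rabs_R1, Rmult_1_l. rewrite <- exp_0. apply exp_le. lra.
Qed.

Lemma is_derive_Hw (a s : R) : 0 < s -> is_derive (Hw (a + 1)) s ((a + 1) * Hw a s - Hw (a + 1) s).
Proof.
  intros Hs. apply (is_derive_ext_loc (fun t => exp (- t) * exp ((a + 1) * ln t))).
  - exists (mkposreal s Hs). intros t Ht. change (Rabs (t - s) < s) in Ht. apply Rabs_lt_between in Ht.
    unfold Hw. rewrite spow_pos by lra. reflexivity.
  - auto_derive; [auto|]. unfold Hw. rewrite !spow_pos by auto.
    replace ((a + 1) * ln s) with (a * ln s + ln s) by ring. rewrite exp_plus, exp_ln by auto. field. lra.
Qed.

(** The factorial integral, by parts. The induction starts at exponent 1, since [spow 0] jumps at 0
    and continuity of the weight holds for positive exponents. *)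
Lemma Hw_integral (a : nat) : RInt0oo (Hw (INR (S a))) = INR (fact (S a)).
Proof.
  induction a as [|a IH].
  - destruct (Hw_okR 1 Rlt_0_1) as [M O]. change (INR 1) with 1.
    rewrite (RInt0oo_ftc M (Hw 1) (fun s => - ((s + 1) * exp (- s)))); auto.
    + rewrite Ropp_0, exp_0. simpl. ring.
    + intros s Hs. replace (Hw 1 s) with (s * exp (- s)).
      * auto_derive; auto. ring.
      * unfold Hw. rewrite spow_pos, Rmult_1_l, exp_ln by auto. ring.
    + apply c_der. auto_derive. auto.
    + apply (dom_lim0 2). intros s Hs. rewrite Rabs_Ropp, Rabs_pos_eq.
      * replace (exp (- s)) with (exp (- s / 2) * exp (- s / 2)) by (rewrite <- exp_plus; f_equal; field).
        pose proof (exp_ineq1_le (s / 2)) as I1. assert (E : exp (s / 2) * exp (- s / 2) = 1).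
        { rewrite <- exp_plus. replace (s / 2 + - s / 2) with 0 by field. apply exp_0. }
        pose proof (exp_pos (- s / 2)) as I2. set (u := exp (- s / 2)) in *. set (v := exp (s / 2)) in *.
        assert (I3 : (1 + s / 2) * u <= 1) by (rewrite <- E; apply Rmult_le_compat_r; lra).
        replace ((s + 1) * (u * u)) with (((s + 1) * u) * u) by ring. apply Rmult_le_compat_r; lra.
      * apply Rmult_le_pos; [lra|left; apply exp_pos].
  - set (b := INR (S a)) in *. assert (Pb : 0 < b) by (apply lt_0_INR; lia).
    rewrite (S_INR (S a)). fold b.
    destruct (Hw_okR b Pb) as [M0 O0]. destruct (Hw_okR (b + 1) ltac:(lra)) as [M1 O1].
    pose proof (okR_scal _ (b + 1) _ O0) as O0'. pose proof (okR_scal _ (-1) _ O1) as O1'.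
    assert (Os : okR (Rabs (b + 1) * M0 + Rabs (-1) * M1) (fun s => (b + 1) * Hw b s + -1 * Hw (b + 1) s)).
    { intros s Hs. destruct (O0' s Hs) as [A1 A2]. destruct (O1' s Hs) as [B1 B2]. split; [apply cU_plus; auto|].
      eapply Rle_trans; [apply Rabs_triang|]. lra. }
    assert (E : RInt0oo (fun s => (b + 1) * Hw b s + -1 * Hw (b + 1) s) = - Hw (b + 1) 0).
    { apply (RInt0oo_ftc _ _ _ Os).
      - intros s Hs. replace ((b + 1) * Hw b s + -1 * Hw (b + 1) s) with ((b + 1) * Hw b s - Hw (b + 1) s) by ring.
        apply is_derive_Hw, Hs.
      - apply O1. lra.
      - apply (dom_lim0 M1). intros s Hs. apply O1, Hs. }
    rewrite (RInt0oo_plus _ _ _ _ O0' O1'), (RInt0oo_scal M0), (RInt0oo_scal M1), IH in E by auto.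
    unfold Hw at 2 in E. rewrite spow_np in E by lra.
    change (fact (S (S a))) with ((S (S a)) * fact (S a))%nat. rewrite mult_INR, S_INR. fold b. lra.
Qed.

Lemma exp_INR (n : nat) (x : R) : exp (INR n * x) = exp x ^ n.
Proof.
  induction n as [|n IH]; [simpl; rewrite Rmult_0_l; apply exp_0|].
  rewrite S_INR. replace ((INR n + 1) * x) with (x + INR n * x) by ring. rewrite exp_plus, IH. reflexivity.
Qed.

Definition Pf (a b : nat) (w : C) (s : R) : C := (Hw (INR a) s * (s + w) ^ b)%C.

Lemma Ccts_pow (f : R -> C) (b : nat) (s : R) : Ccts f s -> Ccts (fun s => f s ^ b)%C s.
Proof. intros Hf. induction b as [|b IH]; simpl; [apply Ccts_const|apply Ccts_mult; auto]. Qed.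

Lemma Pf_ok (a b : nat) (w : C) : (1 <= a)%nat -> exists M, okC M (Pf a b w).
Proof.
  intros Ha. assert (Pa : 0 < INR a) by (apply lt_0_INR; lia).
  destruct (Hw_dom (INR a) ltac:(lra)) as (M & HM & D).
  destruct (exp_ln_growth (INR b) (pos_INR b)) as (K & HK & G).
  pose proof (Cmod_ge_0 w) as W0.
  exists (M * ((1 + Cmod w) ^ b * K)). intros s Hs. split.
  - unfold Pf. apply (Ccts_mult (fun s => RtoC (Hw (INR a) s)) (fun s => (s + w) ^ b)%C).
    + split; [|apply cU_const].
      apply (cU_Hw (fun _ => INR a) (fun s => s)); auto; [apply cU_const|apply continuous_id].
    + apply (Ccts_pow (fun s => s + w)%C). apply Ccts_plus; [|apply Ccts_const].
      split; [apply continuous_id|apply cU_const].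
  - apply D; [exact Hs|lra|]. rewrite Cmod_pow.
    apply Rle_trans with (((1 + Cmod w) * (1 + s)) ^ b).
    + apply pow_incr. split; [apply Cmod_ge_0|]. eapply Rle_trans; [apply Cmod_triangle|].
      rewrite Cmod_R, Rabs_pos_eq by lra. nra.
    + rewrite Rpow_mult_distr, Rmult_assoc. apply Rmult_le_compat_l; [apply pow_le; lra|].
      specialize (G (INR b) s Hs). rewrite exp_INR, exp_ln in G by lra. apply G. pose proof (pos_INR b). lra.
Qed.

Lemma CInt0oo_Pf (a b : nat) (w : C) : (1 <= a)%nat -> CInt0oo (Pf a b w) = qC a b w.
Proof.
  revert a. induction b as [|b IH]; intros a Ha.
  - simpl. destruct a as [|a]; [lia|].
    destruct (Hw_okR (INR (S a))) as [M O]; [apply lt_0_INR; lia|].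
    apply C_ext.
    + transitivity (RInt0oo (Hw (INR (S a)))); [|rewrite Hw_integral; reflexivity].
      apply RInt0oo_ext. intros s _. unfold Pf. unfold Re; simpl; ring.
    + transitivity (RInt0oo (fun s => 0 * Hw (INR (S a)) s)); [|rewrite (RInt0oo_scal M) by exact O; simpl; ring].
      apply RInt0oo_ext. intros s _. unfold Pf. unfold Im; simpl; ring.
  - destruct (Pf_ok (S a) b w ltac:(lia)) as [M1 O1]. destruct (Pf_ok a b w Ha) as [M0 O0].
    simpl qC. rewrite <- (IH (S a)) by lia. rewrite <- (IH a) by auto.
    rewrite <- (CInt0oo_scal M0) by exact O0.
    rewrite <- (CInt0oo_plus M1 (Cmod w * M0)); [|exact O1|apply okC_scal, O0].
    apply CInt0oo_ext. intros s Hs. unfold Pf. rewrite S_INR, Hw_S by auto. rewrite RtoC_mult. simpl Cpow. ring.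
Qed.

Lemma H_nat (M : nat) (w : C) : (1 <= M)%nat -> slit_plane w -> H (INR M) (INR M) w = qC M M w.
Proof.
  intros HM Hs. rewrite <- CInt0oo_Pf by auto. apply CInt0oo_ext. intros s Ps. unfold Hf, Pf.
  rewrite Cpw_nat; [reflexivity|]. apply slit_shift; auto; lra.
Qed.

(** On the negative axis e^(i pi M) = (-1)^M, so for a natural exponent the boundary value from
    above is the ordinary power. *)
Lemma pup_nat (M : nat) (x : R) : (1 <= M)%nat -> pup (INR M) x = (x ^ M)%C.
Proof.
  intros HM. rewrite pup_real.
  assert (Sp : forall y, 0 <= y -> spow (INR M) y = y ^ M).
  { intros y [Hy|Hy].
    - rewrite spow_pos, exp_INR, exp_ln by auto. reflexivity.
    - rewrite <- Hy, spow_np by lra. destruct M; [lia|]. simpl. ring. }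
  rewrite Sp by apply Rabs_pos.
  rewrite <- RtoC_pow. destruct (Rlt_dec x 0) as [L|L].
  - assert (E : Cexp (0, INR M * PI)%R = RtoC ((-1) ^ M)).
    { clear HM Sp. induction M as [|M IH].
      - simpl. replace (0, 0 * PI) with (RtoC 0) by (unfold RtoC; f_equal; ring). rewrite Cexp_R, exp_0. reflexivity.
      - rewrite S_INR. replace (0, (INR M + 1) * PI) with ((0, INR M * PI)%R + (0, PI)%R)%C by (apply C_ext; unfold Re, Im; simpl; ring).
        rewrite Cexp_plus, IH. simpl pow. rewrite RtoC_mult.
        replace (Cexp (0, PI)) with (RtoC (-1)); [ring|].
        apply C_ext; unfold Cexp, Re, Im; simpl; rewrite ?cos_PI, ?sin_PI, exp_0; ring. }
    rewrite E, Rabs_left, <- RtoC_mult, <- Rpow_mult_distr by auto. f_equal. f_equal. ring.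
  - rewrite Rabs_pos_eq by lra. reflexivity.
Qed.

(** At exponent 2n, the centre of the interval in [Hp_real_neq_0], the boundary value on the real
    axis is this polynomial. *)
Lemma qC_real_neq_0 (n : nat) (p : R) : (1 <= n)%nat -> qC (2 * n) (2 * n) p <> 0.
Proof.
  intros Hn. assert (Hn1 : 1 <= INR n) by (apply (le_INR 1); exact Hn).
  assert (E2 : INR (2 * n) = 2 * INR n) by (rewrite mult_INR; reflexivity).
  rewrite <- CInt0oo_Pf by lia. intro E. apply (Hp_real_neq_0 n (INR (2 * n)) p); try lra.
  rewrite <- E. apply CInt0oo_ext. intros s Ps. unfold Hpf, Pf. f_equal.
  rewrite <- RtoC_plus. apply pup_nat. lia.
Qed.

(** Integration by parts against e^(-s) with the factor s^(a+1) (s + w)^(b+1), redone as an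
    induction on the recursion. *)
Lemma qC_ibp (a b : nat) (w : C) :
  qC (S a) (S b) w = (INR (S a) * qC a (S b) w + INR (S b) * qC (S a) b w)%C.
Proof.
  assert (B0 : forall a, qC (S a) 0 w = (INR (S a) * qC a 0 w)%C).
  { intros c. simpl qC. rewrite <- RtoC_mult, <- mult_INR. reflexivity. }
  revert a. induction b as [|b IH]; intros a.
  - change (qC (S a) 1 w) with (qC (S (S a)) 0 w + w * qC (S a) 0 w)%C.
    change (qC a 1 w) with (qC (S a) 0 w + w * qC a 0 w)%C.
    rewrite (B0 (S a)), (B0 a), !S_INR, !RtoC_plus. simpl INR. ring.
  - change (qC (S a) (S (S b)) w) with (qC (S (S a)) (S b) w + w * qC (S a) (S b) w)%C.
    rewrite (IH (S a)).
    replace (w * qC (S a) (S b) w)%C with (w * (INR (S a) * qC a (S b) w + INR (S b) * qC (S a) b w))%C by (rewrite (IH a); reflexivity).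
    change (qC a (S (S b)) w) with (qC (S a) (S b) w + w * qC a (S b) w)%C.
    change (qC (S a) (S b) w) with (qC (S (S a)) b w + w * qC (S a) b w)%C.
    rewrite !S_INR, !RtoC_plus. ring.
Qed.

Lemma qC_three (a b : nat) (w : C) :
  qC a (S (S b)) w = ((w + INR (a + b + 2)) * qC a (S b) w - INR (S b) * (w * qC a b w))%C.
Proof.
  pose proof (qC_ibp a b w) as I.
  change (qC a (S (S b)) w) with (qC (S a) (S b) w + w * qC a (S b) w)%C.
  rewrite I. replace (qC (S a) b w) with (qC a (S b) w - w * qC a b w)%C by (simpl qC; ring).
  rewrite !plus_INR, !S_INR, !RtoC_plus. simpl INR. rewrite ?RtoC_plus. ring.
Qed.

Lemma INR_fact_neq_0' (a : nat) : RtoC (INR (fact a)) <> 0.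
Proof. intro E. apply RtoC_inj in E. apply (INR_fact_neq_0 a), E. Qed.

(** The derivative of [qC a (S b)] is S b times [qC a b], so this is simplicity of roots. By
    [qC_three] two consecutive zeros propagate down to b = 0, where the value is a nonzero
    factorial. *)
Lemma qC_simple (a b : nat) (w : C) : w <> 0 -> qC a (S b) w = 0 -> qC a b w <> 0.
Proof.
  intros Hw. induction b as [|b IH]; intros E1 E0.
  - apply (INR_fact_neq_0' a), E0.
  - apply IH; auto. pose proof (qC_three a b w) as T. rewrite E1, E0 in T.
    assert (T' : (INR (S b) * (w * qC a b w))%C = 0).
    { transitivity (- ((w + INR (a + b + 2)) * 0 - INR (S b) * (w * qC a b w)))%C; [ring|].
      rewrite <- T. ring. }
    apply NNPP. intro N. revert T'. apply Cmult_neq_0; [|apply Cmult_neq_0; auto].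
    intro K. apply RtoC_inj in K. apply (not_0_INR (S b)); auto.
Qed.

Lemma qC_0 (a b : nat) : qC a b 0 = RtoC (INR (fact (a + b))).
Proof.
  revert a. induction b as [|b IH]; intros a; simpl qC; [rewrite Nat.add_0_r; reflexivity|].
  rewrite !IH. replace (a + S b)%nat with (S a + b)%nat by lia. ring.
Qed.

(** A real copy of [qC], to which real derivatives and the mean value theorem apply. *)
Fixpoint qR (a b : nat) (x : R) : R :=
  match b with
  | O => INR (fact a)
  | S b => qR (S a) b x + x * qR a b x
  end.

Lemma qC_R (a b : nat) (x : R) : qC a b x = RtoC (qR a b x).
Proof.
  revert a. induction b as [|b IH]; intros a; [reflexivity|]. simpl. rewrite !IH, RtoC_plus, RtoC_mult. reflexivity.
Qed.

Lemma qR_pos (a b : nat) (x : R) : 0 <= x -> 0 < qR a b x.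
Proof.
  intros Hx. revert a. induction b as [|b IH]; intros a; simpl.
  - apply lt_0_INR, lt_O_fact.
  - pose proof (IH (S a)). pose proof (IH a). nra.
Qed.

Lemma is_derive_qR (a b : nat) (x : R) : is_derive (qR a (S b)) x (INR (S b) * qR a b x).
Proof.
  revert a. induction b as [|b IH]; intros a.
  - simpl. auto_derive; auto; ring.
  - apply (is_derive_ext (fun x => qR (S a) (S b) x + x * qR a (S b) x)); [reflexivity|].
    replace (INR (S (S b)) * qR a (S b) x) with
      (INR (S b) * qR (S a) b x + (1 * qR a (S b) x + x * (INR (S b) * qR a b x))).
    + apply (is_derive_plus (K := R_AbsRing) (V := R_NormedModule)); [apply IH|].
      apply (is_derive_mult (K := R_AbsRing) (fun x => x) (qR a (S b)) x 1 _);
        [apply (is_derive_id (K := R_AbsRing))|apply IH|exact Rmult_comm].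
    + rewrite (S_INR (S b)). simpl qR. ring.
Qed.

Lemma qR_three (a b : nat) (x : R) :
  qR a (S (S b)) x = (x + INR (a + b + 2)) * qR a (S b) x - INR (S b) * (x * qR a b x).
Proof.
  apply RtoC_inj. rewrite RtoC_minus, !RtoC_mult, RtoC_plus, <- !qC_R. apply qC_three.
Qed.

(* With [Q = qR M M], [M = S b + 1], the Sturm-Liouville form of the equation makes
   [exp (- x) x^(-2M) Q Q'] strictly increasing on the negative axis. *)
Lemma qR_one_root (b : nat) (x y : R) : qR (S (S b)) (S (S b)) x = 0 -> qR (S (S b)) (S (S b)) y = 0 -> x = y.
Proof.
  set (M := S (S b)).
  assert (Neg : forall x, qR M M x = 0 -> x < 0).
  { intros u Hu. apply Rnot_le_lt. intro L. pose proof (qR_pos M M u L). lra. }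
  assert (W : forall x y, qR M M x = 0 -> qR M M y = 0 -> ~ x < y).
  { clear x y. intros x y Hx Hy L. pose proof (Neg x Hx) as Nx. pose proof (Neg y Hy) as Ny.
    set (Q := qR M M). set (Q1 := qR M (S b)). set (Q2 := qR M b).
    set (g := fun t => exp (- t) * / t ^ (2 * M) * (Q t * Q1 t)).
    assert (D : forall t, t < 0 -> is_derive g t (exp (- t) * / t ^ (2 * M) * (INR M * (Q1 t * Q1 t) - Q t * Q t / t))).
    { intros t Ht. unfold g.
      assert (D1 : is_derive Q t (INR M * Q1 t)) by (apply (is_derive_qR M (S b))).
      assert (D2 : is_derive Q1 t (INR (S b) * Q2 t)) by (apply (is_derive_qR M b)).
      assert (T : Q t = (t + INR (M + b + 2)) * Q1 t - INR (S b) * (t * Q2 t)) by (apply (qR_three M b)).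
      (* As M = b + 2, the coefficient in the three-term relation is exactly the exponent 2M of the
         weight, and the cross terms in the derivative of g cancel. *)
      replace (M + b + 2)%nat with (2 * M)%nat in T by (unfold M; lia).
      assert (EN : exists k, (2 * M)%nat = S k) by (exists (2 * M - 1)%nat; unfold M; lia).
      destruct EN as [k EN]. rewrite EN in *.
      assert (Tn : t ^ k <> 0) by (apply pow_nonzero; lra).
      assert (D3 : is_derive (fun t => exp (- t) * / t ^ S k) t
        (- exp (- t) * / t ^ S k - exp (- t) * (INR (S k) * / t) * / t ^ S k)).
      { auto_derive; [apply (pow_nonzero t (S k)); lra|]. simpl pred.
        change (match k with O => 1 | S _ => INR k + 1 end) with (INR (S k)).
        simpl pow. field. split; [auto|lra]. }
      clearbody Q Q1 Q2.
      replace (exp (- t) * / t ^ S k * (INR M * (Q1 t * Q1 t) - Q t * Q t / t)) with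
        ((- exp (- t) * / t ^ S k - exp (- t) * (INR (S k) * / t) * / t ^ S k) * (Q t * Q1 t) +
         exp (- t) * / t ^ S k * (INR M * Q1 t * Q1 t + Q t * (INR (S b) * Q2 t))).
      - apply (is_derive_mult (K := R_AbsRing) (fun t => exp (- t) * / t ^ S k) (fun t => Q t * Q1 t)); [exact D3| |exact Rmult_comm].
        apply (is_derive_mult (K := R_AbsRing) Q Q1); [exact D1|exact D2|exact Rmult_comm].
      - replace (INR (S b) * Q2 t) with (((t + INR (S k)) * Q1 t - Q t) / t).
        2:{ rewrite T. field. lra. }
        assert (N1 : t <> 0) by lra. assert (N2 : t ^ S k <> 0) by (apply pow_nonzero; lra). field. auto. }
    (* g vanishes at both roots, so its derivative vanishes at some c between them. For c < 0 the
       bracket is a sum of two nonnegative terms, so Q and Q1 vanish together at c, against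
       simplicity. *)
    destruct (MVT_gen g x y (fun t => exp (- t) * / t ^ (2 * M) * (INR M * (Q1 t * Q1 t) - Q t * Q t / t))) as (c & Hc & E).
    - intros t Ht. apply D. rewrite Rmin_left, Rmax_right in Ht by lra. lra.
    - intros t Ht. apply continuity_pt_filterlim, c_der. eexists. apply D.
      rewrite Rmin_left, Rmax_right in Ht by lra. lra.
    - rewrite Rmin_left, Rmax_right in Hc by lra.
      unfold g in E. fold Q in Hx, Hy. rewrite Hx, Hy in E.
      assert (Pc : 0 < exp (- c) * / c ^ (2 * M)).
      { apply Rmult_lt_0_compat; [apply exp_pos|]. apply Rinv_0_lt_compat.
        rewrite pow_mult. apply pow_lt. nra. }
      assert (K : INR M * (Q1 c * Q1 c) - Q c * Q c / c = 0).
      { apply Rmult_eq_reg_l with (exp (- c) * / c ^ (2 * M)); [|lra].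
        apply Rmult_eq_reg_r with (y - x); [|lra]. rewrite <- E. ring. }
      assert (PM : 0 < INR M) by (apply lt_0_INR; unfold M; lia).
      assert (K2 : 0 <= Q c * Q c * / - c).
      { apply Rmult_le_pos; [nra|]. left. apply Rinv_0_lt_compat. lra. }
      assert (K3 : Q c * Q c / c = - (Q c * Q c * / - c)) by (field; lra).
      rewrite K3 in K.
      assert (Z1 : Q1 c = 0).
      { pose proof (Rle_0_sqr (Q1 c)) as G. unfold Rsqr in G.
        assert (G2 : 0 <= INR M * (Q1 c * Q1 c)) by (apply Rmult_le_pos; lra).
        assert (G3 : INR M * (Q1 c * Q1 c) = 0) by lra.
        apply Rmult_integral in G3. destruct G3 as [G3|G3]; [lra|].
        apply Rmult_integral in G3. destruct G3; auto. }
      assert (Z0 : Q c = 0).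
      { rewrite Z1 in K. assert (K4 : Q c * Q c * / - c = 0) by lra.
        apply Rmult_integral in K4. destruct K4 as [K4|K4]; [apply Rmult_integral in K4; destruct K4; auto|].
        exfalso. apply (Rinv_neq_0_compat (- c)); [lra|exact K4]. }
      apply (qC_simple M (S b) (RtoC c)).
      + intro E0. apply RtoC_inj in E0. lra.
      + change (qC M (S (S b)) c) with (qC M M c). rewrite qC_R. unfold Q in Z0. rewrite Z0. reflexivity.
      + rewrite qC_R. unfold Q1 in Z1. rewrite Z1. reflexivity. }
  intros Hx Hy. destruct (Rtotal_order x y) as [L|[L|L]]; auto; exfalso; [apply (W x y)|apply (W y x)]; auto.
Qed.

(** * Roots and coefficients over the algebraically closed field [complex R] *)

Module ComplexRoots.
Import all_boot all_algebra separable complex Rstruct.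
Import GRing.Theory.
Local Open Scope ring_scope.

Definition phi (z : C) : complex R := Complex (fst z) (snd z).
Definition psi (z : complex R) : C := (complex.Re z, complex.Im z).

Lemma phiK (z : C) : psi (phi z) = z. Proof. by case: z. Qed.
Lemma psiK (z : complex R) : phi (psi z) = z. Proof. by case: z. Qed.
Lemma phi_inj : injective phi. Proof. exact: can_inj phiK. Qed.
Lemma phiD (z w : C) : phi (Cplus z w) = phi z + phi w. Proof. by case: z; case: w. Qed.
Lemma phiM (z w : C) : phi (Cmult z w) = phi z * phi w. Proof. by case: z; case: w. Qed.

Lemma phi_nat (n : nat) : phi (RtoC (INR n)) = n%:R.
Proof.
elim: n => [|n IH] //.
by rewrite S_INR RtoC_plus phiD IH -addn1 natrD.
Qed.

Lemma phiX (z : C) (n : nat) : phi (Cpow z n) = phi z ^+ n.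
Proof. elim: n => [|n IH] //. by rewrite exprS -IH -phiM. Qed.

Fixpoint qp (a b : nat) : {poly complex R} :=
  if b is b'.+1 then qp a.+1 b' + 'X * qp a b' else (fact a)%:R%:P.

Lemma qp_horner (a b : nat) (z : C) : (qp a b).[phi z] = phi (qC a b z).
Proof.
elim: b a => [|b IH] a /=; first by rewrite hornerC phi_nat.
by rewrite hornerD hornerM hornerX !IH phiD phiM.
Qed.

(** Expanding (s + w)^b under the integral leaves a binomial coefficient times the integral of
    e^(-s) s^(a + b - k). *)
Lemma qp_coef (a b k : nat) : (qp a b)`_k = ('C(b, k) * fact (a + b - k))%:R.
Proof.
elim: b a k => [|b IH] a k /=.
  by rewrite coefC; case: k => [|k] /=; rewrite ?bin0 ?mul1n ?addn0 ?subn0 // bin0n mul0n.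
rewrite coefD coefXM !IH; case: k => [|k] /=.
  by rewrite !bin0 !mul1n addr0 !subn0 addnS.
by rewrite -natrD binS mulnDl addnS addSn !subSS.
Qed.

Lemma fact_neq0 (a : nat) : (fact a)%:R != 0 :> complex R.
Proof.
apply/eqP; rewrite -phi_nat => E.
have /RtoC_inj E2 : RtoC (INR (fact a)) = RtoC 0 by apply: phi_inj; rewrite E.
exact: (INR_fact_neq_0 a E2).
Qed.

Lemma qp_size (a b : nat) : size (qp a b) = b.+1.
Proof.
apply/eqP; rewrite eqn_leq; apply/andP; split.
  by apply/leq_sizeP => k Hk; rewrite qp_coef bin_small ?mul0n.
rewrite ltnNge; apply/negP => /leq_sizeP/(_ b (leqnn b))/eqP.
by rewrite qp_coef binn mul1n addnK (negbTE (fact_neq0 a)).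
Qed.

Lemma qp_deriv (a b : nat) : (qp a b.+1)^`() = b.+1%:R *: qp a b.
Proof.
apply/polyP => k; rewrite coef_deriv coefZ !qp_coef -mulrnA -natrM addnS subSS.
by rewrite mulnA (mul_bin_diag b.+1 k) -[in RHS]mulnA mulnC.
Qed.

(** The polynomial splits into linear factors, and [qC_simple] excludes a common root with its
    derivative; the list of factors is thus free of repetitions and as long as the degree. *)
Lemma qC_roots (b : nat) : exists l : list C, NoDup l /\ length l = S b /\
  forall z, In z l <-> qC (S b) (S b) z = RtoC 0.
Proof.
set p := qp b.+1 b.+1.
have Hroot z : root p (phi z) <-> qC (S b) (S b) z = RtoC 0.
  rewrite /root qp_horner; split; first by move/eqP => E; apply: phi_inj; rewrite E.
  by move=> ->; apply/eqP.
have [r Er] := closed_field_poly_normal p.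
have p0 : p != 0 by rewrite -size_poly_eq0 qp_size.
have lc0 : lead_coef p != 0 by rewrite lead_coef_eq0.
have Ur : uniq r.
  rewrite -separable_prod_XsubC.
  have : separable_poly p.
    rewrite separable_poly.unlock; apply: Pdiv.ClosedField.root_coprimep => x.
    rewrite -(psiK x) => /Hroot Hx.
    rewrite qp_deriv hornerZ qp_horner mulf_neq0 //.
      apply/eqP; rewrite -phi_nat => E.
      have /RtoC_inj E2 : RtoC (INR b.+1) = RtoC 0 by apply: phi_inj; rewrite E.
      by move: E2; apply: not_0_INR.
    apply/eqP => E; have E2 : qC b.+1 b (psi x) = RtoC 0 by apply: phi_inj; rewrite E.
    (* [qC_simple] asks for a nonzero point; 0 is no root, because the value there is a
       factorial. *)
    move: E2; apply: (qC_simple b.+1 b (psi x)) => // E0.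
    by move: Hx; rewrite E0 qC_0; apply: INR_fact_neq_0'.
  by move=> Sp; rewrite -(eqp_separable (eqp_scale (\prod_(z <- r) ('X - z%:P)) lc0)) -Er.
have Mem z : (z \in r) = root p z by rewrite Er rootZ // root_prod_XsubC.
have InP (s : seq (complex R)) z : In z [seq psi x | x <- s] <-> phi z \in s.
  elim: s => [|x s IH] //=; rewrite inE; split.
    by case=> [<-|/IH ->]; rewrite ?psiK ?eqxx ?orbT.
  by case/orP=> [/eqP <-|/IH]; [left; rewrite phiK|right].
exists [seq psi x | x <- r]; split; last split.
- elim: r Ur {Er Mem} => [|x s IH] /=; first by move=> _; exact: NoDup_nil.
  case/andP=> Hx Us; apply: NoDup_cons; last exact: IH.
  by move/InP; rewrite psiK (negbTE Hx).
- have : size r = b.+1.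
    move: (qp_size b.+1 b.+1); rewrite -/p Er size_scale // size_prod_XsubC.
    by case.
  by rewrite -(size_map psi).
- by move=> z; rewrite InP Mem.
Qed.

Lemma phi_sum_n (f : nat -> C) (N : nat) :
  phi (sum_n (G := C_AbelianMonoid) f N) = \sum_(k < N.+1) phi (f k).
Proof.
elim: N => [|N IH]; first by rewrite sum_O big_ord1.
by rewrite sum_Sn big_ord_recr -IH phiD.
Qed.

Lemma fact_factorial (n : nat) : fact n = n`!.
Proof. elim: n => [|n IH] //; by rewrite factS -IH. Qed.

Lemma qC_closed_form (M : nat) (w : C) : qC M M w =
  sum_n (G := C_AbelianMonoid) (fun k => Cmult (RtoC (Rdiv
    (Rmult (INR (fact M)) (INR (fact (Nat.sub (Nat.add M M) k))))
    (Rmult (INR (fact k)) (INR (fact (Nat.sub M k)))))) (Cpow w k)) M.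
Proof.
apply: phi_inj; rewrite -qp_horner horner_coef qp_size phi_sum_n.
apply: eq_bigr => k _; rewrite qp_coef phiM phiX -phi_nat; congr (phi (RtoC _) * _).
have Hk : (k <= M)%N by rewrite -ltnS.
have := bin_fact Hk; rewrite -!fact_factorial => E.
rewrite -[in RHS]E; change muln with Nat.mul; change addn with Nat.add; change subn with Nat.sub.
have f1 := INR_fact_neq_0 k; have f2 := INR_fact_neq_0 (Nat.sub M k).
rewrite !mult_INR.
by field; split.
Qed.
End ComplexRoots.

(** * Hankel's symbol at half-integral order *)

Lemma fold_right_Rmult_app (l : list R) (x : R) : fold_right Rmult 1 (l ++ x :: nil) = fold_right Rmult 1 l * x.
Proof. induction l as [|a l IH]; simpl; [ring|rewrite IH; ring]. Qed.

(** At order M + 1/2 the j-th factor (2M + 1)^2 - (2j - 1)^2 equals 4 (M + 1 - j) (M + j), so the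
    product telescopes into factorials. *)
Lemma hankel_half (M k : nat) : (k <= M)%nat ->
  hankel (INR M + 1/2) k = INR (fact (M + k)) / (INR (fact (M - k)) * INR (fact k)).
Proof.
  intros Hk. unfold hankel.
  set (f := fun j : nat => 4 * (INR M + 1/2) ^ 2 - (2 * INR j - 1) ^ 2).
  assert (P : fold_right Rmult 1 (map f (seq 1 k)) * INR (fact (M - k)) = 2 ^ (2 * k) * INR (fact (M + k))).
  { induction k as [|k IH].
    - simpl. rewrite Nat.sub_0_r, Nat.add_0_r. ring.
    - specialize (IH ltac:(lia)).
      rewrite seq_S, map_app. simpl map. rewrite fold_right_Rmult_app.
      replace (M - k)%nat with (S (M - S k)) in IH by lia.
      change (fact (S (M - S k))) with (S (M - S k) * fact (M - S k))%nat in IH. rewrite mult_INR in IH.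
      replace (M + S k)%nat with (S (M + k)) by lia.
      change (fact (S (M + k))) with (S (M + k) * fact (M + k))%nat. rewrite mult_INR.
      replace (2 ^ (2 * S k)) with (4 * 2 ^ (2 * k))
        by (replace (2 * S k)%nat with (S (S (2 * k))) by lia; simpl; ring).
      assert (E : f (1 + k)%nat = 4 * (INR (S (M - S k)) * INR (S (M + k)))).
      { unfold f. replace (S (M - S k)) with (M - k)%nat by lia. rewrite minus_INR by lia.
        rewrite !S_INR, !plus_INR. simpl INR. field. }
      change (S k) with (1 + k)%nat at 1. rewrite E.
      transitivity (4 * INR (S (M + k)) * (fold_right Rmult 1 (map f (seq 1 k)) * (INR (S (M - S k)) * INR (fact (M - S k))))); [ring|].
      rewrite IH. ring. }
  pose proof (INR_fact_neq_0 (M - k)) as f1. pose proof (INR_fact_neq_0 k) as f2.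
  assert (f3 : 2 ^ (2 * k) <> 0) by (apply pow_nonzero; lra).
  apply Rmult_eq_reg_r with (INR (fact (M - k)) * (INR (fact k) * 2 ^ (2 * k)));
    [|repeat apply Rmult_integral_contrapositive_currified; auto].
  transitivity (fold_right Rmult 1 (map f (seq 1 k)) * INR (fact (M - k))).
  - field. auto.
  - rewrite P. field. auto.
Qed.

(** The coefficient M! (2M - k)! / (k! (M - k)!) of w^k is matched with Hankel's symbol at M - k; w
    = 2 z supplies 2^k, which combines with 2^(M - k) to the constant 2^M. *)
Lemma besselK_nu_poly_qC (n : nat) (z : C) :
  qC (2 * n + 1) (2 * n + 1) (2 * z) = (RtoC (INR (fact (2 * n + 1)) * 2 ^ (2 * n + 1)) * besselK_nu_poly n z)%C.
Proof.
  set (M := (2 * n + 1)%nat).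
  rewrite ComplexRoots.qC_closed_form. unfold besselK_nu_poly. fold M.
  assert (En : nu_ n = INR M + 1/2).
  { unfold nu_, M. rewrite plus_INR, mult_INR. simpl INR. field. }
  rewrite En.
  pose proof (sum_n_mult_l (K := C_Ring) (RtoC (INR (fact M) * 2 ^ M))
    (fun k => (RtoC (hankel (INR M + 1 / 2) (M - k) / 2 ^ (M - k)) * z ^ k)%C) M) as E.
  refine (eq_trans _ E). clear E.
  apply sum_n_ext_loc. intros k Hk.
  rewrite hankel_half by lia. replace (M - (M - k))%nat with k by lia.
  replace (M + (M - k))%nat with (M + M - k)%nat by lia.
  rewrite Cpow_mult_l, <- RtoC_pow, !Cmult_assoc, <- !RtoC_mult. f_equal. f_equal.
  pose proof (INR_fact_neq_0 (M - k)) as f1. pose proof (INR_fact_neq_0 k) as f2.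
  assert (f3 : 2 ^ (M - k) <> 0) by (apply pow_nonzero; lra).
  replace (2 ^ M) with (2 ^ k * 2 ^ (M - k)) by (rewrite <- pow_add; f_equal; lia).
  field. auto.
Qed.

(** * Enumerations of the zeros and their limits *)

Lemma H_zero_besselK (nu : R) (z : C) : 3/2 < nu -> (besselK_zero nu z <-> H_zero (nu - 1/2) (2 * z)%C).
Proof.
  intros Hnu. rewrite besselK_zero_H by auto. unfold H_zero. split; intros [S E]; split; auto.
  - apply slit_scal; auto; lra.
  - replace z with ((/ 2)%R * (2 * z))%C by (apply C_ext; unfold Re, Im; simpl; field).
    apply slit_scal; auto; lra.
Qed.

Lemma enumerates_list (nu : R) (l : list C) (u : nat -> C) : 3/2 < nu -> enumZ (nu - 1/2) l ->
  (forall j, (j < length l)%nat -> u j = (/ 2 * nth j l 0)%C) ->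
  enumerates (length l) u (besselK_zero nu).
Proof.
  intros Hnu [ND HZ] Hu.
  assert (E2 : forall j, (j < length l)%nat -> (2 * u j)%C = nth j l 0).
  { intros j Hj. rewrite Hu by auto. field. }
  split; [|split].
  - intros j Hj. apply H_zero_besselK; auto. rewrite E2 by auto. apply HZ, nth_In, Hj.
  - intros i j Hi Hj E. apply (proj1 (NoDup_nth l 0) ND); auto. rewrite <- !E2, E by auto. reflexivity.
  - intros w Hw. apply H_zero_besselK in Hw; auto. apply HZ in Hw.
    destruct (In_nth l _ 0 Hw) as (j & Hj & Ej). exists j. split; auto.
    rewrite Hu, Ej by auto. field.
Qed.

Lemma H_zero_nat (M : nat) (w : C) : (1 <= M)%nat -> Im w <> 0 -> (H_zero (INR M) w <-> qC M M w = 0).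
Proof.
  intros HM Hw. assert (S : slit_plane w) by (right; auto). unfold H_zero. rewrite H_nat by auto. tauto.
Qed.

(** The reference count: 2n lies inside the interval, so no root is real, all roots lie in the slit
    plane, and each is a zero of H_m at m = 2n. *)
Lemma enumZ_even (n : nat) : (1 <= n)%nat -> exists l, enumZ (INR (2 * n)) l /\ length l = (2 * n)%nat.
Proof.
  intros Hn. destruct (ComplexRoots.qC_roots (2 * n - 1)) as (l & ND & Ll & HR).
  replace (S (2 * n - 1)) with (2 * n)%nat in * by lia.
  assert (NR : forall w, qC (2 * n) (2 * n) w = 0 -> Im w <> 0).
  { intros w E I0. apply (qC_real_neq_0 n (Re w) Hn). rewrite <- E. f_equal.
    apply C_ext; [reflexivity|symmetry; exact I0]. }
  assert (P : 0 < INR (2 * n)) by (apply lt_0_INR; lia).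
  exists l. split; auto. split; auto. intros w. rewrite HR. split; intros Hw.
  - apply H_zero_nat; auto; [lia|]. apply (H_zero_nonreal (INR (2 * n))); auto.
  - apply H_zero_nat; auto. lia.
Qed.

Lemma filter_all {A : Type} (f : A -> bool) (l : list A) : (forall x, In x l -> f x = true) -> filter f l = l.
Proof.
  induction l as [|a l IH]; intros Hf; simpl; auto.
  rewrite (Hf a (or_introl eq_refl)). f_equal. apply IH. intros; apply Hf; right; auto.
Qed.

Lemma filter_all_but_one {A : Type} (f : A -> bool) (l : list A) : NoDup l ->
  (forall x y, In x l -> In y l -> f x = false -> f y = false -> x = y) -> (length l <= S (length (filter f l)))%nat.
Proof.
  induction l as [|a l IH]; intros ND Hf; simpl; [lia|]. inversion ND as [|? ? Na ND']; subst.
  destruct (f a) eqn:Ea.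
  - simpl. apply le_n_S, IH; auto. intros x y Hx Hy. apply Hf; right; auto.
  - rewrite filter_all; [lia|]. intros x Hx. destruct (f x) eqn:Ex; auto.
    exfalso. apply Na. rewrite (Hf a x); auto; [left; auto|right; auto].
Qed.

Lemma NoDup_firstn {A : Type} (k : nat) (l : list A) : NoDup l -> NoDup (firstn k l).
Proof.
  intros ND. rewrite <- (firstn_skipn k l) in ND. apply NoDup_app_remove_r in ND. exact ND.
Qed.

Lemma In_firstn' {A : Type} (k : nat) (l : list A) (x : A) : In x (firstn k l) -> In x l.
Proof. intros Hx. rewrite <- (firstn_skipn k l). apply in_or_app. auto. Qed.

(** Among 2n + 1 distinct roots at most one is real by [qR_one_root], so discarding real roots
    shortens the list by at most one. *)
Lemma odd_nonreal_roots (n : nat) : (1 <= n)%nat -> exists l : list C, NoDup l /\ length l = (2 * n)%nat /\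
  forall p, In p l -> qC (2 * n + 1) (2 * n + 1) p = 0 /\ Im p <> 0.
Proof.
  intros Hn. destruct (ComplexRoots.qC_roots (2 * n)) as (l & ND & Ll & HR).
  replace (S (2 * n)) with (2 * n + 1)%nat in * by lia.
  set (f := fun p : C => if Req_EM_T (Im p) 0 then false else true).
  assert (Ff : forall p, f p = false -> p = RtoC (Re p)).
  { intros p. unfold f. destruct (Req_EM_T (Im p) 0) as [E|]; [|discriminate].
    intros _. apply C_ext; [reflexivity|exact E]. }
  assert (Len : (length l <= S (length (filter f l)))%nat).
  { apply filter_all_but_one; auto. intros x y Hx Hy Fx Fy.
    apply Ff in Fx. apply Ff in Fy. apply HR in Hx. apply HR in Hy.
    rewrite Fx in Hx. rewrite Fy in Hy. rewrite qC_R in Hx, Hy.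
    apply RtoC_inj in Hx. apply RtoC_inj in Hy.
    rewrite Fx, Fy. f_equal. apply (qR_one_root (2 * n - 1)); replace (S (S (2 * n - 1))) with (2 * n + 1)%nat by lia; auto. }
  (* At least 2n roots survive the filter; truncation fixes the length at exactly 2n. *)
  exists (firstn (2 * n) (filter f l)). split; [|split].
  - apply NoDup_firstn, NoDup_filter, ND.
  - apply firstn_length_le. lia.
  - intros p Hp. apply In_firstn' in Hp. apply filter_In in Hp. destruct Hp as [Hp Fp].
    split; [apply HR, Hp|]. unfold f in Fp. destruct (Req_EM_T (Im p) 0); [discriminate|auto].
Qed.

Theorem theorem4 (n : nat) (hn : (1 <= n)%nat) :
  exists z : R -> nat -> C,
    (forall nu : R, nu_ n - 2 < nu < nu_ n ->
       enumerates (2 * n) (z nu) (besselK_zero nu)) /\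
    (forall j : nat, (j < 2 * n)%nat ->
       exists l : C,
         filterlim (fun nu : R => z nu j) (at_left (nu_ n))
           (locally (T := C_UniformSpace) l) /\
         besselK_nu_zero n l /\ Im l <> 0).
Proof.
  assert (Hn1 : 1 <= INR n) by (apply (le_INR 1); exact hn).
  assert (E2n : INR (2 * n) = 2 * INR n) by (rewrite mult_INR; reflexivity).
  set (M := (2 * n + 1)%nat).
  assert (EM : INR M = 2 * INR n + 1) by (unfold M; rewrite plus_INR, E2n; reflexivity).
  destruct (enumZ_even n hn) as (l0 & El0 & Ll0).
  (* The implication stands inside the existential so that [choice] gives a total function; outside
     the interval the list is [nil]. *)
  assert (Enum : forall m, exists l, 2 * INR n - 1 < m < 2 * INR n + 1 -> enumZ m l /\ length l = (2 * n)%nat).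
  { intros m. destruct (classic (2 * INR n - 1 < m < 2 * INR n + 1)) as [Hm|Hm]; [|exists nil; tauto].
    destruct (count_const n (INR (2 * n)) m l0 hn ltac:(lra) Hm El0) as (l & El & Ll). exists l. intros _.
    split; auto. congruence. }
  destruct (choice _ Enum) as [le Hle].
  destruct (odd_nonreal_roots n hn) as (L & NDL & LL & HL). fold M in HL.
  assert (ZL : forall p, In p L -> H_zero (INR M) p).
  { intros p Hp. destruct (HL p Hp). apply H_zero_nat; auto. unfold M; lia. }
  assert (Per : forall p, exists r, In p L -> 0 < r /\
    (forall m w w', Rabs (m - INR M) < r -> Cmod (w - p)%C < r -> Cmod (w' - p)%C < r -> H_zero m w -> H_zero m w' -> w = w') /\
    (forall e, 0 < e -> exists d, 0 < d /\ forall m, Rabs (m - INR M) < d -> exists w, Cmod (w - p)%C < e /\ H_zero m w)).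
  { intros p. destruct (classic (In p L)) as [I|N]; [|exists 0; tauto].
    destruct (persist (INR M) p ltac:(lra) (ZL p I)) as (r & Hr). exists r. auto. }
  destruct (choice _ Per) as [r Hr].
  (* e0 is below every uniqueness radius, so each zero that f produces lies in the disc where zeros
     are unique. *)
  destruct (list_min r L) as (e0 & He0 & Be0); [intros p Hp; apply Hr, Hp|].
  destruct (persist_list (INR M) L ltac:(lra) NDL ZL e0 He0) as (d0 & Hd0 & B0).
  assert (Fex : forall m, exists f : C -> C, Rabs (m - INR M) < d0 ->
     (forall p, In p L -> Cmod (f p - p)%C < e0 /\ H_zero m (f p)) /\ NoDup (map f L)).
  { intros m. destruct (classic (Rabs (m - INR M) < d0)) as [I|N]; [|exists (fun p => p); tauto].
    destruct (B0 m I) as [f Hf]. exists f. auto. }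
  destruct (choice _ Fex) as [f Hf].
  (* Near 2n + 1 the zeros are listed in the order of L, so the index j keeps following the same
     root; elsewhere any listing serves. *)
  set (lst := fun m => if Rlt_dec (Rabs (m - INR M)) d0 then map (f m) L else le m).
  assert (Hlst : forall m, 2 * INR n - 1 < m < 2 * INR n + 1 -> enumZ m (lst m) /\ length (lst m) = (2 * n)%nat).
  { intros m Hm. unfold lst. destruct (Rlt_dec (Rabs (m - INR M)) d0) as [C|C]; [|apply Hle, Hm].
    destruct (Hf m C) as [F1 F2]. destruct (Hle m Hm) as [[N1 E1] Len].
    rewrite length_map. split; auto. split; auto.
    (* The continued zeros are 2n distinct members of the complete list [le m] of length 2n, so they
       exhaust it. *)
    assert (I1 : incl (map (f m) L) (le m)).
    { intros w Hw. apply in_map_iff in Hw. destruct Hw as (p & <- & Hp). apply E1, F1, Hp. }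
    intros w. split; intros Hw.
    - apply (NoDup_length_incl (l' := le m) F2); auto; [rewrite length_map; lia|]. apply E1, Hw.
    - apply E1, I1, Hw. }
  assert (Enu : nu_ n - 1/2 = INR M) by (unfold nu_; lra).
  exists (fun (nu : R) (j : nat) => (/ 2 * nth j (lst (nu - 1/2)%R) 0)%C). split.
  - intros nu Hnu. unfold nu_ in Hnu.
    destruct (Hlst (nu - 1/2) ltac:(lra)) as [He Len]. rewrite <- Len.
    apply enumerates_list; auto. lra.
  - intros j Hj. set (p := nth j L 0).
    assert (Ip : In p L) by (apply nth_In; lia).
    destruct (HL p Ip) as [Qp NIp].
    assert (E2p : (2 * (/ 2 * p))%C = p) by (field).
    exists (/ 2 * p)%C. split; [|split].
    + apply filterlim_locally. intros eps.
      destruct (Hr p Ip) as (Prp & Uq & Ex).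
      set (e1 := Rmin eps (r p)).
      assert (He1 : 0 < e1) by (apply Rmin_pos; [apply cond_pos|auto]).
      destruct (Ex e1 He1) as (d1 & Hd1 & B1).
      set (d := Rmin (Rmin d0 d1) (r p)).
      assert (Pd : 0 < d) by (repeat apply Rmin_pos; auto).
      exists (mkposreal d Pd). intros nu Hb _. change (Rabs (nu - nu_ n) < d) in Hb.
      replace (nu - nu_ n) with (nu - 1/2 - INR M) in Hb by lra.
      assert (q0 : Rabs (nu - 1/2 - INR M) < d0) by (eapply Rlt_le_trans; [apply Hb|]; eapply Rle_trans; [apply Rmin_l|apply Rmin_l]).
      assert (q1 : Rabs (nu - 1/2 - INR M) < d1) by (eapply Rlt_le_trans; [apply Hb|]; eapply Rle_trans; [apply Rmin_l|apply Rmin_r]).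
      assert (q2 : Rabs (nu - 1/2 - INR M) < r p) by (eapply Rlt_le_trans; [apply Hb|]; apply Rmin_r).
      destruct (B1 _ q1) as (w & Hw & Zw).
      destruct (Hf _ q0) as [F1 _]. destruct (F1 p Ip) as [F2 F3].
      pose proof (Be0 p Ip) as Bp. pose proof (Rmin_l eps (r p)) as m1. pose proof (Rmin_r eps (r p)) as m2. fold e1 in m1, m2.
      (* f was chosen once at the scale e0, while w is within the arbitrarily small e1 of p;
         uniqueness identifies them, which gives the convergence. *)
      assert (Ew : f (nu - 1/2) p = w) by (apply (Uq (nu - 1/2)); auto; lra).
      assert (En : nth j (lst (nu - 1/2)) 0 = w).
      { unfold lst. destruct (Rlt_dec (Rabs (nu - 1/2 - INR M)) d0) as [|C]; [|contradiction].
        (* The default value 0 is replaced by the image of 0, the form that [map_nth] expects. *)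
        rewrite (nth_indep _ (RtoC 0) (f (nu - 1/2) 0)) by (rewrite length_map; lia).
        rewrite map_nth. exact Ew. }
      rewrite En.
      assert (K : Cmod (/ 2 * w - / 2 * p)%C < eps).
      { replace (/ 2 * w - / 2 * p)%C with (/ 2 * (w - p))%C by ring.
        rewrite Cmod_mult, <- RtoC_inv, Cmod_R, Rabs_pos_eq by lra. pose proof (Cmod_ge_0 (w - p)%C). lra. }
      split.
      * eapply Rle_lt_trans; [apply (re_le_Cmod (/ 2 * w - / 2 * p)%C)|exact K].
      * eapply Rle_lt_trans; [apply (Im_le_Cmod (/ 2 * w - / 2 * p)%C)|exact K].
    + unfold besselK_nu_zero. pose proof (besselK_nu_poly_qC n (/ 2 * p)%C) as E.
      fold M in E. rewrite E2p, Qp in E.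
      apply NNPP. intro N. symmetry in E. revert E. apply Cmult_neq_0; auto.
      intro K. apply RtoC_inj in K. apply Rmult_integral in K. destruct K as [K|K].
      * apply (INR_fact_neq_0 M), K.
      * revert K. apply pow_nonzero. lra.
    + intro E. apply NIp. replace p with (2 * (/ 2 * p))%C by exact E2p.
      replace (Im (2 * (/ 2 * p))%C) with (2 * Im (/ 2 * p)%C) by (unfold Im; simpl; ring). rewrite E. ring.
Qed.
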